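(* Let $0<q_1\le q_2<2$, $\alpha>0$, and let $\varepsilon>0$ be any fixed number. Put $$\delta:=\frac1{q_1}-\frac1{q_2},\qquad \beta:=\frac1{q_1}\,\frac{\alpha}{\alpha+\delta}.$$ Let $(\xi_n)_{n\in\mathbb N}$ be a sequence of increasing positive numbers such that $$\xi_n\le n<2\xi_n\ \text{ if }\alpha\le 1/q_2,\qquad \xi_n^{q_1(\alpha+\delta)}\le n<2\,\xi_n^{q_1(\alpha+\delta)}\ \text{ if }\alpha>1/q_2 .$$ Assume that there is a constant $K$ such that $\|P_mv\|_{H_X^{\alpha,1+\varepsilon}}\le K\|v\|_{H_X^{\alpha,1+\varepsilon}}$ for every $v\in H_X^{\alpha,1+\varepsilon}$ and every $m\in\mathbb N$. Then there is a positive constant $C_\varepsilon$, depending only on $\alpha,q_1,q_2,K$ and $\varepsilon$, such that the following holds. For every $n\ge2$, setting $N:=\lceil n/\log n\rceil$, $N_k:=\lfloor N2^{-k}\rfloor$ and $k_N:=\lfloor\log\xi_N\rfloor$, there exist for $k=1,\dots,k_N$ points $\boldsymbol y_{k,1},\dots,\boldsymbol y_{k,N_k}\in U_0$ and functions $h_{k,1},\dots,h_{k,N_k}\in L_2(U,\mathbb C;\mu)$, such that each $S_{N_k}^Xw:=\sum_{i=1}^{N_k}w(\boldsymbol y_{k,i})h_{k,i}$ is an extended weighted least squares sampling algorithm and the operator $$\bar{\mathcal S}^X_nv:=\sum_{k=1}^{k_N}S^X_{N_k}(\delta_kv)$$ satisfies $$\operatorname{Comp}(\bar{\mathcal S}_n^X):=\sum_{k=1}^{k_N}(2^{k-1}+2^{k-2})N_k\le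 n$$ and $$\sup_{v\in B_X^\alpha}\|v-\bar{\mathcal S}^X_nv\|_{L_2(U,X;\mu)}\le\begin{cases}C_\varepsilon\, n^{-\alpha}(\log n)^{\alpha+1/2+\varepsilon}&\text{if }\alpha<1/q_2,\\ C_\varepsilon\, n^{-\alpha}(\log n)^{\alpha+3/2+\varepsilon}&\text{if }\alpha=1/q_2,\\ C_\varepsilon\, n^{-\beta}(\log n)^{1+\beta(1+\frac1{2\alpha})+\varepsilon\beta/\alpha}&\text{if }\alpha>1/q_2.\end{cases}$$
   Context: $\log$ is the logarithm to base $2$. $(U,\mathcal A,\mu)$ is a probability space with $U$ a separable topological space; $X$ is a separable complex Hilbert space; $L_2(U,X;\mu)$ is the Bochner space of strongly $\mu$-measurable, square $\mu$-integrable mappings from $U$ to $X$; $L_2(U,\mathbb C;\mu)$ and $L_2(U,X;\mu)$ are separable complex Hilbert spaces. $(\varphi_s)_{s\in\mathbb N}$ is a fixed orthonormal basis of $L_2(U,\mathbb C;\mu)$; for $v\in L_2(U,X;\mu)$ put $v_s:=\int_Uv\,\overline{\varphi_s}\,d\mu\in X$, so $v=\sum_sv_s\varphi_s$. For $i=1,2$, $\boldsymbol\sigma_i=(\sigma_{i;s})_{s\in\mathbb N}$ is a non-decreasing sequence of numbers strictly larger than $1$ with $\boldsymbol\sigma_i^{-1}:=(\sigma_{i;s}^{-1})_s\in\ell_{q_i}(\mathbb N)$. Put $\|v\|_{H_{X,\boldsymbol\sigma_i}}:=\big(\sum_s(\sigma_{i;s}\|v_s\|_X)^2\big)^{1/2}$.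 $(V_k)_{k\in\mathbb N}$ is a given sequence of subspaces of $X$ with $\dim V_k=2^{k-1}$, and $(P_k)_{k\in\mathbb N}$ is a given sequence of uniformly bounded linear projectors from $X$ onto $V_k$ (the $V_k$ need not be nested, the $P_k$ need not be orthogonal), extended to $L_2(U,X;\mu)$ by $(P_kv)(\boldsymbol y):=P_k(v(\boldsymbol y))$. Put $\delta_1v:=P_1v$ and $\delta_kv:=P_kv-P_{k-1}v$ for $k\ge2$ (operators, not to be confused with the number $\delta$). $H_X^\alpha$ is the space of $v\in L_2(U,X;\mu)$ with finite norm $\|v\|_{H_X^\alpha}:=\big(\|v\|_{H_{X,\boldsymbol\sigma_1}}^2+\sup_{k\in\mathbb N}(2^{\alpha k}\|v-P_kv\|_{H_{X,\boldsymbol\sigma_2}})^2\big)^{1/2}$, and $B_X^\alpha$ is its unit ball. For $\tau>0$, $H_X^{\alpha,\tau}$ is the space of $v\in L_2(U,X;\mu)$ with finite norm $\|v\|_{H_X^{\alpha,\tau}}:=\big(\|v\|^2_{H_{X,\boldsymbol\sigma_1}}+\sum_{k\in\mathbb N}(2^{\alpha k}k^{-\tau}\|v-P_kv\|_{H_{X,\boldsymbol\sigma_2}})^2\big)^{1/2}$. $U_0\subset U$ is a fixed set of full measure on which pointwise evaluations of functions in these spaces are well defined, through the expansion $v(\boldsymbol y)=\sum_sv_s\varphi_s(\boldsymbol y)$. Sample points may coincide. Extended weighted least squares sampling algorithm: given points $\boldsymbol y_1,\dots,\boldsymbol y_l\in U_0$, weights $\omega_1,\dots,\omega_l\ge0$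 and $\Phi_m=\operatorname{span}\{\varphi_1,\dots,\varphi_m\}$ with $m\le l$, let $\boldsymbol L=[\varphi_s(\boldsymbol y_i)]_{i\le l,\,s\le m}$ and $\boldsymbol W=\operatorname{diag}(\omega_1,\dots,\omega_l)$. For scalar $f$ define $S_l^{\mathbb C}f=\sum_{s=1}^m\hat g_s\varphi_s$ with $(\hat g_s)_s=(\boldsymbol W^{1/2}\boldsymbol L)^+\boldsymbol W^{1/2}(f(\boldsymbol y_i))_i$ ($^+$ is the Moore–Penrose inverse), which minimizes $\sum_i\omega_i|f(\boldsymbol y_i)-g(\boldsymbol y_i)|^2$ over $g\in\Phi_m$. Writing $S_l^{\mathbb C}f=\sum_if(\boldsymbol y_i)h_i$, the extension to $X$-valued $w$ is $S_l^Xw:=\sum_iw(\boldsymbol y_i)h_i$. The quantity $\operatorname{Comp}$ is by definition the sum displayed in the claim.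
   Formalization: The constant C_ε may depend, besides α, q_1, q_2, K and ε, on upper bounds for the ℓ_{q_i}-(quasi)norms of σ_i^{-1}, i=1,2; a constant uniform over all sequences σ_1, σ_2 does not exist. *)

(* Defs.v *)
From HB Require Import structures.
From mathcomp Require Import all_boot all_order all_algebra.
From mathcomp Require Import all_classical all_reals all_analysis.
From mathcomp Require Export complex.

Set Implicit Arguments.
Unset Strict Implicit.
Unset Printing Implicit Defensive.

Import Order.TTheory GRing.Theory Num.Theory.
Import numFieldNormedType.Exports.

Local Open Scope classical_set_scope.
Local Open Scope ring_scope.
Local Open Scope complex_scope.

(* No compatibility between the two structures is required. *)
#[short(type="topMeasurableType")]
HB.structure Definition TopMeasurable d :=
  {T of Measurable d T & Topological T}.

Definition separable_space (T : topologicalType) : Prop :=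
  exists2 D : set T, countable D & dense D.

Definition log2 (R : realType) (x : R) : R := ln x / ln 2.

(* A norm on a module over R[i] takes its values in R[i] (on the nonnegative
   real axis); nrm is its value in R. *)
Definition nrm (R : realType) (X : normedModType R[i]) (x : X) : R :=
  complex.Re `|x|.

Section Bochner.
Context d (U : measurableType d) (R : realType) (mu : probability U R).
Context (X : normedModType R[i]).
Implicit Types (f v : U -> X) (phi : nat -> U -> R[i]) (sigma : nat -> R).

Definition simple_fun f : Prop :=
  finite_set (range f) /\ forall x, measurable (f @^-1` [set x]).

Definition simple_integral f : X :=
  \sum_(x \in range f) (fine (mu (f @^-1` [set x])))%:C *: x.

Definition strongly_measurable f : Prop :=
  exists2 g : nat -> U -> X, (forall n, simple_fun (g n)) &
    {ae mu, forall u, g n u @[n --> \oo] --> f u}.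

Definition is_bochner_integral f (x : X) : Prop :=
  strongly_measurable f /\
  exists g : nat -> U -> X, [/\ forall n, simple_fun (g n),
    (\int[mu]_u (nrm (f u - g n u))%:E)%E @[n --> \oo] --> 0%E &
    simple_integral (g n) @[n --> \oo] --> x].

(* Equal to 0 when f is not Bochner integrable. *)
Definition bochner_integral f : X := xget 0 [set x | is_bochner_integral f x].

Definition L2norm f : \bar R :=
  ((\int[mu]_u ((nrm (f u)) ^+ 2)%:E) `^ 2^-1)%E.

(* Elements of L_2(U, X; mu) are handled through representatives. *)
Definition L2 : set (U -> X) :=
  [set f | strongly_measurable f /\ (L2norm f < +oo)%E].

(* phi 0, phi 1, ... and sigma 0, sigma 1, ... stand for the sequences
   phi_1, phi_2, ... and sigma_1, sigma_2, ... indexed by positive integers. *)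
Definition coef phi v (s : nat) : X :=
  bochner_integral (fun u => Num.conj (phi s u) *: v u).

Definition pt_series phi v (y : U) (n : nat) : X :=
  \sum_(s < n) phi s y *: coef phi v s.

(* Pointwise evaluation through the expansion of v; it depends only on the
   class of v in L_2(U, X; mu), unlike v y. *)
Definition pt_eval phi v (y : U) : X := lim (pt_series phi v y n @[n --> \oo]).

Definition Hnorm phi sigma v : \bar R :=
  ((\sum_(0 <= s <oo) ((sigma s * nrm (coef phi v s)) ^+ 2)%:E) `^ 2^-1)%E.

(* Only the values P k with 1 <= k are used. *)
Definition Hanorm phi sigma1 sigma2 (P : nat -> X -> X) (alpha : R) v : \bar R :=
  ((Hnorm phi sigma1 v ^+ 2 +
    (ereal_sup [set ((2 `^ (alpha * k%:R))%:E *
                     Hnorm phi sigma2 (v \- (P k \o v))%R)%E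
               | k in [set k | (1 <= k)%N]]) ^+ 2) `^ 2^-1)%E.

Definition Hatnorm phi sigma1 sigma2 (P : nat -> X -> X) (alpha tau : R) v
    : \bar R :=
  ((Hnorm phi sigma1 v ^+ 2 +
    \sum_(1 <= k <oo) ((2 `^ (alpha * k%:R) * k%:R `^ (- tau))%:E *
                       Hnorm phi sigma2 (v \- (P k \o v))%R) ^+ 2) `^ 2^-1)%E.

Definition Haball phi sigma1 sigma2 (P : nat -> X -> X) (alpha : R)
    : set (U -> X) :=
  [set v | L2 v /\ (Hanorm phi sigma1 sigma2 P alpha v <= 1)%E].

Definition Hatspace phi sigma1 sigma2 (P : nat -> X -> X) (alpha tau : R)
    : set (U -> X) :=
  [set v | L2 v /\ (Hatnorm phi sigma1 sigma2 P alpha tau v < +oo)%E].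

Definition evaluation_domain phi sigma1 sigma2 (U0 : set U) : Prop :=
  mu.-negligible (~` U0) /\
  forall v, L2 v ->
    (Hnorm phi sigma1 v < +oo)%E \/ (Hnorm phi sigma2 v < +oo)%E ->
    forall y, U0 y -> cvg (pt_series phi v y n @[n --> \oo]).

Definition samp_op phi (l : nat) (y : nat -> U) (h : nat -> U -> R[i])
    (w : U -> X) : U -> X :=
  fun u => \sum_(i < l) h i u *: pt_eval phi w (y i).

End Bochner.

Definition L2C d (U : measurableType d) (R : realType) (mu : probability U R)
  : set (U -> R[i]) := @L2 d U R mu R[i]^o.

Definition orthonormal_basis d (U : measurableType d) (R : realType)
    (mu : probability U R) (phi : nat -> U -> R[i]) : Prop :=
  [/\ forall s, L2C mu (phi s),
      forall s t, coef mu phi (phi s : U -> R[i]^o) t = (s == t)%:R &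
      forall f : U -> R[i]^o, L2 mu f ->
        L2norm mu (fun u => f u - pt_series mu phi f u n) @[n --> \oo]
          --> 0%E].

Definition lq_norm (R : realType) (q : R) (a : nat -> R) : \bar R :=
  ((\sum_(0 <= s <oo) (`|a s| `^ q)%:E) `^ q^-1)%E.

(* In particular, V is a linear subspace. *)
Definition has_dimension (K : fieldType) (X : lmodType K) (V : set X) (n : nat)
    : Prop :=
  exists b : 'I_n -> X,
    (forall c : 'I_n -> K, \sum_i c i *: b i = 0 -> forall i, c i = 0) /\
    V = range (fun c : 'I_n -> K => \sum_i c i *: b i).

Definition projectors (R : realType) (X : normedModType R[i])
    (V : nat -> set X) (P : nat -> {linear X -> X}) : Prop :=
  [/\ forall k, (1 <= k)%N -> range (P k) = V k,
      forall k, (1 <= k)%N -> forall x, P k (P k x) = P k x &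
      exists B : R, forall k, (1 <= k)%N -> forall x, nrm (P k x) <= B * nrm x].

Definition delta_op (X : zmodType) (P : nat -> X -> X) (k : nat) (x : X) : X :=
  if k == 1%N then P 1%N x else P k x - P k.-1 x.

(* This is not mathcomp's pinvmx, which satisfies only the first equation. *)
Definition moore_penrose (C : numClosedFieldType) (m n : nat)
    (A : 'M[C]_(m, n)) (G : 'M[C]_(n, m)) : Prop :=
  [/\ A *m G *m A = A, G *m A *m G = G,
      map_mx Num.conj (A *m G)^T = A *m G &
      map_mx Num.conj (G *m A)^T = G *m A].

(* The functions h i represent the scalar weighted least squares algorithm
   with points y i, weights omega i (i < l) and approximation space
   span (phi 0, ..., phi (m - 1)), for some admissible m and omega. *)
Definition weighted_least_squares (U : Type) (R : realType)
    (phi : nat -> U -> R[i]) (l : nat) (y : nat -> U) (h : nat -> U -> R[i])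
    : Prop :=
  exists (m : nat) (omega : 'I_l -> R) (G : 'M[R[i]]_(m, l)),
    let L := \matrix_(i < l, s < m) phi s (y i) in
    let Wsqrt := diag_mx (\row_(i < l) (Num.sqrt (omega i))%:C) in
    [/\ (1 <= m <= l)%N, forall i, 0 <= omega i, moore_penrose (Wsqrt *m L) G &
        forall (f : U -> R[i]) u,
          \sum_(i < l) f (y i) * h i u =
          \sum_(s < m) (G *m (Wsqrt *m \col_i f (y i))) s 0 * phi s u].

Definition comp_cost (R : realType) (kN : nat) (Nk : nat -> nat) : R :=
  \sum_(1 <= k < kN.+1) (2 ^ (k%:Z - 1) + 2 ^ (k%:Z - 2)) * (Nk k)%:R.

(* The operator v |-> sum_{k = 1}^{kN} S_{Nk k}^X (delta_k v). *)
Definition multilevel_op d (U : measurableType d) (R : realType)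
    (mu : probability U R) (X : normedModType R[i]) (phi : nat -> U -> R[i])
    (P : nat -> X -> X) (kN : nat) (Nk : nat -> nat) (y : nat -> nat -> U)
    (h : nat -> nat -> U -> R[i]) (v : U -> X) : U -> X :=
  fun u => \sum_(1 <= k < kN.+1)
    samp_op mu phi (Nk k) (y k) (h k) (delta_op P k \o v) u.

(* Main.v *)
Require Import Defs.
From HB Require Import structures.
From mathcomp Require Import all_boot all_order all_algebra.
From mathcomp Require Import all_classical all_reals all_analysis.
From mathcomp Require Import measurable_realfun.
From mathcomp Require Import ring lra zify.
Set Implicit Arguments.
Unset Strict Implicit.
Unset Printing Implicit Defensive.
Import Order.TTheory GRing.Theory Num.Theory.
Import numFieldNormedType.Exports.

(** The heart of the proof is a sampling bound that loses no logarithm.  If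
    sigma is nondecreasing, greater than 1, and sigma^-1 is in l_q with q < 2,
    then for every l there are l points and weights for which the weighted
    least squares operator S on about l / 16 basis functions satisfies
      ||w - S w|| <= c l^(-1/q) ||w||_(H_sigma),
    with c depending only on q and on the l_q bound ([sampling_rate]).

    Such points come from the barrier method of Batson, Spielman and
    Srivastava, applied to the measure mu itself ([sparsification],
    [stable_sample_exists]).  Write eta for a number of order m^(-2/q).  One
    looks for 16 m points y_i and weights t_i > 0 such that
    sum_i t_i |g(y_i)|^2 >= m ||g||^2 when g is spanned by the first m basis
    functions, while sum_i t_i |f(y_i)|^2 <= 66 m eta ||f||^2_(H_sigma) when f
    is spanned by the others.  Points are added one at a time, and each new
    point must keep two barrier potentials, traces of inverses of positive
    matrices, at most 1.  An admissible point exists because the inequality that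
    it must satisfy holds after integration over mu: by orthonormality the
    rank-one matrices of the samples have diagonal means, so the means of the
    quadratic forms are the traces that the barriers control
    ([select_point]).  The second family is infinite; a finite block of it is
    handled by the upper barrier, and the remainder, whose weighted energy has
    mean at most eta, enters through one additional scalar load.  Least squares
    reproduces the first m coefficients and is stable, so its error is the
    fit of the tail plus the tail itself ([wls_error]).

    All this has to hold for X-valued functions.  Positive matrices act on
    tuples of vectors of X through [vform], so the matrix inequalities carry
    over from scalars to X; and the norm of a function is bounded by its
    coefficients ([parseval_le]) because simple functions are dense and
    Bessel's inequality holds in X as well.  Identities between Bochner
    integrals are verified by pairing with vectors.

    The multilevel estimate then balances two bounds for delta_k v.  The unit
    ball of H^alpha has norm at most 2 in H^(alpha,1+eps), so the assumption on
    the P_m bounds delta_k v in H_(sigma_1) uniformly in k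
    ([level_diff_coef1]), and the definition of H^alpha bounds it in
    H_(sigma_2) by a multiple of 2^(-alpha k) ([level_diff_coef2]).  With
    N_k ~ N 2^(-k) samples the error at level k is a multiple of
      2^(k/q1) N^(-1/q1)   or   2^(-alpha k) 2^(k/q2) N^(-1/q2).
    The first bound increases with k, and for alpha > 1/q2 the second one
    decreases; they meet at 2^(k (alpha + delta)) = N^delta, where both equal
    N^(-beta).  For alpha <= 1/q2 the second bound is used from k = 2 on, and
    the terms form a geometric series, or are all equal.  Summing over the at
    most log n levels ([level_sum_rate]) and using N >= n / log n gives the
    rates. *)

Local Open Scope ring_scope.
Local Open Scope sesquilinear_scope.

Lemma eq_le_of d (T : porderType d) (x y : T) : x = y -> (x <= y)%O.
Proof. by move->. Qed.

(** * Positive semidefinite matrices *)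

Section PositiveMatrices.
Context {C : numClosedFieldType}.

Definition qform n (Q : 'M[C]_n) (x : 'cV[C]_n) : C := (x ^t* *m Q *m x) 0 0.

Definition psd n (Q : 'M[C]_n) : Prop := Q ^t* = Q /\ forall x, 0 <= qform Q x.

Lemma adjM m n p (A : 'M[C]_(m, n)) (B : 'M[C]_(n, p)) :
  (A *m B) ^t* = B ^t* *m A ^t*.
Proof. by rewrite trmx_mul map_mxM. Qed.

Lemma adjD m n (A B : 'M[C]_(m, n)) : (A + B) ^t* = A ^t* + B ^t*.
Proof. by rewrite linearD /= map_mxD. Qed.

Lemma adjN m n (A : 'M[C]_(m, n)) : (- A) ^t* = - A ^t*.
Proof. by rewrite linearN /= map_mxN. Qed.

Lemma adjZ m n (a : C) (A : 'M[C]_(m, n)) : (a *: A) ^t* = a^* *: A ^t*.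
Proof. by rewrite linearZ /= map_mxZ. Qed.

Lemma adj_scalar n (a : C) : (a%:M : 'M[C]_n) ^t* = (a^*)%:M.
Proof. by rewrite tr_scalar_mx map_scalar_mx. Qed.

Lemma adj_inv n (A : 'M[C]_n) : (invmx A) ^t* = invmx (A ^t*).
Proof. by rewrite trmx_inv map_invmx. Qed.

Lemma adj_mul_ge0 m n (E : 'M[C]_(m, n)) i : 0 <= (E ^t* *m E) i i.
Proof.
by rewrite mxE; apply: sumr_ge0 => k _; rewrite !mxE mulrC mul_conjC_ge0.
Qed.

Lemma mxtrace_adj_mul m n (E : 'M[C]_(m, n)) :
  \tr (E ^t* *m E) = \sum_i \sum_k `|E k i| ^+ 2.
Proof.
apply: eq_bigr => i _; rewrite mxE; apply: eq_bigr => k _.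
by rewrite !mxE mulrC normCK.
Qed.

Lemma qform_gram m n (E : 'M[C]_(m, n)) x :
  qform (E ^t* *m E) x = ((E *m x) ^t* *m (E *m x)) 0 0.
Proof. by rewrite /qform adjM !mulmxA. Qed.

Lemma psd_gram m n (E : 'M[C]_(m, n)) : psd (E ^t* *m E).
Proof.
split; first by rewrite adjM trmxCK.
by move=> x; rewrite qform_gram adj_mul_ge0.
Qed.

Lemma psd_herm n (Q : 'M[C]_n) : psd Q -> Q \is hermsymmx.
Proof. by case=> hQ _; apply/is_hermitianmxP; rewrite expr0 scale1r hQ. Qed.

Lemma qform_tr n (Q : 'M[C]_n) x : qform Q x = \tr (Q *m (x *m x ^t*)).
Proof. by rewrite mulmxA mxtrace_mulC mulmxA /mxtrace big_ord1. Qed.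

Lemma qformD n (P Q : 'M[C]_n) x : qform (P + Q) x = qform P x + qform Q x.
Proof. by rewrite /qform mulmxDr mulmxDl mxE. Qed.

Lemma qformZ n a (Q : 'M[C]_n) x : qform (a *: Q) x = a * qform Q x.
Proof. by rewrite /qform -scalemxAr -scalemxAl mxE. Qed.

Lemma psdD n (P Q : 'M[C]_n) : psd P -> psd Q -> psd (P + Q).
Proof.
move=> [hP pP] [hQ pQ]; split; first by rewrite adjD hP hQ.
by move=> x; rewrite qformD addr_ge0.
Qed.

Lemma psdZ n a (Q : 'M[C]_n) : 0 <= a -> psd Q -> psd (a *: Q).
Proof.
move=> a0 [hQ pQ]; split; last by move=> x; rewrite qformZ mulr_ge0.
by rewrite adjZ hQ; congr (_ *: _); apply: CrealP; apply: ger0_real.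
Qed.

Lemma psd_congr m n (B : 'M[C]_(m, n)) (Q : 'M[C]_m) :
  psd Q -> psd (B ^t* *m Q *m B).
Proof.
move=> [hQ pQ]; split; first by rewrite !adjM trmxCK hQ mulmxA.
by move=> x; have := pQ (B *m x); rewrite /qform adjM !mulmxA.
Qed.

Lemma psd_scalar n (a : C) : 0 <= a -> psd (a%:M : 'M[C]_n).
Proof.
move=> a0; rewrite -[a%:M]mulmx1 mul_scalar_mx; apply: psdZ => //.
by rewrite -[1%:M]mul1mx -{1}(conjC1 C) -adj_scalar; apply: psd_gram.
Qed.

Lemma psd_inv n (Q : 'M[C]_n) : Q \in unitmx -> psd Q -> psd (invmx Q).
Proof.
move=> uQ pQ; have [hQ _] := pQ.
have -> : invmx Q = (invmx Q) ^t* *m Q *m invmx Q.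
  by rewrite adj_inv hQ mulVmx // mul1mx.
exact: psd_congr.
Qed.

Lemma psd_spectral n (Q : 'M[C]_n) : psd Q ->
  exists (V : 'M[C]_n) (d : 'rV[C]_n), [/\ V *m V ^t* = 1%:M, V ^t* *m V = 1%:M,
    forall i, 0 <= d 0 i & Q = V ^t* *m diag_mx d *m V].
Proof.
move=> pQ; have hQ := psd_herm pQ.
have /orthomx_spectralP := hermitian_normalmx hQ.
set V := spectralmx Q; set d := spectral_diag Q => eQ.
have uV := spectral_unitarymx Q.
have V1 : V *m V ^t* = 1%:M by apply/unitarymxP.
have V2 : V ^t* *m V = 1%:M by apply/mulmx1C.
rewrite invmx_unitary // in eQ.
exists V, d; split=> // i.
have := pQ.2 (V ^t* *m delta_mx i 0).
rewrite /qform eQ adjM trmxCK !mulmxA -[_ *m V *m V ^t*]mulmxA V1 mulmx1.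
rewrite -[_ *m V *m V ^t*]mulmxA V1 mulmx1.
rewrite -mulmxA mul_diag_mx mxE (bigD1 i) //= big1.
  by rewrite addr0 !mxE !eqxx conjC1 mul1r mulr1.
by move=> j ji; rewrite !mxE (negPf ji) /= mulr0 mulr0.
Qed.

Lemma psd_factor n (Q : 'M[C]_n) : psd Q -> exists E : 'M[C]_n, Q = E ^t* *m E.
Proof.
move=> /psd_spectral [V [d [_ _ d0 ->]]].
exists (diag_mx (map_mx sqrtC d) *m V).
rewrite adjM !mulmxA; congr (_ *m V); rewrite -!mulmxA; congr (_ *m _).
rewrite tr_diag_mx map_diag_mx mulmx_diag; congr diag_mx.
apply/rowP => j; rewrite !mxE /=.
rewrite conj_Creal ?ger0_real ?sqrtC_ge0 //.
by rewrite -expr2 sqrtCK.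
Qed.

Lemma psd_diag n (v : 'rV[C]_n) :
  (forall i, 0 <= v 0 i) -> psd (diag_mx v).
Proof.
move=> v0; have -> : diag_mx v =
    (diag_mx (map_mx sqrtC v)) ^t* *m diag_mx (map_mx sqrtC v).
  rewrite tr_diag_mx map_diag_mx mulmx_diag; congr diag_mx.
  apply/rowP => j; rewrite !mxE /= conj_Creal ?ger0_real ?sqrtC_ge0 //.
  by rewrite -expr2 sqrtCK.
exact: psd_gram.
Qed.

(** With P = E^* E, the trace of P Q is that of E Q E^*. *)
Lemma psd_tr_ge0 n (P Q : 'M[C]_n) : psd P -> psd Q -> 0 <= \tr (P *m Q).
Proof.
move=> /psd_factor [E ->] pQ.
have [F eF] := psd_factor (psd_congr (E ^t*) pQ).
rewrite trmxCK in eF; rewrite -mulmxA mxtrace_mulC eF.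
by rewrite mxtrace_adj_mul; do 2!apply: sumr_ge0 => ? _; rewrite exprn_ge0.
Qed.

Lemma psd1 n : psd (1%:M : 'M[C]_n).
Proof. exact: psd_scalar ler01. Qed.

Lemma psd_tr_self_ge0 n (Q : 'M[C]_n) : psd Q -> 0 <= \tr Q.
Proof. by move=> pQ; rewrite -[Q]mulmx1; apply: psd_tr_ge0 (psd1 n). Qed.

Lemma psd_addr_unit n (Q : 'M[C]_n) a : 0 < a -> psd Q -> Q + a%:M \in unitmx.
Proof.
move=> a0 /psd_spectral [V [d [V1 V2 d0 ->]]].
have -> : a%:M = V ^t* *m diag_mx (const_mx a) *m V :> 'M[C]_n.
  by rewrite diag_const_mx -mulmxA mul_scalar_mx -scalemxAr V2 scalemx1.
rewrite -mulmxDl -mulmxDr -linearD /= unitmx_mul unitmx_mul.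
have uV : V \in unitmx by case: (mulmx1_unit V1).
have uV' : V ^t* \in unitmx by case: (mulmx1_unit V1).
rewrite uV uV' /= andbT unitmxE det_diag unitfE.
by apply/prodf_neq0 => i _; rewrite !mxE gt_eqF // ltr_wpDl.
Qed.

(** Every eigenvalue of Q has an inverse bounded by the trace of Q^-1. *)
Lemma psd_inv_trace_le1 n (Q : 'M[C]_n) : Q \in unitmx -> psd Q ->
  \tr (invmx Q) <= 1 -> psd (Q - 1%:M).
Proof.
move=> uQ /psd_spectral [V [d [V1 V2 d0 eQ]]].
have uV : V \in unitmx by case: (mulmx1_unit V1).
have uV' : V ^t* \in unitmx by case: (mulmx1_unit V1).
have dgt0 i : 0 < d 0 i.
  rewrite lt_def d0 andbT; move: uQ.
  rewrite eQ !unitmx_mul uV uV' andbT /= unitmxE det_diag unitfE.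
  by move=> /prodf_neq0 /(_ i isT).
have -> : invmx Q = V ^t* *m diag_mx (map_mx GRing.inv d) *m V.
  have e1 : Q *m (V ^t* *m diag_mx (map_mx GRing.inv d) *m V) = 1%:M.
    rewrite eQ !mulmxA -[_ *m V *m V ^t*]mulmxA V1 mulmx1.
    rewrite -[_ *m diag_mx d *m _]mulmxA mulmx_diag -[RHS]V2.
    congr (_ *m V); rewrite -[RHS]mulmx1; congr (_ *m _); rewrite -diag_const_mx.
    congr diag_mx; apply/rowP => j; rewrite !mxE mulfV // gt_eqF //.
  by rewrite -[LHS]mulmx1 -e1 mulKmx.
rewrite mxtrace_mulC mulmxA V1 mul1mx mxtrace_diag => trle.
have dge1 i : 1 <= d 0 i.
  rewrite -[1 <= _]lef_pV2 ?posrE // invr1; apply: le_trans trle.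
  rewrite (bigD1 i) //= !mxE lerDl; apply: sumr_ge0 => j _.
  by rewrite !mxE invr_ge0.
have -> : Q - 1%:M = V ^t* *m diag_mx (d - const_mx 1) *m V.
  by rewrite linearB /= mulmxBr mulmxBl -eQ diag_const_mx mulmx1 V2.
apply: psd_congr.
by apply: psd_diag => i; rewrite !mxE subr_ge0 dge1.
Qed.

(** The Sherman--Morrison formula. *)
Lemma rank_one_update n (Q M : 'M[C]_n) (v : 'cV[C]_n) c :
  Q *m M = 1%:M -> 1 + c * qform M v != 0 ->
  (Q + c *: (v *m v ^t*)) *m
  (M - (c / (1 + c * qform M v)) *: (M *m (v *m v ^t*) *m M)) = 1%:M.
Proof.
move=> QM q0; set q := qform M v in q0 *.
have vMv : v ^t* *m M *m v = q%:M.
  by apply/matrixP => i j; rewrite !ord1 -/(qform M v) mxE.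
set d := c / (1 + c * q); set W := v *m v ^t*.
have WMW : W *m M *m W = q *: W.
  by rewrite /W !mulmxA -[v *m _ *m M]mulmxA -[v *m _ *m v]mulmxA vMv
    mul_mx_scalar -scalemxAl.
clearbody W; rewrite mulmxBr !mulmxDl QM -scalemxAl.
rewrite -2!scalemxAr -scalemxAl.
have -> : Q *m (M *m W *m M) = W *m M by rewrite !mulmxA QM mul1mx.
have -> : W *m (M *m W *m M) = q *: (W *m M).
  by rewrite !mulmxA WMW -scalemxAl.
rewrite -addrA -[RHS]addr0; congr (_ + _).
rewrite !scalerA -scalerDl -scalerBl.
apply/eqP; rewrite scaler_eq0; apply/orP; left; apply/eqP.
by rewrite /d; field.
Qed.

End PositiveMatrices.

(** * Barrier potentials *)

Section Barriers.
Context {C : numClosedFieldType}.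

Lemma psd_rank_one n (v : 'cV[C]_n) : psd (v *m v ^t*).
Proof. by rewrite -[v in v *m _]trmxCK; apply: psd_gram. Qed.

Lemma psd_unit_tr_gt0 n (Q : 'M[C]_n) : (0 < n)%N -> Q \in unitmx -> psd Q ->
  0 < \tr Q.
Proof.
move=> n0 uQ pQ; rewrite lt_def psd_tr_self_ge0 // andbT.
apply/eqP => tr0; have [E eE] := psd_factor pQ.
have E0 : E = 0.
  apply/matrixP => i j; rewrite mxE; move: tr0; rewrite eE mxtrace_adj_mul.
  move/psumr_eq0P => /(_ _ j isT) tr0.
  have /psumr_eq0P -/(_ _ i isT) := tr0 (fun _ _ => sumr_ge0 _ (fun _ _ => exprn_ge0 _ (normr_ge0 _))).
  by move=> /(_ (fun _ _ => exprn_ge0 _ (normr_ge0 _))) /eqP; rewrite expf_eq0 /= normr_eq0 => /eqP.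
move: uQ; rewrite eE E0 mulmx0 unitmxE.
by case: n n0 {Q pQ E eE E0 tr0} => // n _; rewrite det0 unitr0.
Qed.

Lemma psd_mul_self n (Q : 'M[C]_n) : psd Q -> psd (Q *m Q).
Proof. by case=> hQ _; rewrite -{1}hQ; apply: psd_gram. Qed.

Lemma psd_sandwich n (Q P : 'M[C]_n) : psd Q -> psd P -> psd (Q *m P *m Q).
Proof. by move=> [hQ _] pP; rewrite -{1}hQ; apply: psd_congr. Qed.

Lemma invmxE n (Q M : 'M[C]_n) : Q *m M = 1%:M -> Q \in unitmx /\ invmx Q = M.
Proof.
move=> QM; have uQ : Q \in unitmx by case: (mulmx1_unit QM).
by split=> //; rewrite -[LHS]mulmx1 -QM mulKmx.
Qed.

(** The resolvent identity, with the factors in both orders. *)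
Lemma resolvent n (S : 'M[C]_n) (d : C) :
  S \in unitmx -> S + d%:M \in unitmx ->
  invmx S - invmx (S + d%:M) = d *: (invmx S *m invmx (S + d%:M)) /\
  invmx S - invmx (S + d%:M) = d *: (invmx (S + d%:M) *m invmx S).
Proof.
move=> uS uS'; set N := invmx S; set M := invmx _.
have ed : d%:M = (S + d%:M) - S by rewrite addrC addKr.
split.
  have -> : d *: (N *m M) = N *m d%:M *m M.
    by rewrite mul_mx_scalar -scalemxAl.
  by rewrite {1}ed mulmxBr mulmxBl mulVmx // mul1mx -mulmxA mulmxV // mulmx1.
have -> : d *: (M *m N) = M *m d%:M *m N by rewrite mul_mx_scalar -scalemxAl.
by rewrite {1}ed mulmxBr mulmxBl mulVmx // mul1mx -mulmxA mulmxV // mulmx1.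
Qed.

(** S measures how far the accumulated sum lies above the lower barrier.  The
    barrier is advanced by d, and a rank-one term must then bring the potential
    tr S^-1 back below 1. *)
Section LowerBarrier.
Variables (n : nat) (S : 'M[C]_n) (d : C).
Hypotheses (n_gt0 : (0 < n)%N) (uS : S \in unitmx) (pS : psd S)
  (trS : \tr (invmx S) <= 1) (d_gt0 : 0 < d) (d_lt1 : d < 1).
Let S' := S - d%:M.
Let N := invmx S.
Let M := invmx S'.

(** The potential bound forces S >= 1, so S - d >= 1 - d > 0. *)
Lemma lower_shift_unit : S' \in unitmx /\ psd S'.
Proof.
have e : S' = (S - 1%:M) + (1 - d)%:M.
  by rewrite /S' raddfB /= addrA subrK.
have p1 := psd_inv_trace_le1 uS pS trS.
have d' : 0 < 1 - d by rewrite subr_gt0.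
by rewrite e; split; [exact: psd_addr_unit | apply: psdD => //;
   apply: psd_scalar; exact: ltW].
Qed.

Let uS' := lower_shift_unit.1.
Let pN : psd N. Proof. exact: psd_inv. Qed.
Let pM : psd M. Proof. exact: psd_inv lower_shift_unit.2. Qed.

Let resM : M - N = d *: (M *m N) /\ M - N = d *: (N *m M).
Proof.
have eS : S = S' + d%:M by rewrite /S' subrK.
by have := @resolvent _ S' d uS'; rewrite -eS => /(_ uS) [-> ->].
Qed.

Let r := \tr (M *m N).

Let trD : \tr M - \tr N = d * r.
Proof. by rewrite -linearB /= resM.1 linearZ. Qed.

Lemma lower_shift_gt0 : 0 < \tr M - \tr N.
Proof.
rewrite trD mulr_gt0 //.
have [F eF] := psd_factor pN.
have uF : F \in unitmx.
  by have := uS; rewrite -unitmx_inv -/N eF unitmx_mul => /andP[].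
have uM : M \in unitmx by rewrite unitmx_inv.
rewrite /r eF mulmxA mxtrace_mulC mulmxA -[F in F *m M]trmxCK.
apply: psd_unit_tr_gt0 => //; last exact: psd_congr.
by rewrite !unitmx_mul uM trmxCK uF /= unitmxE det_map_mx det_tr unitfE
  fmorph_eq0 -unitfE -unitmxE uF.
Qed.

(** The shift raises the potential by d tr(M N).  Since tr N <= 1, the
    Cauchy--Schwarz inequality for the trace form weighted by N gives
    tr(M N)^2 <= tr(M N M), and d tr(M N M) = tr(M M) - tr(M N). *)
Lemma lower_shift_tr :
  (\tr M - \tr N) / d + (\tr M - \tr N) ^+ 2 <= \tr (M *m M).
Proof.
rewrite trD mulrAC divff ?gt_eqF // mul1r.
have e1 : \tr (M *m M) - r = d * \tr (M *m N *m M).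
  by rewrite /r -linearB /= -mulmxBr resM.2 -scalemxAr linearZ /= mulmxA.
rewrite -lerBrDl e1 exprMn expr2 -mulrA ler_pM2l //.
have r0 : 0 <= r by apply: psd_tr_ge0.
have tN0 : 0 <= \tr N by apply: psd_tr_self_ge0.
have r2 : r ^+ 2 <= \tr (M *m N *m M).
  have pX : psd ((M - r%:M) *m N *m (M - r%:M)).
    have {1}-> : M - r%:M = (M - r%:M) ^t*.
      rewrite adjD adjN adj_scalar pM.1; congr (_ - _%:M).
      by rewrite conj_Creal // ger0_real.
    exact: psd_congr.
  have := psd_tr_self_ge0 pX.
  rewrite !mulmxBl !mulmxBr !mul_scalar_mx !mul_mx_scalar -!scalemxAl.
  have trB (P Q : 'M[C]_n) : \tr (P - Q) = \tr P - \tr Q by rewrite raddfB.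
  rewrite !trB !mxtraceZ -[\tr (M *m N)]/r [\tr (N *m M)]mxtrace_mulC -/r.
  move=> h; rewrite -subr_ge0; apply: le_trans h _.
  rewrite -subr_ge0.
  have -> : \tr (M *m N *m M) - r ^+ 2
     - (\tr (M *m N *m M) - r * r - (r * r - r * (r * \tr N)))
     = r ^+ 2 * (1 - \tr N) by ring.
  by rewrite mulr_ge0 ?exprn_ge0 // subr_ge0.
apply: le_trans r2; rewrite ler_piMl ?exprn_ge0 //; exact: ltW.
Qed.

(** By Sherman--Morrison the new term lowers the potential by
    qform (M M) v / (1/t + qform M v), which must cover the increase caused by
    the shift. *)
Lemma lower_add (v : 'cV[C]_n) t : 0 < t ->
  (\tr M - \tr N) * (t^-1 + qform M v) <= qform (M *m M) v ->
  [/\ S' + t *: (v *m v ^t*) \in unitmx, psd (S' + t *: (v *m v ^t*)) &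
     \tr (invmx (S' + t *: (v *m v ^t*))) <= 1].
Proof.
move=> t0 ht.
have q0 : 0 <= qform M v := pM.2 v.
have tq0 : 0 < 1 + t * qform M v by rewrite ltr_wpDr // mulr_ge0 // ltW.
have SM : S' *m M = 1%:M by rewrite mulmxV.
have [uR eR] := invmxE (rank_one_update SM (lt0r_neq0 tq0)).
split=> //.
  by apply: psdD lower_shift_unit.2 _; apply: psdZ (ltW t0) (psd_rank_one v).
rewrite eR linearB /= linearZ /=.
have -> : \tr (M *m (v *m v ^t*) *m M) = qform (M *m M) v.
  by rewrite qform_tr [LHS]mxtrace_mulC !mulmxA.
apply: le_trans trS; rewrite -/N lerBlDr -lerBlDl mulrAC ler_pdivlMr //.
rewrite -(ler_pM2l t0) in ht; apply: le_trans ht; apply: eq_le_of.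
by field; rewrite gt_eqF.
Qed.

End LowerBarrier.

(** T measures how far the accumulated sum lies below the upper barrier, and
    the potential is tr(L T^-1), with L the mean of the rank-one terms.  The
    barrier is advanced by 1. *)
Section UpperBarrier.
Variables (n : nat) (T L : 'M[C]_n).
Hypotheses (n_gt0 : (0 < n)%N) (uT : T \in unitmx) (pT : psd T)
  (uL : L \in unitmx) (pL : psd L) (L1 : psd (1%:M - L))
  (trT : \tr (L *m invmx T) <= 1).
Let T' := T + 1%:M.
Let N := invmx T.
Let M := invmx T'.
Let E := \tr (L *m (M *m M)).

Let uT' : T' \in unitmx. Proof. exact: psd_addr_unit ltr01 pT. Qed.
Let pT' : psd T'. Proof. exact: psdD pT (psd1 _). Qed.
Let pN : psd N. Proof. exact: psd_inv. Qed.
Let pM : psd M. Proof. exact: psd_inv. Qed.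
Let uM : M \in unitmx. Proof. by rewrite unitmx_inv. Qed.

Lemma upper_shift_gt0 : 0 < E.
Proof.
rewrite /E mulmxA mxtrace_mulC mulmxA; apply: psd_unit_tr_gt0 => //.
  by rewrite !unitmx_mul uM uL.
exact: psd_sandwich.
Qed.

(** N - M = M N M + M M: the shift lowers the potential at least by E. *)
Lemma upper_shift_tr : \tr (L *m M) + E <= \tr (L *m N).
Proof.
rewrite -lerBrDl -linearB /= -mulmxBr -subr_ge0 -linearB /= -mulmxBr.
have [e1 e2] := resolvent uT uT'.
have -> : N - M - M *m M = M *m N *m M.
  rewrite e2 scale1r -mulmxBr e1 scale1r mulmxA //.
by apply: psd_tr_ge0 => //; apply: psd_sandwich.
Qed.

(** M L M <= M M because L <= 1; this bounds the mean of the second term in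
    the criterion of [upper_add]. *)
Lemma upper_shift_tr_weighted : \tr (M *m L *m M *m L) <= E.
Proof.
rewrite -subr_ge0 /E.
have -> : \tr (M *m L *m M *m L) = \tr (L *m (M *m L *m M)).
  by rewrite mxtrace_mulC.
rewrite -linearB /= -mulmxBr.
have -> : M *m M - M *m L *m M = M *m (1%:M - L) *m M.
  by rewrite mulmxBr mulmxBl mulmx1.
by apply: psd_tr_ge0 => //; apply: psd_sandwich.
Qed.

Lemma upper_shift_tr_le1 : \tr (M *m L) <= 1.
Proof.
rewrite mxtrace_mulC; apply: le_trans trT; apply: le_trans upper_shift_tr.
by rewrite lerDl ltW // upper_shift_gt0.
Qed.

(** Sherman--Morrison with a subtracted term: the potential grows by
    t w / (1 - t q), where q = qform M b and w = qform (M L M) b, and the gain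
    E of the shift must pay for it. *)
Lemma upper_add (b : 'cV[C]_n) t : 0 < t ->
  qform M b + E^-1 * qform (M *m L *m M) b < t^-1 ->
  [/\ T' - t *: (b *m b ^t*) \in unitmx, psd (T' - t *: (b *m b ^t*)) &
     \tr (L *m invmx (T' - t *: (b *m b ^t*))) <= 1].
Proof.
move=> t0 ht; have E0 := upper_shift_gt0.
set q := qform M b in ht; set w := qform (M *m L *m M) b in ht.
have q0 : 0 <= q := pM.2 b.
have w0 : 0 <= w := (psd_sandwich pM pL).2 b.
have qt : 0 < 1 - t * q.
  rewrite subr_gt0 -ltr_pdivlMl // mulr1; apply: le_lt_trans ht.
  by rewrite lerDl mulr_ge0 // invr_ge0 ltW.
have TM : T' *m M = 1%:M by rewrite mulmxV.
have q1 : 1 + - t * qform M b != 0 by rewrite mulNr lt0r_neq0.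
have := invmxE (rank_one_update TM q1).
rewrite -/q !mulNr !scaleNr opprK => -[uR eR].
have pI : psd (M + (t / (1 - t * q)) *: (M *m (b *m b ^t*) *m M)).
  apply: psdD => //; apply: psdZ; first by rewrite divr_ge0 ?ltW.
  by apply: psd_sandwich => //; apply: psd_rank_one.
split=> //.
  by rewrite -[_ - _]invmxK eR; apply: psd_inv => //; rewrite -eR unitmx_inv.
rewrite eR mulmxDr linearD /= -scalemxAr linearZ /=.
have -> : \tr (L *m (M *m (b *m b ^t*) *m M)) = w.
  by rewrite /w qform_tr !mulmxA [LHS]mxtrace_mulC !mulmxA.
apply: le_trans trT; apply: le_trans upper_shift_tr; rewrite lerD2l.
rewrite mulrAC ler_pdivrMr //.
have : (t * E) * (q + E^-1 * w) <= (t * E) * t^-1.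
  by rewrite ler_pM2l ?mulr_gt0 // ltW.
have -> : (t * E) * t^-1 = E by field; rewrite gt_eqF.
have -> : (t * E) * (q + E^-1 * w) = t * w + E * (t * q).
  by field; rewrite gt_eqF.
by rewrite mulrBr mulr1 lerBrDr.
Qed.

End UpperBarrier.

End Barriers.

(** * Sparsification by barriers *)

Section Sparsification.
Context {C : numClosedFieldType}.
Variables (Y : Type) (good : Y -> Prop) (m D : nat).
Variables (a : Y -> 'cV[C]_m) (b : Y -> 'cV[C]_D) (tau : Y -> C) (L : 'M[C]_D).
Hypotheses (m_gt0 : (0 < m)%N) (D_gt0 : (0 < D)%N).
Hypotheses (uL : L \in unitmx) (pL : psd L) (L1 : psd (1%:M - L))
  (trL : \tr L <= m%:R) (tau_ge0 : forall y, good y -> 0 <= tau y).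
(* The averaging principle: if the rank-one matrices of a and b have means 1
   and L, and tau has mean at most 1, then the last premise compares the means
   of the two sides of the conclusion. *)
Hypothesis select : forall (P1 Q1 : 'M[C]_m) (Q2 : 'M[C]_D) (c : C),
  psd P1 -> psd Q1 -> psd Q2 -> 0 <= c ->
  \tr Q1 + \tr (Q2 *m L) + c * 2 < \tr P1 ->
  exists2 y, good y &
    qform Q1 (a y) + qform Q2 (b y) + c * (tau y + 1) < qform P1 (a y).

Definition barrier_state (S : 'M[C]_m) (T : 'M[C]_D) : Prop :=
  [/\ S \in unitmx, psd S & \tr (invmx S) <= 1] /\
  [/\ T \in unitmx, psd T & \tr (L *m invmx T) <= 1].

Lemma barrier_start : barrier_state (m%:R)%:M (m%:R)%:M.
Proof.
have m0 : (m%:R : C) != 0 by rewrite pnatr_eq0 -lt0n.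
have uS n : ((m%:R)%:M : 'M[C]_n) \in unitmx.
  by rewrite unitmxE det_scalar unitrX // unitfE.
have iS n : invmx ((m%:R)%:M : 'M[C]_n) = (m%:R^-1)%:M.
  have e : (m%:R)%:M *m (m%:R^-1)%:M = 1%:M :> 'M[C]_n.
    by rewrite -scalar_mxM mulfV.
  by case: (invmxE e).
split; split=> //; try exact: psd_scalar.
  by rewrite iS mxtrace_scalar -[_ *+ m]mulr_natr mulVf.
by rewrite iS mul_mx_scalar linearZ /= mulrC ler_pdivrMr ?mul1r // ltr0n.
Qed.

(** Per point, the lower barrier advances by 1/8 and the upper one by 1.  With
    dl the increase of the lower potential under its shift, the averaging
    principle applies because the total demand dl (dl + 1) + 2 dl + 2 dl stays
    below the available 8 dl + dl^2 of [lower_shift_tr]. *)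
Lemma barrier_step S T : barrier_state S T -> exists y t,
  [/\ good y, 0 < t, t * tau y <= 1 &
    barrier_state (S - 8^-1%:M + t *: (a y *m (a y) ^t*))
                  (T + 1%:M - t *: (b y *m (b y) ^t*))].
Proof.
move=> [[uS pS trS] [uT pT trT]].
have d0 : 0 < 8^-1 :> C by rewrite invr_gt0 ltr0n.
have d1 : 8^-1 < 1 :> C by rewrite invf_lt1 ?ltr1n ?ltr0n.
have Dlt0 := lower_shift_gt0 m_gt0 uS pS trS d0 d1.
have Dltr := lower_shift_tr uS pS trS d0 d1.
have ladd := lower_add uS pS trS d1.
have [uS' pS'] := lower_shift_unit uS pS trS d1.
set M := invmx (S - _) in Dlt0 Dltr ladd.
set dl := \tr M - _ in Dlt0 Dltr ladd.
have E0 := upper_shift_gt0 D_gt0 pT uL pL.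
have uadd := upper_add D_gt0 uT pT uL pL trT.
have trw := upper_shift_tr_weighted pT pL L1.
have tr1 := upper_shift_tr_le1 D_gt0 uT pT uL pL trT.
set W := invmx (T + _) in E0 uadd trw tr1.
set E := \tr (L *m _) in E0 uadd trw.
have pM : psd M by exact: psd_inv.
have pW : psd W.
  by apply: psd_inv; [exact: psd_addr_unit ltr01 pT | exact: psdD pT (psd1 _)].
have pWLW : psd (W *m L *m W) by exact: psd_sandwich.
have pU : psd (W + E^-1 *: (W *m L *m W)).
  by apply: psdD => //; apply: psdZ => //; rewrite invr_ge0 ltW.
have [|y gy] := select (psd_mul_self pM) (psdZ (ltW Dlt0) pM)
                       (psdZ (ltW Dlt0) pU) (ltW Dlt0).
  rewrite linearZ /= -scalemxAl linearZ /= mulmxDl linearD /= -scalemxAl linearZ /=.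
  apply: lt_le_trans Dltr.
  have -> : \tr M = dl + \tr (invmx S) by rewrite /dl subrK.
  have h1 : E^-1 * \tr (W *m L *m W *m L) <= 1.
    by rewrite mulrC ler_pdivrMr // mul1r.
  rewrite -!mulrDr invrK ltr_pM2l //.
  apply: (@le_lt_trans _ _ (dl + 1 + (1 + 1) + 2)).
    by rewrite lerD2r lerD ?lerD2l // lerD.
  rewrite -subr_gt0 (_ : _ - _ = 3) ?ltr0n //; ring.
rewrite !qformZ -!mulrDr qformD qformZ => hy.
set u := qform W (b y) + E^-1 * qform (W *m L *m W) (b y) in hy.
have u0 : 0 <= u by have := pU.2 (b y); rewrite qformD qformZ.
have ty0 := tau_ge0 gy.
have s0 : 0 < u + (tau y + 1) by rewrite ltr_wpDl // ltr_wpDl.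
(* Besides the demand u of the upper barrier, 1/t contains the load, so that
   t tau <= 1, and a summand 1, which makes the upper criterion strict. *)
exists y, (u + (tau y + 1))^-1; split=> //; first by rewrite invr_gt0.
  rewrite mulrC ler_pdivrMr // mul1r addrCA lerDl addr_ge0 //.
split; first by apply: ladd; rewrite ?invr_gt0 // invrK addrC addrA; exact: ltW.
by apply: uadd; rewrite ?invr_gt0 // invrK ltrDl ltr_wpDl.
Qed.

(** The lower barrier starts at - m and the upper one at m, which is where the
    potentials of multiples of the identity equal 1 and tr L / m.  After 16 m
    steps the lower barrier stands at - m + 2 m = m, the upper one at
    m + 16 m = 17 m. *)
Theorem sparsification : exists (y : nat -> Y) (t : nat -> C),
  [/\ forall i, (i < 16 * m)%N -> good (y i) /\ 0 < t i,
    psd (\sum_(i < 16 * m) t i *: (a (y i) *m (a (y i)) ^t*) - m%:R%:M),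
    psd ((17 * m)%:R%:M - \sum_(i < 16 * m) t i *: (b (y i) *m (b (y i)) ^t*)) &
    \sum_(i < 16 * m) t i * tau (y i) <= (16 * m)%:R].
Proof.
have iter k : exists (y : nat -> Y) (t : nat -> C),
  [/\ forall i, (i < k)%N -> good (y i) /\ 0 < t i,
    barrier_state
      (\sum_(i < k) t i *: (a (y i) *m (a (y i)) ^t*) + (m%:R - k%:R / 8)%:M)
      ((m + k)%:R%:M - \sum_(i < k) t i *: (b (y i) *m (b (y i)) ^t*)) &
    \sum_(i < k) t i * tau (y i) <= k%:R].
  elim: k => [|k [y [t [gt st tt]]]].
    have [y0 _] := barrier_step barrier_start.
    exists (fun=> y0), (fun=> 1); split=> //; last by rewrite big_ord0.
    by rewrite !big_ord0 add0r mul0r !subr0 addn0; exact: barrier_start.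
  have [y1 [t1 [gy1 t10 tt1 st1]]] := barrier_step st.
  pose upd (X : Type) (f : nat -> X) x i := if i == k then x else f i.
  exists (upd _ y y1), (upd _ t t1).
  have updk X (f : nat -> X) x : upd _ f x k = x by rewrite /upd eqxx.
  have updl X (f : nat -> X) x (i : 'I_k) : upd _ f x i = f i.
    by rewrite /upd ltn_eqF.
  split.
  - move=> i; rewrite ltnS leq_eqVlt /upd; case: eqVneq => //= _; exact: gt.
  - rewrite !big_ord_recr /= !updk.
    under eq_bigr do rewrite !updl.
    under [X in _ - (X + _)]eq_bigr do rewrite !updl.
    move: st1; congr barrier_state.
      have -> : m%:R - k.+1%:R / 8 = m%:R - k%:R / 8 - 8^-1 :> C.
        by rewrite -natr1; field.
      by rewrite [(_ - 8^-1)%:M]raddfB /= [RHS]addrACA -[LHS]addrA [- _ + _]addrC.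
    by rewrite addnS -natr1 [(_ + 1)%:M]raddfD /= opprD [RHS]addrACA addrA.
  - rewrite big_ord_recr /= !updk -natr1.
    by under eq_bigr do rewrite !updl; exact: lerD.
have [y [t [gt [[uS pS trS] [uT pT trT]] tt]]] := iter (16 * m)%N.
exists y, t; split=> //.
move: pS; congr (psd (_ + _)).
rewrite -raddfN; congr (_%:M); rewrite natrM -mulrA.
by field.
Qed.

End Sparsification.

(** * Norms and real scalar products *)

Local Open Scope classical_set_scope.
Local Open Scope ring_scope.
Local Open Scope complex_scope.

Section RealNorm.
Context {R : realType}.
Implicit Types (X : normedModType R[i]).

Lemma real_complex_Re (z : R[i]) : 0 <= z -> z = (complex.Re z)%:C.
Proof. by case: z => a b; rewrite lecE /= => /andP[/eqP -> _]. Qed.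

Lemma nrmE X (x : X) : `|x| = (nrm x)%:C.
Proof. exact: real_complex_Re. Qed.

Lemma nrm_ge0 X (x : X) : 0 <= nrm x.
Proof. by have := normr_ge0 x; rewrite nrmE lecR. Qed.

Lemma nrmD X (x y : X) : nrm (x + y) <= nrm x + nrm y.
Proof. by have := ler_normD x y; rewrite !nrmE -rmorphD lecR. Qed.

Lemma nrm0 X : nrm (0 : X) = 0.
Proof. by rewrite /nrm normr0. Qed.

Lemma nrm_eq0 X (x : X) : (nrm x == 0) = (x == 0).
Proof.
by rewrite -(normr_eq0 x) nrmE (inj_eq (fmorph_inj (real_complex R))).
Qed.

Lemma nrmN X (x : X) : nrm (- x) = nrm x.
Proof. by rewrite /nrm normrN. Qed.

Lemma nrmB X (x y : X) : nrm (x - y) <= nrm x + nrm y.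
Proof. by rewrite -[nrm y]nrmN nrmD. Qed.

Lemma nrm_distC X (x y : X) : nrm (x - y) = nrm (y - x).
Proof. by rewrite -nrmN opprB. Qed.

(** The modulus as an element of R; it is [nrm] on R[i]^o. *)
Definition cabs (a : R[i]) : R := complex.Re `|a|.

Lemma cabsE (a : R[i]) : `|a| = (cabs a)%:C.
Proof. exact: real_complex_Re. Qed.

Lemma cabs_ge0 a : 0 <= cabs a.
Proof. by have := normr_ge0 a; rewrite cabsE lecR. Qed.

Lemma nrmZ X (a : R[i]) (x : X) : nrm (a *: x) = cabs a * nrm x.
Proof.
apply: (fmorph_inj (real_complex R)).
by rewrite -[LHS]/((nrm (a *: x))%:C) -nrmE normrZ nrmE cabsE rmorphM.
Qed.

Lemma nrm_regular (a : R[i]^o) : nrm a = cabs a.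
Proof. by []. Qed.

Lemma cabsM a b : cabs (a * b) = cabs a * cabs b.
Proof.
apply: (fmorph_inj (real_complex R)).
by rewrite -[LHS]/((cabs (a * b))%:C) -cabsE normrM !cabsE rmorphM.
Qed.

Lemma cabs_real (r : R) : 0 <= r -> cabs r%:C = r.
Proof. by move=> r0; rewrite /cabs ger0_norm ?lecR. Qed.

Lemma cabs_conj a : cabs (Num.conj a) = cabs a.
Proof. by rewrite /cabs norm_conjC. Qed.

Lemma cabs_sqr a : (cabs a ^+ 2)%:C = a * Num.conj a.
Proof. by rewrite -normCK cabsE rmorphXn. Qed.

Lemma nrm_sum X (I : Type) (r : seq I) (P : pred I) (F : I -> X) :
  nrm (\sum_(i <- r | P i) F i) <= \sum_(i <- r | P i) nrm (F i).
Proof.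
elim/big_rec2 : _ => [|i y x _ h]; first by rewrite nrm0.
by apply: le_trans (nrmD _ _) _; rewrite lerD2l.
Qed.

Lemma cvg_nrmP X (T : Type) (F : set_system T) {FF : Filter F} (f : T -> X) (x : X) :
  (f u @[u --> F] --> x) <-> (nrm (f u - x) @[u --> F] --> (0 : R)).
Proof.
split.
  move=> /cvgrPdist_lt h; apply/cvgrPdist_lt => e e0.
  have e0' : 0 < e%:C :> R[i] by rewrite ltcR.
  apply: filterS (h _ e0') => u.
  by rewrite sub0r normrN ger0_norm ?nrm_ge0 // nrm_distC nrmE ltcR.
move=> /cvgrPdist_lt h; apply/cvgrPdist_lt => e e0.
have ee : e = (complex.Re e)%:C by apply: real_complex_Re; apply: ltW.
have e0' : 0 < complex.Re e by move: e0; rewrite {1}ee ltcR.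
apply: filterS (h _ e0') => u.
by rewrite sub0r normrN ger0_norm ?nrm_ge0 // nrm_distC nrmE {2}ee ltcR.
Qed.

Lemma cvg_nrm X (T : Type) (F : set_system T) {FF : Filter F} (f : T -> X) (x : X) :
  f u @[u --> F] --> x -> nrm (f u) @[u --> F] --> nrm x.
Proof.
move=> /cvg_nrmP /cvgrPdist_lt h; apply/cvgrPdist_lt => e e0.
apply: filterS (h _ e0) => u; rewrite sub0r normrN ger0_norm ?nrm_ge0 //.
have h1 : nrm (f u) <= nrm (f u - x) + nrm x.
  by rewrite -{1}(subrK x (f u)) nrmD.
have h2 : nrm x <= nrm (f u - x) + nrm (f u).
  by rewrite nrm_distC -{1}(subrK (f u) x) nrmD.
by apply: le_lt_trans; rewrite ler_norml; apply/andP; split; lra.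
Qed.

End RealNorm.

Section Inner.
Context {R : realType}.

(** The real part of a Hermitian scalar product; [ip_adj] recalls the complex
    structure. *)
Record real_inner (X : normedModType R[i]) (ip : X -> X -> R) : Prop := RealInner {
  ipDl : forall x y z, ip (x + y) z = ip x z + ip y z;
  ipZl : forall r x z, ip (r%:C *: x) z = r * ip x z;
  ipC : forall x y, ip x y = ip y x;
  ip_adj : forall a x y, ip (a *: x) y = ip x (Num.conj a *: y);
  ipxx : forall x, ip x x = nrm x ^+ 2 }.

(** Completeness by Cauchy sequences for [nrm], which covers the Hilbert space
    X and the space R[i]^o of scalars alike. *)
Definition seq_complete (X : normedModType R[i]) : Prop := forall u : nat -> X,
  (forall e : R, 0 < e -> exists N, forall m n, (N <= m)%N -> (N <= n)%N ->
    nrm (u m - u n) < e) ->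
  exists x : X, u n @[n --> \oo] --> x.

Lemma seq_completeX (X : completeNormedModType R[i]) : seq_complete X.
Proof.
move=> u hu; suff /cvg_ex [x hx] : cvg (u n @[n --> \oo]) by exists x.
apply/cauchy_cvgP/cauchy_exP => e e0.
have ee : e = (complex.Re e)%:C by apply: real_complex_Re; apply: ltW.
have e0' : 0 < complex.Re e by move: e0; rewrite {1}ee ltcR.
have [N hN] := hu _ e0'; exists (u N); exists N => //= n /= Nn.
by rewrite -ball_normE /= nrmE ee ltcR; apply: hN.
Qed.

Lemma cabs_Re (z : R[i]) : `|complex.Re z| <= cabs z.
Proof. by rewrite -lecR -cabsE normc_ge_Re. Qed.

Lemma cabs_Im (z : R[i]) : `|complex.Im z| <= cabs z.
Proof.
rewrite -normrN -ReiNIm; apply: le_trans (cabs_Re _) _.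
rewrite cabsM [X in _ * X](_ : _ = 1) ?mulr1 // /cabs normc_def /=.
by rewrite expr0n expr1n add0r sqrtr1.
Qed.

Lemma cabs_le (z : R[i]) : cabs z <= `|complex.Re z| + `|complex.Im z|.
Proof.
rewrite /cabs normc_def /= -[leRHS]ger0_norm ?addr_ge0 // -sqrtr_sqr ler_sqrt ?sqr_ge0 //.
rewrite sqrrD !real_normK ?num_real // lerD2r lerDl mulrn_wge0 // mulr_ge0 //.
Qed.

(** Real and imaginary parts of a Cauchy sequence are Cauchy sequences. *)
Lemma seq_complete_regular : @seq_complete R[i]^o.
Proof.
move=> u hu.
have part (p : R[i] -> R) : (forall x y, p (x - y) = p x - p y) ->
    (forall x, `|p x| <= cabs x) -> exists a : R, p (u n) @[n --> \oo] --> a.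
  move=> pB ple; suff /cvg_ex [a ha] : cvg (p (u n) @[n --> \oo]) by exists a.
  apply/cauchy_cvgP/cauchy_exP => e e0.
  have [N hN] := hu _ e0; exists (p (u N)); exists N => //= n /= Nn.
  by rewrite -ball_normE /= -pB; apply: le_lt_trans (ple _) _; apply: hN.
have [a ha] := part (@complex.Re R) (raddfB (@complex.Re R : Rcomplex R -> R)) cabs_Re.
have [b hb] := part (@complex.Im R) (raddfB (@complex.Im R : Rcomplex R -> R)) cabs_Im.
exists (a +i* b); apply/cvg_nrmP/cvgrPdist_lt => e e0.
have e2 : 0 < e / 2 by rewrite divr_gt0.
move: ha => /cvgrPdist_lt /(_ _ e2) ha; move: hb => /cvgrPdist_lt /(_ _ e2) hb.
apply: filterS2 ha hb => n ha hb.
rewrite sub0r normrN ger0_norm ?nrm_ge0 // nrm_distC nrm_regular.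
apply: le_lt_trans (cabs_le _) _.
by case: (u n) ha hb => p q /= ha hb; rewrite [e]splitr ltrD.
Qed.

Lemma dot_real_inner (X : normedModType R[i]) (dot : {dot X for Num.conj}) :
  (forall x : X, `|x| ^+ 2 = dot x x) ->
  real_inner (fun x y : X => complex.Re (dot x y)).
Proof.
move=> hd; split.
- by move=> x y z; rewrite linearDl raddfD.
- move=> r x z; rewrite linearZl_LR /=; case: (dot x z) => p q /=; ring.
- by move=> x y; rewrite hermC /= expr0 mul1r; case: (dot y x).
- by move=> a x y; rewrite linearZl_LR linearZr_LR /= conjCK.
- by move=> x; rewrite -hd nrmE -rmorphXn.
Qed.

Lemma regular_real_inner :
  @real_inner R[i]^o (fun x y => complex.Re (x * Num.conj y)).
Proof.
split.
- by move=> x y z; rewrite mulrDl raddfD.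
- move=> r x z; rewrite -[_ *: x]/(r%:C * x) -mulrA.
  by case: (x * _) => p q /=; ring.
- by move=> x y; rewrite -{1}[x]conjCK -rmorphM mulrC; case: (y * _).
- move=> a x y; change (complex.Re (a * x * Num.conj y) =
    complex.Re (x * Num.conj (Num.conj a * y))).
  by rewrite [Num.conj (_ * y)]rmorphM /= conjCK mulrA [a * x]mulrC.
- by move=> x; rewrite -cabs_sqr.
Qed.

Variables (X : normedModType R[i]) (ip : X -> X -> R).
Hypothesis ipP : real_inner ip.

Lemma ipDr x y z : ip x (y + z) = ip x y + ip x z.
Proof. by rewrite ipC // ipDl // ![ip _ x]ipC. Qed.

Lemma ip0l x : ip 0 x = 0.
Proof. by have := ipZl ipP 0 0 x; rewrite scale0r mul0r. Qed.

Lemma ip0r x : ip x 0 = 0.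
Proof. by rewrite ipC // ip0l. Qed.

Lemma ipNl x y : ip (- x) y = - ip x y.
Proof.
by have := ipZl ipP (-1) x y; rewrite mulN1r => <-; rewrite rmorphN rmorph1 scaleN1r.
Qed.

Lemma ipNr x y : ip x (- y) = - ip x y.
Proof. by rewrite ipC // ipNl ipC. Qed.

Lemma ipZr r x z : ip x (r%:C *: z) = r * ip x z.
Proof. by rewrite ipC // ipZl // ipC. Qed.

Lemma ip_suml I (s : seq I) (P : pred I) (F : I -> X) z :
  ip (\sum_(i <- s | P i) F i) z = \sum_(i <- s | P i) ip (F i) z.
Proof. by apply: (big_morph (ip^~ z)) => [x y|]; rewrite ?ipDl ?ip0l. Qed.

Lemma ip_sumr I (s : seq I) (P : pred I) (F : I -> X) z :
  ip z (\sum_(i <- s | P i) F i) = \sum_(i <- s | P i) ip z (F i).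
Proof. by apply: (big_morph (ip z)) => [x y|]; rewrite ?ipDr ?ip0r. Qed.

Lemma nrm_sqrD x y : nrm (x + y) ^+ 2 = nrm x ^+ 2 + nrm y ^+ 2 + 2 * ip x y.
Proof.
by rewrite -!(ipxx ipP) ipDl // !ipDr [ip y x]ipC //; ring.
Qed.

Lemma ip_cauchy x y : `|ip x y| <= nrm x * nrm y.
Proof.
have key a b : ip a b <= nrm a * nrm b.
  have [/eqP a0|a0] := eqVneq (nrm a) 0.
    by move: a0; rewrite nrm_eq0 => /eqP ->; rewrite ip0l nrm0 mul0r.
  have [/eqP b0|b0] := eqVneq (nrm b) 0.
    by move: b0; rewrite nrm_eq0 => /eqP ->; rewrite ip0r nrm0 mulr0.
  have ap : 0 < nrm a by rewrite lt_def a0 nrm_ge0.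
  have bp : 0 < nrm b by rewrite lt_def b0 nrm_ge0.
  have := sqr_ge0 (nrm ((nrm b)%:C *: a - (nrm a)%:C *: b)).
  rewrite nrm_sqrD nrmN !nrmZ !cabs_real ?nrm_ge0 // ipNr ipZl // ipZr.
  rewrite (_ : _ + _ = 2 * (nrm a * nrm b) * (nrm a * nrm b - ip a b)); last by ring.
  by rewrite pmulr_rge0 ?subr_ge0 // !mulr_gt0.
rewrite ler_norml; apply/andP; split; last exact: key.
by rewrite lerNl -ipNl; apply: le_trans (key _ _) _; rewrite nrmN.
Qed.

Lemma ip_inj x y : (forall z, ip x z = ip y z) -> x = y.
Proof.
move=> h; apply/eqP; rewrite -subr_eq0 -nrm_eq0 -sqrf_eq0 -(ipxx ipP).
by rewrite ipDl // ipNl h subrr.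
Qed.

End Inner.

(** * Simple functions and their limits *)

Section LowerIntegral.
Context d (U : measurableType d) (R : realType) (mu : {measure set U -> \bar R}).
Local Open Scope ereal_scope.
Import HBNNSimple.

(** The integral of a nonnegative function is the supremum of the integrals of
    the simple functions below it, and restricting a simple function to the
    complement of a null set does not change its integral. *)
Lemma ge0_integral_le_ae (f g : U -> \bar R) :
  (forall u, 0 <= f u) -> (forall u, 0 <= g u) ->
  {ae mu, forall u, f u <= g u} -> \int[mu]_u f u <= \int[mu]_u g u.
Proof.
move=> f0 g0 [N [mN N0 sN]].
rewrite !ge0_integralTE //; apply: ge_ereal_sup => y [h hf hy]; rewrite -{}hy {y}.
rewrite -integralT_nnsfun.
pose h' := proj_nnsfun h (measurableC mN).
have -> : \int[mu]_u (h u)%:E = \int[mu]_u (h' u)%:E.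
  apply: ge0_ae_eq_integral => //.
  - exact/measurable_EFinP.
  - exact/measurable_EFinP.
  - by move=> x _; rewrite lee_fin.
  - by move=> x _; rewrite lee_fin.
  - exists N; split=> //; rewrite -(setCK N); apply: subsetC => u Nu _.
    by rewrite /h' /= mindicE mem_set // mulr1.
rewrite integralT_nnsfun; apply: ereal_sup_ubound; exists h' => //.
move=> u; rewrite /h' /= mindicE; have [uN|uN] := boolP (u \in ~` N).
  rewrite mulr1; apply: le_trans (hf u) _.
  by apply: contrapT => Hn; move: uN; rewrite inE /=; apply; apply: sN.
by rewrite mulr0 g0.
Qed.

Lemma ge0_integral_eq_ae (f g : U -> \bar R) :
  (forall u, 0 <= f u) -> (forall u, 0 <= g u) ->
  {ae mu, forall u, f u = g u} -> \int[mu]_u f u = \int[mu]_u g u.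
Proof.
move=> f0 g0 fg; apply/eqP; rewrite eq_le !ge0_integral_le_ae //.
- by apply: filterS fg => u ->.
- by apply: filterS fg => u ->.
Qed.

End LowerIntegral.

Section SimpleFun.
Context d (U : measurableType d) (R : realType).
Implicit Types (X Y Z : normedModType R[i]).

Lemma simple_fun_cst X (x : X) : simple_fun (fun _ : U => x).
Proof.
split; first by apply: (@sub_finite_set _ _ [set x]) => // _ [u _ <-].
by move=> y; rewrite preimage_cst; case: ifP.
Qed.

Lemma simple_fun_preimage X (f : U -> X) (A : set X) :
  simple_fun f -> measurable (f @^-1` A).
Proof.
move=> [fr mf].
rewrite (_ : _ @^-1` _ = \bigcup_(x in range f `&` A) f @^-1` [set x]).
  by apply: fin_bigcup_measurable; [exact: finite_setIl|move=> *; exact: mf].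
apply/seteqP; split=> [u Au|u [x [_ Ax] fux]].
  by exists (f u) => //; split=> //; exists u.
by rewrite /preimage /= fux.
Qed.

Lemma simple_fun_comp2 X Y Z (F : X -> Y -> Z) (f : U -> X) (g : U -> Y) :
  simple_fun f -> simple_fun g -> simple_fun (fun u => F (f u) (g u)).
Proof.
move=> sf sg; split.
  apply: (@sub_finite_set _ _ [set F x y | x in range f & y in range g]).
    by move=> _ [u _ <-]; exists (f u); [exists u|exists (g u); [exists u|]].
  by apply: finite_image2; [exact: sf.1|exact: sg.1].
move=> z; rewrite (_ : _ @^-1` _ = \bigcup_(x in range f)
    (f @^-1` [set x] `&` g @^-1` [set y | F x y = z])).
  apply: fin_bigcup_measurable; first exact: sf.1.
  by move=> x _; apply: measurableI; [exact: sf.2|exact: simple_fun_preimage].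
apply/seteqP; split=> [u /= <-|u [x _ [fux]]] /=.
  by exists (f u) => //; exists u.
by rewrite -fux.
Qed.

Definition cindic (A : set U) (u : U) : R[i]^o := (\1_A u)%:C.

Lemma simple_fun_indic (A : set U) : measurable A -> simple_fun (cindic A).
Proof.
move=> mA; split.
  apply: (@sub_finite_set _ _ [set (0 : R[i]^o); (1 : R[i]^o)]).
    move=> _ [u _ <-] /=; rewrite /cindic indicE; case: (u \in A); [right|left] => //.
  by apply: finite_set2.
move=> x; rewrite (_ : _ @^-1` _ =
   (if (1 : R[i]^o) == x then A else set0) `|` (if (0 : R[i]^o) == x then ~` A else set0)).
  by apply: measurableU; case: ifP => // _; exact: measurableC.
apply/seteqP; split=> u /=; rewrite /cindic indicE.
  have [uA <-|uA <-] := boolP (u \in A).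
    by left; rewrite eqxx; apply: set_mem.
  by right; rewrite eqxx => /mem_set; apply/negP.
case.
  by case: eqP => [<-|//] /mem_set ->.
by case: eqP => [<-|//] uA; rewrite memNset.
Qed.

Lemma simple_fun_patch X (f : U -> X) (A : set U) : measurable A ->
  simple_fun f -> simple_fun (fun u => if u \in A then f u else 0).
Proof.
move=> mA sf.
have := simple_fun_comp2 (fun (a : R[i]^o) x => if a == 0 then 0 else x)
   (simple_fun_indic mA) sf.
congr simple_fun; apply/funext => u; rewrite /cindic indicE.
by case: (u \in A); rewrite ?oner_eq0 ?eqxx.
Qed.

(** Everywhere limits of simple functions.  Every strongly measurable function
    has such a representative, and pointwise continuous operations preserve
    this class. *)
Definition smeas X (f : U -> X) : Prop :=
  exists2 g : nat -> U -> X, (forall n, simple_fun (g n)) &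
    forall u, g n u @[n --> \oo] --> f u.

Lemma simple_smeas X (f : U -> X) : simple_fun f -> smeas f.
Proof. by move=> sf; exists (fun=> f) => // u; exact: cvg_cst. Qed.

Lemma smeas_comp2 X Y Z (F : X -> Y -> Z) (f : U -> X) (g : U -> Y) :
  (forall (x_ : nat -> X) (y_ : nat -> Y) x y, x_ n @[n --> \oo] --> x ->
    y_ n @[n --> \oo] --> y -> F (x_ n) (y_ n) @[n --> \oo] --> F x y) ->
  smeas f -> smeas g -> smeas (fun u => F (f u) (g u)).
Proof.
move=> cF [f_ sf cf] [g_ sg cg].
exists (fun n u => F (f_ n u) (g_ n u)); first by move=> n; exact: simple_fun_comp2.
by move=> u; apply: cF.
Qed.

Lemma smeas_comp X Z (F : X -> Z) (f : U -> X) :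
  (forall (x_ : nat -> X) x, x_ n @[n --> \oo] --> x ->
    F (x_ n) @[n --> \oo] --> F x) -> smeas f -> smeas (F \o f).
Proof.
move=> cF sf; have := @smeas_comp2 X X Z (fun x _ => F x) f f _ sf sf.
by apply=> x_ y_ x y hx _; exact: cF.
Qed.

Lemma smeasD X (f g : U -> X) : smeas f -> smeas g -> smeas (fun u => f u + g u).
Proof. by apply: smeas_comp2 => x_ y_ x y; exact: cvgD. Qed.

Lemma smeasB X (f g : U -> X) : smeas f -> smeas g -> smeas (fun u => f u - g u).
Proof. by apply: (smeas_comp2 (F := fun x y : X => x - y)) => x_ y_ x y; exact: cvgB. Qed.

Lemma smeasZ X (a : U -> R[i]^o) (f : U -> X) :
  smeas a -> smeas f -> smeas (fun u => (a u : R[i]) *: f u).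
Proof.
apply: (smeas_comp2 (F := fun (a : R[i]^o) x => (a : R[i]) *: x)) => x_ y_ x y.
exact: cvgZ.
Qed.

Lemma smeas_cst X (x : X) : smeas (fun _ : U => x).
Proof. by apply: simple_smeas; apply: simple_fun_cst. Qed.

Lemma smeas_conj (a : U -> R[i]^o) : smeas a ->
  smeas (fun u => Num.conj (a u : R[i]) : R[i]^o).
Proof.
apply: (smeas_comp (F := fun a : R[i]^o => Num.conj (a : R[i]) : R[i]^o)) => x_ x.
move=> /cvg_nrmP h; apply/cvg_nrmP.
rewrite (_ : (fun n => _) = (fun n => nrm (x_ n - x))) //.
apply/funext => n; rewrite !nrm_regular -[RHS]cabs_conj; congr cabs.
by rewrite [RHS]rmorphB.
Qed.

Lemma smeas_measurable X (f : U -> X) (h : X -> R) :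
  (forall (x_ : nat -> X) x, x_ n @[n --> \oo] --> x ->
    h (x_ n) @[n --> \oo] --> h x) ->
  smeas f -> measurable_fun setT (h \o f).
Proof.
move=> ch [g sg cg].
apply: (@measurable_fun_cvg _ _ _ _ (fun n => h \o g n)).
  by move=> n _ B mB; rewrite setTI; apply: (@simple_fun_preimage _ _ (h @^-1` B)).
by move=> u _; apply: ch.
Qed.

Lemma smeas_nrm X (f : U -> X) : smeas f -> measurable_fun setT (fun u => nrm (f u)).
Proof. by apply: smeas_measurable => x_ x; exact: cvg_nrm. Qed.

End SimpleFun.

(** * Real integrals *)

Section RealIntegrals.
Context d (U : measurableType d) (R : realType) (mu : probability U R).
Implicit Types (f g : U -> R).

Definition rint f : Prop := mu.-integrable setT (EFin \o f).

Lemma rintP f : rint f ->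
  measurable_fun setT f /\ (\int[mu]_u (f u)%:E)%E = (\int[mu]_u f u)%:E.
Proof.
move=> rf; split; first by case/integrableP : rf => /measurable_EFinP.
by rewrite /Rintegral fineK //; apply: integrable_fin_num.
Qed.

Lemma rint_le f g : measurable_fun setT f -> (forall u, `|f u| <= g u) ->
  rint g -> rint f.
Proof.
move=> mf fg rg; apply: (le_integrable _ _ _ rg) => //.
  exact/measurable_EFinP.
by move=> u _; rewrite /= lee_fin; apply: le_trans (fg u) (ler_norm _).
Qed.

Lemma rintD f g : rint f -> rint g -> rint (fun u => f u + g u).
Proof. exact: integrableD. Qed.

Lemma rintZ c f : rint f -> rint (fun u => c * f u).
Proof. exact: integrableZl. Qed.

Lemma rint_eq f g : (forall u, f u = g u) -> rint f -> rint g.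
Proof. by move=> fg; congr rint; apply/funext. Qed.

Lemma rintN f : rint f -> rint (fun u => - f u).
Proof. by move=> rf; apply: (rint_eq _ (rintZ (-1) rf)) => u; rewrite mulN1r. Qed.

Lemma rintB f g : rint f -> rint g -> rint (fun u => f u - g u).
Proof. by move=> rf rg; apply: rintD => //; apply: rintN. Qed.

Lemma rint_indic A : measurable A -> rint (\1_A : U -> R).
Proof. exact: integrable_indic. Qed.

Lemma rint_cst c : rint (fun=> c).
Proof.
have := rintZ c (rint_indic measurableT); apply: rint_eq => u.
by rewrite indicE mem_set // mulr1.
Qed.

Lemma rint0 : rint (fun=> 0). Proof. exact: rint_cst. Qed.

Lemma rint_sum (I : Type) (r : seq I) (P : pred I) (F : I -> U -> R) :
  (forall i, rint (F i)) -> rint (fun u => \sum_(i <- r | P i) F i u).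
Proof.
move=> rF; elim: r => [|i r IH].
  by apply: (rint_eq _ rint0) => u; rewrite big_nil.
case: (boolP (P i)) => Pi.
  by apply: (rint_eq _ (rintD (rF i) IH)) => u; rewrite big_cons Pi.
by apply: (rint_eq _ IH) => u; rewrite big_cons (negPf Pi).
Qed.

Lemma RintD f g : rint f -> rint g ->
  \int[mu]_u (f u + g u) = \int[mu]_u f u + \int[mu]_u g u.
Proof. exact: RintegralD. Qed.

Lemma RintB f g : rint f -> rint g ->
  \int[mu]_u (f u - g u) = \int[mu]_u f u - \int[mu]_u g u.
Proof. exact: RintegralB. Qed.

Lemma RintZ c f : rint f -> \int[mu]_u (c * f u) = c * \int[mu]_u f u.
Proof. exact: RintegralZl. Qed.

Lemma Rint_cst c : \int[mu]_u (c : R) = c.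
Proof.
rewrite Rintegral_cst //; have -> : fine (mu setT) = 1 by rewrite probability_setT.
exact: mulr1.
Qed.

Lemma eq_Rint f g : (forall u, f u = g u) -> \int[mu]_u f u = \int[mu]_u g u.
Proof. by move=> fg; apply: eq_Rintegral => u _. Qed.

Lemma Rint_indic A : measurable A -> \int[mu]_u (\1_A u) = fine (mu A).
Proof. by move=> mA; rewrite /Rintegral integral_indic // setIT. Qed.

Lemma Rint_sum (I : Type) (r : seq I) (P : pred I) (F : I -> U -> R) :
  (forall i, rint (F i)) ->
  \int[mu]_u (\sum_(i <- r | P i) F i u) = \sum_(i <- r | P i) \int[mu]_u F i u.
Proof.
move=> rF; elim: r => [|i r IH].
  by rewrite big_nil -[RHS](Rint_cst 0); apply: eq_Rint => u; rewrite big_nil.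
rewrite big_cons; case: (boolP (P i)) => Pi.
  rewrite -IH -RintD //; last exact: rint_sum.
  by apply: eq_Rint => u; rewrite big_cons Pi.
by rewrite -IH; apply: eq_Rint => u; rewrite big_cons (negPf Pi).
Qed.

Lemma le_Rint f g : rint f -> rint g -> (forall u, f u <= g u) ->
  \int[mu]_u f u <= \int[mu]_u g u.
Proof. by move=> rf rg fg; apply: le_Rintegral. Qed.

Lemma Rint_norm f : rint f -> `|\int[mu]_u f u| <= \int[mu]_u `|f u|.
Proof. by move=> rf; apply: le_normr_Rintegral. Qed.

Lemma rint_norm f : rint f -> rint (fun u => `|f u|).
Proof.
move=> rf; have [mf _] := rintP rf.
have /integrable_abse := rf; apply: rint_eq => u //.
Qed.

Lemma Rint_ge0 f : (forall u, 0 <= f u) -> 0 <= \int[mu]_u f u.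
Proof. by move=> f0; apply: Rintegral_ge0. Qed.

Lemma rint_finite f : measurable_fun setT f -> (forall u, 0 <= f u) ->
  (\int[mu]_u (f u)%:E < +oo)%E -> rint f.
Proof.
move=> mf f0 h; apply/integrableP; split; first exact/measurable_EFinP.
by under eq_integral do rewrite /= ger0_norm //.
Qed.

Lemma dominated_Rint0 (f_ : nat -> U -> R) (g : U -> R) :
  (forall n, measurable_fun setT (f_ n)) -> (forall u, f_ n u @[n --> \oo] --> (0:R)) ->
  rint g -> (forall n u, `|f_ n u| <= g u) ->
  \int[mu]_u f_ n u @[n --> \oo] --> (0 : R).
Proof.
move=> mf cf rg fg.
have := @dominated_cvg _ _ _ mu setT measurableT (fun n => EFin \o f_ n) (cst 0%E) (EFin \o g).
move=> /(_ _ _ _ rg) /= h.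
have cE u : True -> (f_ n u)%:E @[n --> \oo] --> 0%E.
  by move=> _; apply/fine_cvgP; split; [exact: nearW|exact: cf].
have {h} := h (fun n => (measurable_EFinP _ _).2 (mf n)) cE (fun _ _ => isT)
  (fun n u _ => fg n u).
by rewrite integral0 => /fine_cvgP [_].
Qed.

End RealIntegrals.

(** * The Bochner integral *)

Section Functionals.
Context {R : realType}.

(** Bounded real-linear functionals.  Those of the form ip _ z separate the
    points of X, so identities between X-valued integrals can be verified after
    applying them. *)
Record real_functional (X : normedModType R[i]) (h : X -> R) : Prop := RealFunctional {
  rfD : forall x y, h (x + y) = h x + h y;
  rfZ : forall r x, h (r%:C *: x) = r * h x;
  rf_bounded : exists2 c, 0 <= c & forall x, `|h x| <= c * nrm x }.

Variables (X : normedModType R[i]) (h : X -> R).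
Hypothesis hP : real_functional h.

Lemma rf0 : h 0 = 0.
Proof. by have := rfZ hP 0 0; rewrite scaler0 mul0r. Qed.

Lemma rfN x : h (- x) = - h x.
Proof. by rewrite -[- x]scaleN1r -[-1]/((-1)%R) -(rmorphN1 (real_complex R)) (rfZ hP) mulN1r. Qed.

Lemma rfB x y : h (x - y) = h x - h y.
Proof. by rewrite rfD // rfN. Qed.

Lemma rf_sum I (s : seq I) (P : pred I) (F : I -> X) :
  h (\sum_(i <- s | P i) F i) = \sum_(i <- s | P i) h (F i).
Proof. by apply: (big_morph h) => [x y|]; rewrite ?rfD ?rf0. Qed.

Lemma rf_cvg (x_ : nat -> X) x : x_ n @[n --> \oo] --> x ->
  h (x_ n) @[n --> \oo] --> h x.
Proof.
move=> /cvg_nrmP hx; have [c c0 hc] := rf_bounded hP.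
apply/cvgrPdist_le => e e0.
have c1 : 0 < c + 1 by rewrite ltr_wpDl.
have e0' : 0 < e / (c + 1) by rewrite divr_gt0.
move: hx => /cvgrPdist_le /(_ _ e0'); apply: filterS => n.
rewrite sub0r normrN ger0_norm ?nrm_ge0 // => hn.
rewrite -rfB; apply: le_trans (hc _) _; rewrite nrm_distC.
apply: le_trans (_ : (c + 1) * nrm (x_ n - x) <= _).
  by rewrite ler_wpM2r ?nrm_ge0 // lerDl.
by rewrite mulrC -ler_pdivlMr.
Qed.

End Functionals.

Section Bochner.
Context d (U : measurableType d) (R : realType) (mu : probability U R).

Lemma ip_functional (X : normedModType R[i]) (ip : X -> X -> R) (ipP : real_inner ip) z :
  real_functional (fun x => ip x z).
Proof.
split; [by move=> *; apply: ipDl|by move=> *; apply: ipZl|].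
exists (nrm z); first exact: nrm_ge0.
by move=> x; rewrite mulrC ip_cauchy.
Qed.

Section SimpleIntegral.
Variables (X : normedModType R[i]).

Lemma simple_decomp (g : U -> X) (h : X -> R) u : simple_fun g ->
  h (g u) = \sum_(x <- finmap.enum_fset (fset_set (range g))) h x * \1_(g @^-1` [set x]) u.
Proof.
move=> sg; rewrite (bigD1_seq (g u)) /=; last first.
- exact: finmap.fset_uniq.
- by rewrite in_fset_set ?inE; [exists u|exact: sg.1].
rewrite indicE mem_set // mulr1 big1 ?addr0 // => x xg.
rewrite indicE memNset ?mulr0 // => /= gx.
by move: xg; rewrite gx eqxx.
Qed.

Lemma simple_rint (h : X -> R) (g : U -> X) : simple_fun g ->
  rint mu (fun u => h (g u)).
Proof.
move=> sg; apply: (rint_eq (fun u => esym (simple_decomp h u sg))).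
apply: rint_sum => x; apply: rintZ; apply: rint_indic; exact: sg.2.
Qed.

Lemma simple_integral_functional (g : U -> X) (h : X -> R) : simple_fun g ->
  real_functional h -> h (simple_integral mu g) = \int[mu]_u h (g u).
Proof.
move=> sg hP; rewrite /simple_integral fsbig_finite; last exact: sg.1.
rewrite rf_sum // (eq_Rint mu (fun u => simple_decomp h u sg)).
rewrite Rint_sum.
  apply: eq_bigr => x _; rewrite rfZ // RintZ; last exact: rint_indic (sg.2 x).
  by rewrite Rint_indic; [exact: mulrC|exact: sg.2].
by move=> x; apply: rintZ; apply: rint_indic; exact: sg.2.
Qed.

Lemma smeas_functional (f : U -> X) (h : X -> R) : real_functional h ->
  smeas f -> measurable_fun setT (fun u => h (f u)).
Proof. by move=> hP; apply: smeas_measurable => x_ x; apply: rf_cvg. Qed.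

(** Bochner integrable functions, in their everywhere defined form. *)
Definition bint (f : U -> X) : Prop := smeas f /\ rint mu (fun u => nrm (f u)).

Lemma bint_functional (f : U -> X) (h : X -> R) : real_functional h ->
  bint f -> rint mu (fun u => h (f u)).
Proof.
move=> hP [sf rf]; have [c c0 hc] := rf_bounded hP.
apply: (rint_le _ (g := fun u => c * nrm (f u))) => //; last exact: rintZ.
exact: smeas_functional.
Qed.

Lemma simple_bint (g : U -> X) : simple_fun g -> bint g.
Proof. by move=> sg; split; [exact: simple_smeas|exact: (simple_rint _ sg)]. Qed.

Lemma bintB (f g : U -> X) : bint f -> bint g -> bint (fun u => f u - g u).
Proof.
move=> [sf rf] [sg rg]; split; first exact: smeasB.
apply: (rint_le (smeas_nrm (smeasB sf sg)) _ (rintD rf rg)) => u.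
by rewrite ger0_norm ?nrm_ge0 // nrmB.
Qed.

(** Integrals of functionals determine the Bochner integral, whatever
    approximating sequence defines it. *)
Lemma bochner_functional (f : U -> X) y (h : X -> R) : bint f ->
  is_bochner_integral mu f y -> real_functional h -> h y = \int[mu]_u h (f u).
Proof.
move=> bf [_ [g [sg cg cy]]] hP; have [c c0 hc] := rf_bounded hP.
have rfg n : rint mu (fun u => nrm (f u - g n u)).
  by have [] := bintB bf (simple_bint (sg n)).
have cg' : \int[mu]_u nrm (f u - g n u) @[n --> \oo] --> (0 : R).
  by move: cg => /fine_cvgP [_].
have h1 := rf_cvg hP cy.
suff h2 : h (simple_integral mu (g n)) @[n --> \oo] --> \int[mu]_u h (f u).
  exact: (cvg_unique _ h1 h2).
apply/cvgrPdist_le => e e0.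
have c1 : 0 < c + 1 by rewrite ltr_wpDl.
have e0' : 0 < e / (c + 1) by rewrite divr_gt0.
move: cg' => /cvgrPdist_le /(_ _ e0'); apply: filterS => n.
rewrite sub0r normrN ger0_norm; last by apply: Rint_ge0 => u; exact: nrm_ge0.
move=> hn; rewrite simple_integral_functional // -RintB; last first.
- exact: (simple_rint _ (sg n)).
- exact: bint_functional.
have rh : rint mu (fun u => h (f u) - h (g n u)).
  by apply: rintB; [exact: bint_functional|exact: (simple_rint _ (sg n))].
apply: le_trans (Rint_norm rh) _.
apply: le_trans (_ : (c + 1) * \int[mu]_u nrm (f u - g n u) <= _); last first.
  by rewrite mulrC -ler_pdivlMr.
rewrite -RintZ //; apply: le_Rint; [exact: rint_norm|exact: rintZ|].
move=> u; rewrite -rfB //; apply: le_trans (hc _) _.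
by rewrite ler_wpM2r ?nrm_ge0 // lerDl.
Qed.

(** Approximants are replaced by 0 where they exceed twice the limit, which
    makes the convergence dominated. *)
Lemma smeas_approx (f : U -> X) : smeas f -> exists g : nat -> U -> X,
  [/\ forall n, simple_fun (g n),
      forall u, g n u @[n --> \oo] --> f u &
      forall n u, nrm (f u - g n u) <= 3 * nrm (f u)].
Proof.
move=> sf; have [g sg cg] := sf.
pose A n := [set u | nrm (g n u) <= 2 * nrm (f u)].
have mA n : measurable (A n).
  rewrite -[A n]setTI; apply: (measurable_fun_le measurableT).
    exact: smeas_nrm (simple_smeas (sg n)).
  by apply: measurable_funM => //; exact: smeas_nrm.
exists (fun n u => if u \in A n then g n u else 0); split.
- by move=> n; apply: simple_fun_patch.
- move=> u; have := cg u => /cvg_nrmP h; apply/cvg_nrmP.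
  have [f0|f0] := eqVneq (nrm (f u)) 0.
    have fu0 : f u = 0 by apply/eqP; rewrite -nrm_eq0 f0.
    rewrite (_ : (fun n => _) = cst 0); first exact: cvg_cst.
    apply/funext => n; rewrite fu0 subr0.
    case: ifPn => [|_]; last by rewrite nrm0.
    by rewrite inE /A /= f0 mulr0 => /(conj (nrm_ge0 _)) /andP /le_anti <-.
  have fp : 0 < nrm (f u) by rewrite lt_def f0 nrm_ge0.
  move: h => /cvgrPdist_le h; apply/cvgrPdist_le => e e0.
  apply: filterS2 (h _ e0) (h _ fp) => n.
  rewrite !sub0r !normrN !ger0_norm ?nrm_ge0 // => h1 h2.
  rewrite mem_set // /A /=.
  have : nrm (g n u) <= nrm (g n u - f u) + nrm (f u).
    by rewrite -{1}(subrK (f u) (g n u)) nrmD.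
  lra.
- move=> n u; case: ifPn; last by rewrite subr0 => _; have := nrm_ge0 (f u); lra.
  by rewrite inE /A /= => h; have := nrmB (f u) (g n u); lra.
Qed.

End SimpleIntegral.

Section Existence.
Variables (X : normedModType R[i]) (ip : X -> X -> R).
Hypotheses (ipP : real_inner ip) (cX : seq_complete X).

(** The integrals s_n of a dominated approximating sequence form a Cauchy
    sequence: the square of the norm of z = s_m - s_n is the integral of
    ip (g m - g n) z, at most nrm z times the integral of nrm (g m - g n). *)
Lemma bochner_exists (f : U -> X) : bint f -> exists y, is_bochner_integral mu f y.
Proof.
move=> bf; have [sf rf] := bf; have [g [sg cg fg]] := smeas_approx sf.
have rfg n : rint mu (fun u => nrm (f u - g n u)).
  by have [] := bintB bf (simple_bint (sg n)).
have cg0 : \int[mu]_u nrm (f u - g n u) @[n --> \oo] --> (0 : R).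
  apply: (dominated_Rint0 _ _ (rintZ 3 rf)).
  - by move=> n; have [] := rintP (rfg n).
  - move=> u; have /cvg_nrmP := cg u; under eq_fun do rewrite nrm_distC; exact.
  - by move=> n u; rewrite ger0_norm ?nrm_ge0.
pose s n := simple_integral mu (g n).
have sB m n : nrm (s m - s n) <=
    \int[mu]_u nrm (f u - g m u) + \int[mu]_u nrm (f u - g n u).
  set z := s m - s n.
  have [z0|z0] := eqVneq (nrm z) 0.
    by rewrite z0 addr_ge0 // Rint_ge0 // => u; exact: nrm_ge0.
  have zp : 0 < nrm z by rewrite lt_def z0 nrm_ge0.
  have hz := ip_functional ipP z.
  have sz k : ip (s k) z = \int[mu]_u ip (g k u) z.
    exact: (simple_integral_functional (sg k) hz).
  rewrite -(ler_pM2r zp) -expr2 -(ipxx ipP) {1}/z (rfB hz) /= !sz.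
  rewrite -RintB; try exact: (simple_rint (fun x => ip x z) (sg _)).
  rewrite -RintD // mulrC -RintZ; last exact: rintD.
  apply: le_Rint.
  - by apply: rintB; exact: (simple_rint (fun x => ip x z) (sg _)).
  - by apply: rintZ; exact: rintD.
  move=> u; rewrite -(rfB hz); apply: le_trans (ler_norm _) _.
  apply: le_trans (ip_cauchy ipP _ _) _; rewrite mulrC ler_wpM2l ?nrm_ge0 //.
  have -> : g m u - g n u = (f u - g n u) - (f u - g m u).
    by rewrite opprB [RHS]addrC addrA subrK.
  by apply: le_trans (nrmB _ _) _; rewrite addrC.
have [y hy] : exists y : X, s n @[n --> \oo] --> y.
  apply: cX => e e0; have e2 : 0 < e / 2 by rewrite divr_gt0.
  move: cg0 => /cvgrPdist_lt /(_ _ e2) [N _ hN]; exists N => m n Nm Nn.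
  apply: le_lt_trans (sB _ _) _.
  have := hN _ Nm; have := hN _ Nn; rewrite /= !sub0r !normrN.
  rewrite !ger0_norm; try by apply: Rint_ge0 => u; exact: nrm_ge0.
  lra.
exists y; split.
  by have [g' sg' cg'] := sf; exists g' => //; apply: aeW.
exists g; split=> //.
apply/fine_cvgP; split=> //; apply: nearW => n.
by rewrite (rintP (rfg n)).2.
Qed.

Lemma bochner_integralE (f : U -> X) (h : X -> R) : bint f -> real_functional h ->
  h (bochner_integral mu f) = \int[mu]_u h (f u).
Proof.
move=> bf hP; apply: bochner_functional => //.
by have [y hy] := bochner_exists bf; rewrite /bochner_integral; apply: (xgetPex 0 (ex_intro _ y hy)).
Qed.

End Existence.

(** The function and its approximants are set to 0 on the exceptional null set. *)
Lemma strongly_measurable_rep (X : normedModType R[i]) (f : U -> X) :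
  strongly_measurable mu f ->
  exists2 f', smeas f' & {ae mu, forall u, f u = f' u}.
Proof.
move=> [g sg [N [mN N0 sN]]].
exists (fun u => if u \in ~` N then f u else 0).
  exists (fun n u => if u \in ~` N then g n u else 0).
    by move=> n; apply: simple_fun_patch => //; exact: measurableC.
  move=> u; case: ifPn => [|_]; last exact: cvg_cst.
  by rewrite inE /= => Nu; apply: contrapT => h; apply: Nu; apply: sN.
exists N; split=> //; rewrite -{2}[N]setCK; apply: subsetC => u Nu /=.
by rewrite mem_set.
Qed.

Lemma smeas_strongly_measurable (X : normedModType R[i]) (f f' : U -> X) :
  smeas f' -> {ae mu, forall u, f u = f' u} -> strongly_measurable mu f.
Proof.
move=> [g sg cg] ff; exists g => //; apply: filterS ff => u ->; exact: cg.
Qed.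

Lemma bochner_integral_ae (X : normedModType R[i]) (f f' : U -> X) :
  smeas f' -> {ae mu, forall u, f u = f' u} ->
  bochner_integral mu f = bochner_integral mu f'.
Proof.
move=> sf ff; rewrite /bochner_integral; congr xget.
have e g : (\int[mu]_u (nrm (f u - g u))%:E = \int[mu]_u (nrm (f' u - g u))%:E)%E.
  apply: ge0_integral_eq_ae.
  - by move=> u; rewrite lee_fin nrm_ge0.
  - by move=> u; rewrite lee_fin nrm_ge0.
  - by apply: filterS ff => u ->.
apply/seteqP; split=> y [_ [g [h1 h2 h3]]].
  split; first by apply: (smeas_strongly_measurable sf); apply: aeW.
  exists g; split=> //; move: h2.
  by rewrite (_ : (fun n => _) = (fun n => \int[mu]_u (nrm (f' u - g n u))%:E)%E) //; apply/funext => n; rewrite e.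
split; first exact: (smeas_strongly_measurable sf).
exists g; split=> //; move: h2.
by rewrite (_ : (fun n => _) = (fun n => \int[mu]_u (nrm (f u - g n u))%:E)%E) //; apply/funext => n; rewrite e.
Qed.

End Bochner.

(** * Square integrable functions *)

Section SquareIntegrable.
Context d (U : measurableType d) (R : realType) (mu : probability U R).

Section OneSpace.
Variable (X : normedModType R[i]).
Implicit Types (f g : U -> X).

(** Everywhere defined representatives of the elements of L_2. *)
Definition sq2 f : Prop := smeas f /\ rint mu (fun u => nrm (f u) ^+ 2).

(** The square of the L_2 norm. *)
Definition energy f : R := \int[mu]_u (nrm (f u) ^+ 2).

Lemma energy_ge0 f : 0 <= energy f.
Proof. by apply: Rint_ge0 => u; exact: sqr_ge0. Qed.

Lemma L2norm_ae f f' : {ae mu, forall u, f u = f' u} -> L2norm mu f = L2norm mu f'.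
Proof.
move=> ff; congr (_ `^ _)%E; apply: ge0_integral_eq_ae.
- by move=> u; rewrite lee_fin sqr_ge0.
- by move=> u; rewrite lee_fin sqr_ge0.
- by apply: filterS ff => u ->.
Qed.

Lemma L2normE f : sq2 f -> L2norm mu f = (Num.sqrt (energy f))%:E.
Proof. by move=> [_ rf]; rewrite /L2norm (rintP rf).2 poweR_EFin powR12_sqrt // energy_ge0. Qed.

Lemma smeas_sqr_measurable f : smeas f -> measurable_fun setT (fun u => nrm (f u) ^+ 2).
Proof. by move=> sf; apply: measurable_funX; exact: smeas_nrm. Qed.

(** A class of L_2 is handled through a representative in [sq2]; the lemmas on
    [L2] below all descend from their analogues for [sq2]. *)
Lemma L2_rep f : L2 mu f -> exists2 f', sq2 f' & {ae mu, forall u, f u = f' u}.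
Proof.
move=> [/strongly_measurable_rep [f' sf' ff'] hL]; exists f' => //; split=> //.
apply: rint_finite; first exact: smeas_sqr_measurable.
  by move=> u; exact: sqr_ge0.
move: hL; rewrite (L2norm_ae ff') /L2norm.
by apply: lty_poweRy; rewrite invr_eq0 pnatr_eq0.
Qed.

Lemma rep_L2 f f' : sq2 f' -> {ae mu, forall u, f u = f' u} -> L2 mu f.
Proof.
move=> sf' ff'; split; first exact: smeas_strongly_measurable sf'.1 ff'.
by rewrite (L2norm_ae ff') L2normE // ltry.
Qed.

Lemma sq2_L2 f : sq2 f -> L2 mu f.
Proof. by move=> sf; apply: (rep_L2 sf); exact: aeW. Qed.

Lemma sqr_nrmD (x y : X) : nrm (x + y) ^+ 2 <= 2 * nrm x ^+ 2 + 2 * nrm y ^+ 2.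
Proof.
apply: (@le_trans _ _ ((nrm x + nrm y) ^+ 2)).
  by rewrite ler_sqr ?nnegrE ?addr_ge0 ?nrm_ge0 // nrmD.
by have := sqr_ge0 (nrm x - nrm y); nra.
Qed.

Lemma sq2D f g : sq2 f -> sq2 g -> sq2 (fun u => f u + g u).
Proof.
move=> [sf rf] [sg rg]; split; first exact: smeasD.
apply: (rint_le (smeas_sqr_measurable (smeasD sf sg)) _
         (rintD (rintZ 2 rf) (rintZ 2 rg))) => u.
by rewrite ger0_norm ?sqr_ge0 // sqr_nrmD.
Qed.

Lemma energyD_le f g : sq2 f -> sq2 g -> energy (fun u => f u + g u) <= 2 * energy f + 2 * energy g.
Proof.
move=> sf sg; have [_ r] := sq2D sf sg; case: sf sg => [_ rf] [_ rg].
rewrite /energy -!RintZ // -RintD; try exact: rintZ.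
by apply: le_Rint => //; [apply: rintD; exact: rintZ|move=> u; exact: sqr_nrmD].
Qed.

Lemma simple_sq2 f : simple_fun f -> sq2 f.
Proof.
move=> sf; split; first exact: simple_smeas.
exact: (simple_rint mu (fun x => nrm x ^+ 2) sf).
Qed.

End OneSpace.

Section TwoSpaces.
Variable (X : normedModType R[i]).
Implicit Types (f g : U -> X).

Lemma sq2_le (Y : normedModType R[i]) (c : R) (g : U -> Y) f : smeas f -> sq2 g ->
  (forall u, nrm (f u) <= c * nrm (g u)) -> sq2 f.
Proof.
move=> sf [sg rg] fg; split=> //.
apply: (rint_le (smeas_sqr_measurable sf) _ (rintZ (c ^+ 2) rg)) => u.
rewrite ger0_norm ?sqr_ge0 // -exprMn ler_sqr ?nnegrE ?nrm_ge0 //.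
exact: le_trans (nrm_ge0 _) (fg u).
Qed.

Lemma sq2_0 : sq2 (fun=> 0 : X).
Proof. by apply: simple_sq2; exact: simple_fun_cst. Qed.

Lemma sq2_sum (I : Type) (r : seq I) (P : pred I) (f : I -> U -> X) :
  (forall i, sq2 (f i)) -> sq2 (fun u => \sum_(i <- r | P i) f i u).
Proof.
move=> sf; elim: r => [|i r IH].
  by have := sq2_0; congr sq2; apply/funext => u; rewrite big_nil.
case: (boolP (P i)) => Pi.
  by have := sq2D (sf i) IH; congr sq2; apply/funext => u; rewrite big_cons Pi.
by move: IH; congr sq2; apply/funext => u; rewrite big_cons (negPf Pi).
Qed.

Lemma smeasZc (a : R[i]) f : smeas f -> smeas (fun u => a *: f u).
Proof. by move=> sf; apply: (smeasZ (a := fun=> a)) => //; exact: smeas_cst. Qed.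

Lemma sq2Z (a : R[i]) f : sq2 f -> sq2 (fun u => a *: f u).
Proof.
move=> sf; apply: (sq2_le (c := cabs a) _ sf); first exact: smeasZc sf.1.
by move=> u; rewrite nrmZ.
Qed.

Lemma sq2N f : sq2 f -> sq2 (fun u => - f u).
Proof.
by move=> /(sq2Z (-1)); congr sq2; apply/funext => u; rewrite scaleN1r.
Qed.

Lemma sq2B f g : sq2 f -> sq2 g -> sq2 (fun u => f u - g u).
Proof. by move=> sf sg; apply: sq2D => //; exact: sq2N. Qed.

Lemma sq2_scale_vec (a : U -> R[i]^o) (x : X) : sq2 a -> sq2 (fun u => (a u : R[i]) *: x).
Proof.
move=> sa; apply: (sq2_le (c := nrm x) _ sa).
  by apply: smeasZ sa.1 _; exact: smeas_cst.
by move=> u; rewrite nrmZ nrm_regular mulrC.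
Qed.

Lemma bint_scale (a : U -> R[i]^o) f : sq2 a -> sq2 f ->
  bint mu (fun u => Num.conj (a u : R[i]) *: f u).
Proof.
move=> [sa ra] [sf rf]; have sm : smeas (fun u => Num.conj (a u : R[i]) *: f u).
  by apply: (smeasZ (smeas_conj sa)).
split=> //; apply: (rint_le (smeas_nrm sm) _ (rintD ra rf)) => u.
rewrite ger0_norm ?nrm_ge0 // nrmZ cabs_conj nrm_regular.
have := sqr_ge0 (cabs (a u) - nrm (f u)).
by have := nrm_ge0 (f u); have := cabs_ge0 (a u); nra.
Qed.

End TwoSpaces.

Section Triangle.
Variable (X : normedModType R[i]).
Implicit Types (f g : U -> X).

(** Integration of the pointwise inequality
    (x + y)^2 <= (1 + b/a) x^2 + (1 + a/b) y^2, whose right-hand side becomes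
    (a + b)^2 for energies a^2 and b^2. *)
Lemma energy_triangle f g (a b : R) : sq2 f -> sq2 g -> 0 <= a -> 0 <= b ->
  energy f <= a ^+ 2 -> energy g <= b ^+ 2 -> energy (fun u => f u + g u) <= (a + b) ^+ 2.
Proof.
move=> sf sg a0 b0 fa gb.
have [_ rfg] := sq2D sf sg; have [_ rf] := sf; have [_ rg] := sg.
(* The shift by e keeps the weights b/a and a/b defined when a or b is 0. *)
have key e : 0 < e -> energy (fun u => f u + g u) <= (a + b + 2 * e) ^+ 2.
  move=> e0; pose a' := a + e; pose b' := b + e.
  have a'0 : 0 < a' by rewrite ltr_wpDl.
  have b'0 : 0 < b' by rewrite ltr_wpDl.
  have p u : nrm (f u + g u) ^+ 2 <=
      (1 + b' / a') * nrm (f u) ^+ 2 + (1 + a' / b') * nrm (g u) ^+ 2.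
    apply: (@le_trans _ _ ((nrm (f u) + nrm (g u)) ^+ 2)).
      by rewrite ler_sqr ?nnegrE ?addr_ge0 ?nrm_ge0 // nrmD.
    rewrite -subr_ge0.
    have -> : (1 + b' / a') * nrm (f u) ^+ 2 + (1 + a' / b') * nrm (g u) ^+ 2
      - (nrm (f u) + nrm (g u)) ^+ 2 =
      (b' * nrm (f u) - a' * nrm (g u)) ^+ 2 / (a' * b').
      by field; rewrite !gt_eqF.
    by rewrite divr_ge0 ?sqr_ge0 // mulr_ge0 // ltW.
  apply: (@le_trans _ _ ((1 + b' / a') * energy f + (1 + a' / b') * energy g)).
    rewrite /energy -!RintZ // -RintD; try exact: rintZ.
    by apply: le_Rint => //; apply: rintD; exact: rintZ.
  have fa' : energy f <= a' ^+ 2.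
    by apply: le_trans fa _; rewrite ler_sqr ?nnegrE ?(ltW a'0) // lerDl ltW.
  have gb' : energy g <= b' ^+ 2.
    by apply: le_trans gb _; rewrite ler_sqr ?nnegrE ?(ltW b'0) // lerDl ltW.
  have -> : (a + b + 2 * e) ^+ 2 =
      (1 + b' / a') * a' ^+ 2 + (1 + a' / b') * b' ^+ 2.
    rewrite (_ : a + b + 2 * e = a' + b'); last by rewrite /a' /b'; ring.
    by field; rewrite !gt_eqF.
  by apply: lerD; apply: ler_wpM2l => //; rewrite addr_ge0 // divr_ge0 // ltW.
have h : Num.sqrt (energy (fun u => f u + g u)) <= a + b.
  apply/ler_addgt0Pr => e e0; have e2 : 0 < e / 2 by rewrite divr_gt0.
  have := key _ e2; rewrite mulrCA divff ?mulr1 ?pnatr_eq0 // => h.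
  have s0 : 0 <= a + b + e by rewrite addr_ge0 ?addr_ge0 // ltW.
  by rewrite -(ger0_norm s0) -sqrtr_sqr ler_sqrt // sqr_ge0.
by rewrite -[leLHS]sqr_sqrtr ?energy_ge0 // ler_sqr ?nnegrE ?sqrtr_ge0 ?addr_ge0.
Qed.

End Triangle.

Section L2Original.
Variable (X : normedModType R[i]).
Implicit Types (f g : U -> X).

Lemma L2D f g : L2 mu f -> L2 mu g -> L2 mu (fun u => f u + g u).
Proof.
move=> /L2_rep [f' sf ff] /L2_rep [g' sg gg]; apply: (rep_L2 (sq2D sf sg)).
by apply: filterS2 ff gg => u -> ->.
Qed.

Lemma L2_0 : L2 mu (fun=> 0 : X).
Proof. exact: sq2_L2 (sq2_0 X). Qed.

Lemma L2B f g : L2 mu f -> L2 mu g -> L2 mu (fun u => f u - g u).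
Proof.
move=> /L2_rep [f' sf ff] /L2_rep [g' sg gg]; apply: (rep_L2 (sq2B sf sg)).
by apply: filterS2 ff gg => u -> ->.
Qed.

Lemma L2Z a f : L2 mu f -> L2 mu (fun u => a *: f u).
Proof.
by move=> /L2_rep [f' sf ff]; apply: (rep_L2 (sq2Z a sf)); apply: filterS ff => u ->.
Qed.

Lemma L2_sum (I : Type) (r : seq I) (P : pred I) (f : I -> U -> X) :
  (forall i, P i -> L2 mu (f i)) -> L2 mu (fun u => \sum_(i <- r | P i) f i u).
Proof.
move=> sf; elim: r => [|i r IH].
  by have := L2_0; congr L2; apply/funext => u; rewrite big_nil.
case: (boolP (P i)) => Pi.
  by have := L2D (sf i Pi) IH; congr L2; apply/funext => u; rewrite big_cons Pi.
by move: IH; congr L2; apply/funext => u; rewrite big_cons (negPf Pi).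
Qed.

Lemma L2_scale_vec (a : U -> R[i]) (x : X) : L2C mu a -> L2 mu (fun u => a u *: x).
Proof.
move=> /L2_rep [a' sa aa]; apply: (rep_L2 (sq2_scale_vec x sa)).
by apply: filterS aa => u ->.
Qed.

Lemma L2norm_triangle f g (a b : R) : L2 mu f -> L2 mu g -> 0 <= a -> 0 <= b ->
  (L2norm mu f <= a%:E)%E -> (L2norm mu g <= b%:E)%E ->
  (L2norm mu (fun u => f u + g u)%R <= (a + b)%:E)%E.
Proof.
move=> /L2_rep [f' sf ff] /L2_rep [g' sg gg] a0 b0.
rewrite (L2norm_ae ff) (L2norm_ae gg).
rewrite (_ : L2norm mu (fun u => f u + g u) = L2norm mu (fun u => f' u + g' u)); last first.
  apply: L2norm_ae.
  by apply: filterS2 ff gg => u -> ->.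
have conv (h : U -> X) (c : R) : sq2 h -> 0 <= c ->
    (L2norm mu h <= c%:E)%E <-> (energy h <= c ^+ 2).
  move=> sh c0; rewrite L2normE // lee_fin -{1}(ger0_norm c0) -sqrtr_sqr.
  by rewrite ler_sqrt ?sqr_ge0.
move=> /(conv _ _ sf a0) h1 /(conv _ _ sg b0) h2.
apply/conv; [exact: sq2D|exact: addr_ge0|exact: energy_triangle].
Qed.

End L2Original.

End SquareIntegrable.

(** * Coefficients and the Parseval inequality *)

Section NullSequences.
Context {R : realType}.

Lemma cvg0_le (a : nat -> R) : (forall n, 0 <= a n) ->
  a n @[n --> \oo] --> (0 : R) <->
  forall e, 0 < e -> \forall n \near \oo, a n <= e.
Proof.
move=> a0; split=> [/cvgrPdist_le h e e0|h].
  by apply: filterS (h _ e0) => n; rewrite sub0r normrN ger0_norm.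
by apply/cvgrPdist_le => e e0; apply: filterS (h _ e0) => n; rewrite sub0r normrN ger0_norm.
Qed.

Lemma quarter_sum (x a b c e : R) :
  x <= 2 * a + 2 * b -> a <= c -> c <= e / 4 -> b <= e / 4 -> x <= e.
Proof. lra. Qed.

End NullSequences.

Section Coefficients.
Context d (U : measurableType d) (R : realType) (mu : probability U R).

Record bounded_linear (X Y : normedModType R[i]) (T : X -> Y) : Prop := BoundedLinear {
  blD : forall x y, T (x + y) = T x + T y;
  blZ : forall a x, T (a *: x) = a *: T x;
  bl_bounded : exists2 c, 0 <= c & forall x, nrm (T x) <= c * nrm x }.

Lemma bounded_linear_functional (X Y : normedModType R[i]) (T : X -> Y) (h : Y -> R) :
  bounded_linear T -> real_functional h -> real_functional (h \o T).
Proof.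
move=> [TD TZ [c c0 hc]] [hD hZ [c' c'0 hc']]; split.
- by move=> x y /=; rewrite TD hD.
- by move=> r x /=; rewrite TZ hZ.
- exists (c' * c); first exact: mulr_ge0.
  move=> x /=; apply: le_trans (hc' _) _.
  by rewrite -mulrA ler_wpM2l.
Qed.

Lemma bounded_linear_cvg (X Y : normedModType R[i]) (T : X -> Y) (x_ : nat -> X) x :
  bounded_linear T -> x_ n @[n --> \oo] --> x -> T (x_ n) @[n --> \oo] --> T x.
Proof.
move=> [TD TZ [c c0 hc]] /cvg_nrmP h; apply/cvg_nrmP/cvgrPdist_le => e e0.
have c1 : 0 < c + 1 by rewrite ltr_wpDl.
have e0' : 0 < e / (c + 1) by rewrite divr_gt0.
move: h => /cvgrPdist_le /(_ _ e0'); apply: filterS => n.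
rewrite !sub0r !normrN !ger0_norm ?nrm_ge0 // => hn.
have -> : T (x_ n) - T x = T (x_ n - x).
  by rewrite -[in RHS]scaleN1r TD TZ scaleN1r.
apply: le_trans (hc _) _; apply: (@le_trans _ _ ((c + 1) * nrm (x_ n - x))).
  by rewrite ler_wpM2r ?nrm_ge0 // lerDl.
by rewrite mulrC -ler_pdivlMr.
Qed.

Lemma sq2_bounded_linear (X Y : normedModType R[i]) (T : X -> Y) (f : U -> X) :
  bounded_linear T -> sq2 mu f -> sq2 mu (T \o f).
Proof.
move=> bT sf; have [c c0 hc] := bl_bounded bT; apply: (sq2_le (c := c) _ sf).
  by apply: smeas_comp sf.1 => x_ x; exact: bounded_linear_cvg.
by move=> u; exact: hc.
Qed.

Lemma L2_bounded_linear (X Y : normedModType R[i]) (T : X -> Y) (f : U -> X) :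
  bounded_linear T -> L2 mu f -> L2 mu (T \o f).
Proof.
move=> bT /L2_rep [f' sf ff]; apply: (rep_L2 (sq2_bounded_linear bT sf)).
by apply: filterS ff => u /= ->.
Qed.

Lemma scale_vec_bounded_linear (X : normedModType R[i]) (x : X) :
  bounded_linear (fun a : R[i]^o => (a : R[i]) *: x).
Proof.
split.
- by move=> a b; rewrite scalerDl.
- by move=> a b; rewrite -[a *: b]/(a * b) scalerA.
- exists (nrm x); first exact: nrm_ge0.
  by move=> a; rewrite nrmZ nrm_regular mulrC.
Qed.

Lemma coef_ae (X : normedModType R[i]) (phi psi : nat -> U -> R[i]) (v v' : U -> X) s :
  sq2 mu (psi s : U -> R[i]^o) -> sq2 mu v' ->
  {ae mu, forall u, phi s u = psi s u} -> {ae mu, forall u, v u = v' u} ->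
  coef mu phi v s = coef mu psi v' s.
Proof.
move=> sp sv pp vv; apply: bochner_integral_ae.
  exact: (bint_scale sp sv).1.
by apply: filterS2 pp vv => u -> ->.
Qed.

Section Hilbert.
Variables (X : normedModType R[i]) (ip : X -> X -> R).
Hypotheses (ipP : real_inner ip) (cX : seq_complete X).
Variable psi : nat -> U -> R[i].
Hypothesis psi2 : forall s, sq2 mu (psi s : U -> R[i]^o).

Lemma coefE (v : U -> X) (h : X -> R) s : sq2 mu v -> real_functional h ->
  h (coef mu psi v s) = \int[mu]_u h (Num.conj (psi s u) *: v u).
Proof. by move=> sv hP; apply: (bochner_integralE ipP cX) => //; exact: (bint_scale (psi2 s)). Qed.

Lemma coefD_rep (v w : U -> X) s : sq2 mu v -> sq2 mu w ->
  coef mu psi (fun u => v u + w u) s = coef mu psi v s + coef mu psi w s.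
Proof.
move=> sv sw; apply: (ip_inj ipP) => z; have hz := ip_functional ipP z.
rewrite (ipDl ipP) (coefE s (sq2D sv sw) hz) (coefE s sv hz) (coefE s sw hz).
rewrite -RintD; first by apply: eq_Rint => u; rewrite scalerDr (ipDl ipP).
- exact: (bint_functional hz (bint_scale (psi2 s) sv)).
- exact: (bint_functional hz (bint_scale (psi2 s) sw)).
Qed.

End Hilbert.

(** Bounded linear maps commute with the Bochner integral; paired with z, both
    sides become the integral of one functional of v. *)
Lemma coef_linear_rep (X Y : normedModType R[i]) (ip : X -> X -> R) (ipY : Y -> Y -> R)
    (psi : nat -> U -> R[i]) (T : X -> Y) (v : U -> X) s :
  real_inner ip -> seq_complete X -> real_inner ipY -> seq_complete Y ->
  (forall s, sq2 mu (psi s : U -> R[i]^o)) -> bounded_linear T -> sq2 mu v ->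
  coef mu psi (T \o v) s = T (coef mu psi v s).
Proof.
move=> iX cX iY cY psi2 bT sv; apply: (ip_inj iY) => z.
have hz := ip_functional iY z.
rewrite (coefE iY cY psi2 s (sq2_bounded_linear bT sv) hz).
rewrite -[RHS]/(((ipY ^~ z) \o T) _).
rewrite (coefE iX cX psi2 s sv (bounded_linear_functional bT hz)).
by apply: eq_Rint => u /=; rewrite (blZ bT).
Qed.

Section Orthonormal.
Variables (X : normedModType R[i]) (ip : X -> X -> R).
Hypotheses (ipP : real_inner ip) (cX : seq_complete X).
Variable psi : nat -> U -> R[i].
Hypothesis psi2 : forall s, sq2 mu (psi s : U -> R[i]^o).
Hypothesis orth : forall s t, coef mu psi (psi s : U -> R[i]^o) t = (s == t)%:R.

Let rI := @regular_real_inner R.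
Let rC := @seq_complete_regular R.

Lemma rint_ip (f g : U -> X) : sq2 mu f -> sq2 mu g ->
  rint mu (fun u => ip (f u) (g u)).
Proof.
move=> sf sg; have [_ r] := sq2D sf sg; case: sf sg => [_ rf] [_ rg].
apply: (rint_eq _ (rintZ 2^-1 (rintB (rintB r rf) rg))) => u.
by rewrite (nrm_sqrD ipP); field.
Qed.

Lemma energyD (f g : U -> X) : sq2 mu f -> sq2 mu g ->
  energy mu (fun u => f u + g u) = energy mu f + energy mu g + 2 * \int[mu]_u ip (f u) (g u).
Proof.
move=> sf sg; have rip := rint_ip sf sg; case: sf sg => [_ rf] [_ rg].
rewrite -RintZ // /energy -RintD // -RintD; [|exact: rintD|exact: rintZ].
by apply: eq_Rint => u; rewrite (nrm_sqrD ipP).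
Qed.

Lemma coef_basis_vec (x : X) t s :
  coef mu psi (fun u => psi t u *: x) s = (t == s)%:R *: x.
Proof.
have := coef_linear_rep s rI rC ipP cX psi2 (scale_vec_bounded_linear x) (psi2 t).
by rewrite orth.
Qed.

Lemma Rint_ip_coef (v : U -> X) (y : X) s : sq2 mu v ->
  \int[mu]_u ip (v u) (psi s u *: y) = ip (coef mu psi v s) y.
Proof.
move=> sv; have hy := ip_functional ipP y.
rewrite (coefE ipP cX psi2 s sv hy); apply: eq_Rint => u.
by rewrite (ip_adj ipP) conjCK.
Qed.

Lemma sq2_term (x : X) s : sq2 mu (fun u => psi s u *: x).
Proof. exact: sq2_scale_vec x (psi2 s). Qed.

Lemma sq2_comb n (x : 'I_n -> X) : sq2 mu (fun u => \sum_(s < n) psi s u *: x s).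
Proof. by apply: sq2_sum => s; exact: sq2_term. Qed.

Lemma coef_comb n (x : 'I_n -> X) s :
  coef mu psi (fun u => \sum_(t < n) psi t u *: x t) s =
  \sum_(t < n) (t == s :> nat)%:R *: x t.
Proof.
elim: n x => [|n IH] x.
  rewrite big_ord0; rewrite (_ : (fun u => _) = fun u => psi 0%N u *: (0 : X)).
    by rewrite coef_basis_vec scaler0.
  by apply/funext => u; rewrite big_ord0 scaler0.
rewrite big_ord_recr /= -IH -coef_basis_vec -(coefD_rep ipP cX psi2).
- by congr coef; apply/funext => u; rewrite big_ord_recr.
- exact: sq2_comb.
- exact: sq2_term.
Qed.

Lemma pythagoras n (x : 'I_n -> X) :
  energy mu (fun u => \sum_(s < n) psi s u *: x s) = \sum_(s < n) nrm (x s) ^+ 2.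
Proof.
have sc := sq2_comb x.
transitivity (\int[mu]_u ip (\sum_(s < n) psi s u *: x s) (\sum_(s < n) psi s u *: x s)).
  by apply: eq_Rint => u; rewrite (ipxx ipP).
under eq_Rint do rewrite (ip_sumr ipP).
rewrite Rint_sum; last by move=> s; apply: rint_ip => //; exact: sq2_term.
apply: eq_bigr => s _; rewrite Rint_ip_coef // coef_comb (bigD1 s) //=.
rewrite eqxx scale1r big1 ?addr0 ?(ipxx ipP) // => t ts.
by rewrite (_ : (t == s :> nat) = false) ?scale0r //; apply/negbTE.
Qed.

Lemma bessel (v : U -> X) n : sq2 mu v ->
  energy mu (fun u => v u - pt_series mu psi v u n) =
  energy mu v - \sum_(s < n) nrm (coef mu psi v s) ^+ 2.
Proof.
move=> sv; pose x (s : 'I_n) := - coef mu psi v s.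
have sc := sq2_comb x.
transitivity (energy mu (fun u => v u + \sum_(s < n) psi s u *: x s)).
  apply: eq_Rint => u; rewrite /pt_series -sumrN; congr (nrm (_ + _) ^+ 2).
  by apply: eq_bigr => s _; rewrite scalerN.
rewrite energyD // pythagoras; under eq_Rint do rewrite (ip_sumr ipP).
rewrite Rint_sum; last by move=> s; apply: rint_ip => //; exact: sq2_term.
rewrite -addrA mulr_sumr -big_split -sumrN; congr (_ + _).
apply: eq_bigr => s _; rewrite /= Rint_ip_coef // /x nrmN (ipNr ipP) (ipxx ipP).
by ring.
Qed.

Lemma sq2_rest (v : U -> X) n : sq2 mu v -> sq2 mu (fun u => v u - pt_series mu psi v u n).
Proof. by move=> sv; apply: sq2B => //; exact: sq2_comb. Qed.

End Orthonormal.

Section Parseval.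
Variables (X : normedModType R[i]) (ip : X -> X -> R).
Hypotheses (ipP : real_inner ip) (cX : seq_complete X).
Variable psi : nat -> U -> R[i].
Hypothesis psi2 : forall s, sq2 mu (psi s : U -> R[i]^o).
Hypothesis basis : orthonormal_basis mu psi.

Let orth : forall s t, coef mu psi (psi s : U -> R[i]^o) t = (s == t)%:R.
Proof. by case: basis. Qed.
Let rI := @regular_real_inner R.
Let rC := @seq_complete_regular R.

Definition rest (v : U -> X) n := fun u => v u - pt_series mu psi v u n.

Lemma restD (v w : U -> X) n u : sq2 mu v -> sq2 mu w ->
  rest (fun u => v u + w u) n u = rest v n u + rest w n u.
Proof.
move=> sv sw; rewrite /rest /pt_series addrACA -opprD -big_split /=.
by congr (_ - _); apply: eq_bigr => s _; rewrite (coefD_rep ipP cX psi2) // scalerDr.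
Qed.

Let energy_eq (f g : U -> X) : (forall u, f u = g u) -> energy mu f = energy mu g.
Proof. by move=> fg; apply: eq_Rint => u; rewrite fg. Qed.

Lemma energy_restD (v w z : U -> X) n : sq2 mu v -> sq2 mu w ->
  (forall u, z u = v u + w u) ->
  energy mu (rest z n) <= 2 * energy mu (rest v n) + 2 * energy mu (rest w n).
Proof.
move=> sv sw /funext ->.
rewrite [leLHS](energy_eq (fun u => restD n u sv sw)).
exact: energyD_le (sq2_rest psi2 n sv) (sq2_rest psi2 n sw).
Qed.

Let cvg2D (a b c : nat -> R) : (forall n, 0 <= c n) ->
  (forall n, c n <= 2 * a n + 2 * b n) -> a n @[n --> \oo] --> (0 : R) ->
  b n @[n --> \oo] --> (0 : R) -> c n @[n --> \oo] --> (0 : R).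
Proof.
move=> c0 cab ha hb; apply: (@squeeze_cvgr _ _ _ _ (cst 0) (fun n => 2 * a n + 2 * b n)).
- by apply: nearW => n; rewrite c0 cab.
- exact: cvg_cst.
- rewrite -[X in _ --> X](_ : 2 * 0 + 2 * 0 = 0 :> R); last by ring.
  by apply: cvgD; apply: cvgM => //; exact: cvg_cst.
Qed.

(** Completeness of the basis concerns scalar functions.  It reaches the
    products of an indicator with a vector x because taking coefficients
    commutes with the map a |-> a *: x. *)
Lemma rest_indic (A : set U) (x : X) : measurable A ->
  energy mu (rest (fun u => (cindic R A u : R[i]) *: x) n) @[n --> \oo] --> (0 : R).
Proof.
move=> mA; have sA := simple_sq2 mu (simple_fun_indic R mA).
have [_ _ /(_ _ (sq2_L2 sA)) hA] := basis.
have E n : energy mu (rest (fun u => (cindic R A u : R[i]) *: x) n) =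
    nrm x ^+ 2 * energy mu (fun u => cindic R A u - pt_series mu psi (cindic R A) u n).
  have [_ r] := sq2_rest psi2 n sA.
  rewrite /energy -RintZ //; apply: eq_Rint => u; rewrite -exprMn; congr (_ ^+ 2).
  rewrite /rest /pt_series.
  rewrite [X in nrm X](_ : _ =
      (cindic R A u - \sum_(s < n) psi s u *: coef mu psi (cindic R A) s : R[i]) *: x).
    by rewrite nrmZ nrm_regular mulrC.
  rewrite scalerBl scaler_suml; congr (_ - _); apply: eq_bigr => s _.
  have := coef_linear_rep s rI rC ipP cX psi2 (scale_vec_bounded_linear x) sA.
  by move=> ->; rewrite scalerA.
rewrite (_ : (fun n => _) = (fun n => nrm x ^+ 2 *
   energy mu (fun u => cindic R A u - pt_series mu psi (cindic R A) u n))); last first.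
  by apply/funext => n; exact: E.
rewrite -[X in _ --> X](mulr0 (nrm x ^+ 2)); apply: cvgM; first exact: cvg_cst.
move: hA; rewrite (_ : (fun n => _) = (fun n => (Num.sqrt (energy mu (fun u =>
   cindic R A u - pt_series mu psi (cindic R A) u n)))%:E)); last first.
  by apply/funext => n; rewrite (L2normE (sq2_rest psi2 n sA)).
move=> /fine_cvgP [_ /=] h.
rewrite (_ : (fun n => _) = (fun n => Num.sqrt (energy mu (fun u =>
   cindic R A u - pt_series mu psi (cindic R A) u n)) ^+ 2)); last first.
  by apply/funext => n; rewrite sqr_sqrtr // energy_ge0.
have h2 := cvgM h h; rewrite mulr0 in h2; exact: h2.
Qed.

Lemma rest_simple (g : U -> X) : simple_fun g ->
  energy mu (rest g n) @[n --> \oo] --> (0 : R).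
Proof.
move=> sg; have [fr mg] := sg.
pose t x u := (cindic R (g @^-1` [set x]) u : R[i]) *: x.
have st x : sq2 mu (t x).
  by apply: sq2_scale_vec; apply: simple_sq2; apply: simple_fun_indic; exact: mg.
have key (r : seq X) :
    energy mu (rest (fun u => \sum_(x <- r) t x u) n) @[n --> \oo] --> (0 : R).
  elim: r => [|x r IH].
    rewrite (_ : (fun n => _) = cst 0); first exact: cvg_cst.
    apply/funext => n; rewrite -[RHS](Rint_cst mu 0); apply: eq_Rint => u.
    rewrite /rest /pt_series big_nil big1 ?subrr ?nrm0 ?expr0n // => s _.
    have := coef_comb ipP cX psi2 orth (n := 0) (fun _ => 0) s.
    rewrite big_ord0 (_ : (fun u => _) = (fun u => \sum_(x <- [::]) t x u)).
      by move=> ->; rewrite scaler0.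
    by apply/funext => w; rewrite big_ord0 big_nil.
  have sr : sq2 mu (fun u => \sum_(x <- r) t x u) by exact: sq2_sum.
  apply: (cvg2D _ _ (rest_indic x (mg x)) IH); first by move=> n; exact: energy_ge0.
  by move=> n; apply: (energy_restD n (st x) sr) => w; rewrite big_cons.
move: (key (finmap.enum_fset (fset_set (range g)))).
rewrite (_ : (fun u => _) = g) //; apply/funext => u.
rewrite (bigD1_seq (g u)) /=; last first.
- exact: finmap.fset_uniq.
- by rewrite in_fset_set ?inE //; exists u.
rewrite {1}/t /cindic indicE mem_set // scale1r big1 ?addr0 // => x xg.
rewrite /t /cindic indicE memNset ?scale0r // => /= gx.
by move: xg; rewrite gx eqxx.
Qed.

(** By Bessel's inequality passing to the remainder does not increase the
    energy, so it suffices to approximate v by a simple function. *)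
Lemma rest_small (v : U -> X) e : sq2 mu v -> 0 < e ->
  exists n, energy mu (rest v n) <= e.
Proof.
move=> sv e0; have [mv rv] := sv; have [g [sg cg vg]] := smeas_approx mv.
have sgs n := simple_sq2 mu (sg n).
have svg n : sq2 mu (fun u => v u - g n u) by apply: sq2B.
have ap : energy mu (fun u => v u - g n u) @[n --> \oo] --> (0 : R).
  apply: (dominated_Rint0 _ _ (rintZ 9 rv)).
  - by move=> n; apply: smeas_sqr_measurable; exact: (svg n).1.
  - move=> u; have /cvg_nrmP h := cg u.
    have h1 : nrm (v u - g n u) @[n --> \oo] --> (0 : R).
      by move: h; under eq_fun do rewrite nrm_distC.
    have h2 := cvgM h1 h1; rewrite mulr0 in h2; exact: h2.
  - move=> n u; rewrite ger0_norm ?sqr_ge0 //.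
    rewrite (_ : 9 = 3 ^+ 2 :> R); last by ring.
    by rewrite -exprMn ler_sqr ?nnegrE ?mulr_ge0 ?nrm_ge0.
have e4 : 0 < e / 4 by rewrite divr_gt0.
have [k _ /(_ k (leqnn k)) /= hk] := (cvg0_le (fun n => energy_ge0 mu _)).1 ap _ e4.
have [n _ /(_ n (leqnn n)) /= hn] :=
  (cvg0_le (fun n => energy_ge0 mu (rest (g k) n))).1 (rest_simple (sg k)) _ e4.
exists n.
have hd := energy_restD n (svg k) (sgs k) (fun w => esym (subrK (g k w) (v w))).
have hb : energy mu (rest (fun u => v u - g k u) n) <= energy mu (fun u => v u - g k u).
  rewrite (bessel ipP cX psi2 orth n (svg k)) gerBl.
  by apply: sumr_ge0 => s _; exact: sqr_ge0.
exact: quarter_sum hd hb hk hn.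
Qed.

Lemma parseval_le_rep (v : U -> X) (B : R) : sq2 mu v ->
  (forall n, \sum_(s < n) nrm (coef mu psi v s) ^+ 2 <= B) -> energy mu v <= B.
Proof.
move=> sv hB; apply/ler_addgt0Pr => e e0.
have [n hn] := rest_small sv e0.
have hb : energy mu (rest v n) = energy mu v - \sum_(s < n) nrm (coef mu psi v s) ^+ 2.
  exact: (bessel ipP cX psi2 orth n sv).
move: (energy mu (rest v n)) hn hb => r; rewrite /= => hn hb.
rewrite hb lerBlDr in hn; apply: le_trans hn _.
by rewrite [leRHS]addrC lerD2l; exact: hB.
Qed.

End Parseval.

End Coefficients.

(** * Quadratic forms on tuples of vectors *)

Lemma conj_realC (R : realType) (r : R) : Num.conj (r%:C : R[i]) = r%:C.
Proof. exact: conjc_real. Qed.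

Section VectorForms.
Context {R : realType} (X : normedModType R[i]) (ip : X -> X -> R).
Hypothesis ipP : real_inner ip.

(** For Hermitian Q, the value on x of the form that Q defines on X^n.  It is
    nonnegative for positive Q, because such a Q is a sum of rank-one Gram
    matrices. *)
Definition vform n (Q : 'M[R[i]]_n) (x : 'I_n -> X) : R :=
  \sum_s \sum_t ip (Q s t *: x t) (x s).

Lemma vformD n (P Q : 'M[R[i]]_n) x : vform (P + Q) x = vform P x + vform Q x.
Proof.
rewrite /vform -big_split; apply: eq_bigr => s _; rewrite -big_split.
by apply: eq_bigr => t _; rewrite mxE scalerDl (ipDl ipP).
Qed.

Lemma vformN n (Q : 'M[R[i]]_n) x : vform (- Q) x = - vform Q x.
Proof.
rewrite /vform -sumrN; apply: eq_bigr => s _; rewrite -sumrN.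
by apply: eq_bigr => t _; rewrite mxE scaleNr (ipNl ipP).
Qed.

Lemma vformZ n (r : R) (Q : 'M[R[i]]_n) x : vform (r%:C *: Q) x = r * vform Q x.
Proof.
rewrite /vform mulr_sumr; apply: eq_bigr => s _; rewrite mulr_sumr.
by apply: eq_bigr => t _; rewrite mxE -scalerA (ipZl ipP).
Qed.

Lemma vform_sum n (I : Type) (r : seq I) (F : I -> 'M[R[i]]_n) x :
  vform (\sum_(i <- r) F i) x = \sum_(i <- r) vform (F i) x.
Proof.
apply: (big_morph (fun Q => vform Q x)) => [P Q|]; first exact: vformD.
by rewrite /vform big1 // => s _; rewrite big1 // => t _; rewrite mxE scale0r (ip0l ipP).
Qed.

Lemma vform_scalar n (r : R) x :
  vform ((r%:C)%:M : 'M[R[i]]_n) x = r * \sum_s nrm (x s) ^+ 2.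
Proof.
rewrite -[_%:M]mulmx1 mul_scalar_mx vformZ; congr (_ * _).
apply: eq_bigr => s _; rewrite (bigD1 s) //= mxE eqxx scale1r (ipxx ipP).
rewrite big1 ?addr0 // => t ts; rewrite mxE eq_sym (negPf ts) scale0r.
exact: ip0l.
Qed.

Lemma vform_rank_one n (w : 'cV[R[i]]_n) x :
  vform (w *m w ^t*) x = nrm (\sum_t Num.conj (w t 0) *: x t) ^+ 2.
Proof.
rewrite -(ipxx ipP) (ip_sumr ipP); apply: eq_bigr => s _.
rewrite (ip_suml ipP); apply: eq_bigr => t _.
rewrite mxE big_ord1 !mxE [RHS](ipC ipP) [RHS](ip_adj ipP) conjCK.
by rewrite [RHS](ipC ipP) scalerA.
Qed.

Lemma vform_psd n (Q : 'M[R[i]]_n) x : psd Q -> 0 <= vform Q x.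
Proof.
move=> /psd_factor [E ->].
have -> : E ^t* *m E = \sum_k ((row k E) ^t* *m ((row k E) ^t*) ^t*).
  apply/matrixP => s t; rewrite !mxE summxE; apply: eq_bigr => k _.
  by rewrite !mxE big_ord1 !mxE conjCK.
by rewrite vform_sum sumr_ge0 // => k _; rewrite vform_rank_one sqr_ge0.
Qed.

End VectorForms.

Section Averages.
Context d (U : measurableType d) (R : realType) (mu : probability U R).
Variable psi : nat -> U -> R[i].
Hypothesis psi2 : forall s, sq2 mu (psi s : U -> R[i]^o).
Hypothesis orth : forall s t, coef mu psi (psi s : U -> R[i]^o) t = (s == t)%:R.

(** The conjugates make the rank-one matrix of this vector take, on a tuple x,
    the squared norm of the combination of the x_s with the coefficients
    rho_s psi_s(y). *)
Definition pt_vec n (rho : 'I_n -> R) (y : U) : 'cV[R[i]]_n :=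
  \col_s ((rho s)%:C * Num.conj (psi s y)).

(** By orthonormality the rank-one matrices of the sampling vectors have a
    diagonal mean, so the mean of a quadratic form is a trace. *)
Lemma qform_mean n (rho : 'I_n -> R) (Q : 'M[R[i]]_n) : psd Q ->
  exists f : U -> R, [/\ rint mu f, forall y, 0 <= f y,
    forall y, qform Q (pt_vec rho y) = (f y)%:C &
    (\int[mu]_y f y)%:C = \tr (Q *m diag_mx (\row_s ((rho s) ^+ 2)%:C))].
Proof.
move=> /psd_factor [E ->].
pose c k s : R[i]^o := (rho s)%:C * Num.conj (E k s).
pose g k y : R[i]^o := \sum_(s < n) psi s y *: c k s.
have sg k : sq2 mu (g k) by exact: sq2_comb.
exists (fun y => \sum_k nrm (g k y) ^+ 2); split.
- by apply: rint_sum => k; exact: (sg k).2.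
- by move=> y; apply: sumr_ge0 => k _; exact: sqr_ge0.
- move=> y; have e k : (E *m pt_vec rho y) k 0 = Num.conj (g k y : R[i]).
    rewrite mxE [RHS]rmorph_sum; apply: eq_bigr => s _; rewrite !mxE.
    rewrite -[psi s y *: _]/(psi s y * ((rho s)%:C * Num.conj (E k s))).
    rewrite !rmorphM /= conjCK conj_realC; ring.
  rewrite qform_gram mxE rmorph_sum; apply: eq_bigr => k _.
  transitivity ((g k y : R[i]) * Num.conj (g k y : R[i])).
    have -> : ((E *m pt_vec rho y) ^t*) 0 k = Num.conj ((E *m pt_vec rho y) k 0).
      by rewrite 2!mxE.
    by rewrite e conjCK.
  exact: esym (cabs_sqr _).
- rewrite Rint_sum; last by move=> k; exact: (sg k).2.
  under eq_bigr do rewrite -[Rintegral _ _ _]/(energy mu (g _)) (pythagoras regular_real_inner (@seq_complete_regular R) psi2 orth).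
  rewrite exchange_big rmorph_sum; apply: eq_bigr => s _.
  rewrite mul_mx_diag !mxE mulr_suml rmorph_sum; apply: eq_bigr => k _.
  transitivity ((c k s : R[i]) * Num.conj (c k s : R[i])).
    exact: cabs_sqr.
  rewrite /c rmorphM /= conjCK conj_realC !mxE rmorphXn /=. ring.
Qed.

End Averages.

(** * Selection of a sample point by averaging *)

Section Selection.
Context d (U : measurableType d) (R : realType) (mu : probability U R).
Variable psi : nat -> U -> R[i].
Hypothesis psi2 : forall s, sq2 mu (psi s : U -> R[i]^o).
Hypothesis orth : forall s t, coef mu psi (psi s : U -> R[i]^o) t = (s == t)%:R.
Variables (m D : nat) (w : nat -> R) (eta : R).
Hypothesis eta_gt0 : 0 < eta.
Hypothesis w_tail : (\sum_(0 <= s <oo) (w (m + D + s)%N ^+ 2)%:E <= eta%:E)%E.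
Variable good : U -> Prop.
Hypothesis good_ae : {ae mu, forall y, good y}.

Definition tail_energy (y : U) : \bar R :=
  (\sum_(0 <= s <oo)
    (w (m + D + s)%N ^+ 2 * nrm (psi (m + D + s)%N y : R[i]^o) ^+ 2)%:E)%E.

Lemma tail_energy_ge0 y : (0 <= tail_energy y)%E.
Proof. by apply: nneseries_ge0 => s _ _; rewrite lee_fin mulr_ge0 ?sqr_ge0. Qed.

Lemma orth_norm s : energy mu (psi s : U -> R[i]^o) = 1.
Proof.
have := pythagoras regular_real_inner (@seq_complete_regular R) psi2 orth
  (fun t : 'I_s.+1 => ((t == ord_max)%:R : R[i]^o)).
rewrite big_ord_recr /= eqxx big1 => [|t _]; last first.
  by rewrite (_ : _ == _ = false) ?nrm0 ?expr0n //; apply/eqP => /(congr1 val)/= ts;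
     move: (ltn_ord t); rewrite ts ltnn.
rewrite add0r nrm_regular [cabs _](_ : _ = 1) ?expr1n; last first.
  by rewrite -[1]/(1%:C) cabs_real.
move=> <-; apply: eq_Rint => u; rewrite big_ord_recr /= eqxx big1 => [|t _].
  by rewrite add0r; congr (nrm _ ^+ 2); exact: esym (mulr1 _).
rewrite (_ : _ == _ = false) ?scaler0 //; apply/eqP => /(congr1 val)/= ts.
by move: (ltn_ord t); rewrite ts ltnn.
Qed.

Lemma tail_energy_measurable : measurable_fun setT tail_energy.
Proof.
pose h s y := (w (m + D + s)%N ^+ 2 * nrm (psi (m + D + s)%N y : R[i]^o) ^+ 2)%:E.
have := @ge0_emeasurable_sum _ U R setT h xpredT; apply.
  by move=> s y _ _; rewrite lee_fin mulr_ge0 ?sqr_ge0.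
move=> s _; apply/measurable_EFinP; apply: measurable_funM => //.
by apply: smeas_sqr_measurable; exact: (psi2 _).1.
Qed.

Lemma tail_energy_integral : (\int[mu]_y tail_energy y <= eta%:E)%E.
Proof.
rewrite /tail_energy integral_nneseries //.
- apply: le_trans w_tail; apply: eq_le_of.
  apply: eq_eseriesr => s _.
  have [_ r] := psi2 (m + D + s)%N.
  rewrite (rintP (rintZ (w (m + D + s)%N ^+ 2) r)).2 RintZ //.
  by rewrite -[Rintegral _ _ _]/(energy mu _) orth_norm mulr1.
- move=> s; apply/measurable_EFinP; apply: measurable_funM => //.
  by apply: smeas_sqr_measurable; exact: (psi2 _).1.
- by move=> s y _; rewrite lee_fin mulr_ge0 ?sqr_ge0.
Qed.

(** Normalized so that its mean is at most 1. *)
Definition tail_load (y : U) : R := fine (tail_energy y) / eta.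

Definition head_vec (y : U) : 'cV[R[i]]_m := pt_vec psi (fun=> 1) y.
(** The factors 1 / sqrt eta turn the bound by eta of the squared weights into
    the bound of [block_weights] by 1. *)
Definition block_vec (y : U) : 'cV[R[i]]_D :=
  pt_vec (fun s => psi (m + s)%N) (fun s : 'I_D => w (m + s) / Num.sqrt eta) y.
Definition block_weights : 'M[R[i]]_D := diag_mx (\row_(s < D) ((w (m + s) / Num.sqrt eta) ^+ 2)%:C).

Definition admissible y := good y /\ (tail_energy y < +oo)%E.

Lemma admissible_ae : {ae mu, forall y, admissible y}.
Proof.
have ie : mu.-integrable setT tail_energy.
  apply/integrableP; split; first exact: tail_energy_measurable.
  under eq_integral do rewrite gee0_abs ?tail_energy_ge0 //.
  by apply: le_lt_trans tail_energy_integral _; rewrite ltry.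
have := integrable_ae measurableT ie.
apply: filterS2 good_ae => y gy fy; split=> //.
by rewrite -ge0_fin_numE ?tail_energy_ge0 //; exact: fy.
Qed.

(** If no point worked, the reverse inequality would hold almost everywhere,
    and its integral would contradict the assumption on the traces. *)
Lemma select_point (P1 Q1 : 'M[R[i]]_m) (Q2 : 'M[R[i]]_D) (c : R[i]) :
  psd P1 -> psd Q1 -> psd Q2 -> 0 <= c ->
  \tr Q1 + \tr (Q2 *m block_weights) + c * 2 < \tr P1 ->
  exists2 y, admissible y &
    qform Q1 (head_vec y) + qform Q2 (block_vec y) + c * ((tail_load y)%:C + 1) < qform P1 (head_vec y).
Proof.
move=> pP1 pQ1 pQ2 c0 htr.
have ec := real_complex_Re c0; set r := complex.Re c in ec.
have r0 : 0 <= r by move: c0; rewrite ec lecR.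
have orthD s t : coef mu (fun s => psi (m + s)%N) (psi (m + s)%N : U -> R[i]^o) t = (s == t)%:R.
  by rewrite -(eqn_add2l m) -orth.
have [f1 [rf1 f10 ef1 tf1]] := qform_mean psi2 orth (fun=> 1) pP1.
have [g1 [rg1 g10 eg1 tg1]] := qform_mean psi2 orth (fun=> 1) pQ1.
have [g2 [rg2 g20 eg2 tg2]] := qform_mean (fun s => psi2 (m + s)%N) orthD
  (fun s : 'I_D => w (m + s) / Num.sqrt eta) pQ2.
have id1 : diag_mx (\row_(s < m) (((1 : R) ^+ 2)%:C)) = 1%:M :> 'M[R[i]]_m.
  by rewrite -diag_const_mx; congr diag_mx; apply/rowP => s; rewrite !mxE expr1n.
rewrite id1 mulmx1 in tf1; rewrite id1 mulmx1 in tg1.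
move: htr; rewrite -tf1 -tg1 -/block_weights -tg2 ec.
rewrite -[2]/(2%:R) -(rmorph_nat (real_complex R)) -rmorphM -!rmorphD ltcR => htr.
apply: contrapT => Hn.
have le_ae : {ae mu, forall y, ((f1 y)%:E <= (g1 y + g2 y + r)%:E + (r / eta)%:E * tail_energy y)%E}.
  apply: filterS admissible_ae => y vy.
  have fy : tail_energy y \is a fin_num by rewrite ge0_fin_numE ?tail_energy_ge0 //; exact: vy.2.
  rewrite -(fineK fy) -EFinM -EFinD lee_fin leNgt; apply/negP => hlt.
  apply: Hn; exists y => //; rewrite ef1 eg1 eg2.
  rewrite -[1]/(1%:R) -(rmorph_nat (real_complex R)) -!rmorphD -rmorphM -rmorphD ltcR.
  apply: le_lt_trans hlt; rewrite /tail_load; apply: eq_le_of; ring.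
have re0 : 0 <= r / eta by rewrite divr_ge0 // ltW.
have m1 : measurable_fun setT (fun y => (g1 y + g2 y + r)%:E).
  by apply/measurable_EFinP; apply: (rintP (rintD (rintD rg1 rg2) (rint_cst mu r))).1.
have m2 : measurable_fun setT (fun y => ((r / eta)%:E * tail_energy y)%E).
  by apply: measurable_funeM; exact: tail_energy_measurable.
have : (\int[mu]_y (f1 y)%:E <=
    \int[mu]_y ((g1 y + g2 y + r)%:E + (r / eta)%:E * tail_energy y))%E.
  apply: ge0_integral_le_ae => // y.
  apply: adde_ge0; first by rewrite lee_fin !addr_ge0.
  by apply: mule_ge0; [rewrite lee_fin|exact: tail_energy_ge0].
rewrite ge0_integralD //; last 2 first.
- by move=> y _; rewrite lee_fin !addr_ge0.
- by move=> y _; apply: mule_ge0; [rewrite lee_fin|exact: tail_energy_ge0].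
rewrite ge0_integralZl //; [|exact: tail_energy_measurable|by move=> y _; exact: tail_energy_ge0].
rewrite (rintP rf1).2 (rintP (rintD (rintD rg1 rg2) (rint_cst mu r))).2.
rewrite RintD //; [|exact: rintD|exact: rint_cst].
rewrite RintD // Rint_cst => hle.
have : ((\int[mu]_u f1 u)%:E <= (\int[mu]_u g1 u + \int[mu]_u g2 u + r)%:E + (r / eta)%:E * eta%:E)%E.
  by apply: le_trans hle _; rewrite leeD2l // lee_wpmul2l ?lee_fin // tail_energy_integral.
rewrite -EFinM -EFinD lee_fin divfK ?gt_eqF // leNgt => /negP; apply.
by apply: le_lt_trans htr; rewrite mulr_natr mulr2n addrA.
Qed.

End Selection.

(** * Regular representatives of an orthonormal basis *)

Section BasisRep.
Context d (U : measurableType d) (R : realType) (mu : probability U R).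

(** The basis is countable, so one null set contains all exceptional points, and
    coefficients and norms depend only on classes modulo null sets. *)
Lemma basis_rep (phi : nat -> U -> R[i]) : orthonormal_basis mu phi ->
  exists psi : nat -> U -> R[i],
    [/\ forall s, sq2 mu (psi s : U -> R[i]^o),
        {ae mu, forall y, forall s, phi s y = psi s y} &
        orthonormal_basis mu psi].
Proof.
move=> [h1 h2 h3].
have hex s : exists psi : U -> R[i]^o, sq2 mu psi /\ {ae mu, forall y, phi s y = psi y}.
  by have [f' sf ff] := L2_rep (h1 s); exists f'.
have [psi hpsi] := choice hex.
have p2 s := (hpsi s).1.
have pae s := (hpsi s).2.
exists psi; split; [exact: p2|exact: ae_foralln pae|].
have cE (v : U -> R[i]^o) s : L2 mu v -> coef mu phi v s = coef mu psi v s.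
  move=> /L2_rep [v' sv vv].
  apply: (etrans (coef_ae (p2 s) sv (pae s) vv)).
  apply/esym; apply: (coef_ae (p2 s) sv _ vv); exact: aeW.
split.
- move=> s; apply: sq2_L2; exact: p2.
- move=> s t; apply: etrans (h2 s t); apply/esym.
  exact: (coef_ae (p2 t) (p2 s) (pae t) (pae s)).
- move=> f Lf.
  have e : (fun n => L2norm mu (fun u => f u - pt_series mu phi f u n)) =
           (fun n => L2norm mu (fun u => f u - pt_series mu psi f u n)).
    apply/funext => n; apply: L2norm_ae.
    have hu := ae_foralln pae; move: hu; apply: filterS => u hu.
    suff -> : pt_series mu phi f u n = pt_series mu psi f u n by [].
    rewrite /pt_series; apply: eq_bigr => s _.
    have e1 := hu s; have e2 := cE f s Lf.
    by rewrite e2 e1.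
  exact: (eq_ind _ (fun F : nat -> \bar R => F n @[n --> \oo] --> 0%E) (h3 f Lf) _ e).
Qed.

End BasisRep.

(** * Bounds for sums and series *)

Section SumBounds.
Context {R : realType}.

Lemma cauchy_schwarz_sum n (a b : 'I_n -> R) :
  (\sum_i a i * b i) ^+ 2 <= (\sum_i a i ^+ 2) * (\sum_i b i ^+ 2).
Proof.
elim: n a b => [|n IH] a b; first by rewrite !big_ord0 expr0n mul0r.
rewrite !big_ord_recr /=.
have := IH (fun i => a (widen_ord (leqnSn n) i)) (fun i => b (widen_ord (leqnSn n) i)).
set S := \sum_(i < n) _; set A := \sum_(i < n) _; set B := \sum_(i < n) _ => h.
have A0 : 0 <= A by apply: sumr_ge0 => i _; exact: sqr_ge0.
have B0 : 0 <= B by apply: sumr_ge0 => i _; exact: sqr_ge0.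
set x := a ord_max; set y := b ord_max.
have key : 2 * S * (x * y) <= A * y ^+ 2 + B * x ^+ 2.
  have hS : `|S| <= Num.sqrt A * Num.sqrt B.
    by rewrite -sqrtrM // -sqrtr_sqr ler_sqrt // mulr_ge0.
  have h1 : S * (x * y) <= Num.sqrt A * Num.sqrt B * (`|x| * `|y|).
    apply: le_trans (ler_norm _) _; rewrite !normrM.
    by apply: ler_pM => //; rewrite ?normr_ge0 // -normrM normr_ge0.
  have := sqr_ge0 (Num.sqrt A * `|y| - Num.sqrt B * `|x|).
  rewrite sqrrB !exprMn !sqr_sqrtr // !real_normK ?num_real //; nra.
by nra.
Qed.

Lemma nneseries_partial (u : nat -> R) (B : R) :
  (forall s, 0 <= u s) -> (\sum_(0 <= s <oo) (u s)%:E <= B%:E)%E ->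
  forall n, \sum_(s < n) u s <= B.
Proof.
move=> u0 hB n; rewrite -lee_fin; apply: le_trans hB.
rewrite -(big_mkord xpredT) -sumEFin.
by apply: nneseries_lim_ge => s _ _; rewrite lee_fin.
Qed.

Lemma nneseries_tail_small (u : nat -> R) (B e : R) :
  (forall s, 0 <= u s) -> (\sum_(0 <= s <oo) (u s)%:E <= B%:E)%E -> 0 < e ->
  exists2 D, (0 < D)%N & (\sum_(0 <= s <oo) (u (D + s)%N)%:E <= e%:E)%E.
Proof.
move=> u0 hB e0.
have fin : (\sum_(0 <= s <oo) (u s)%:E < +oo)%E by apply: le_lt_trans hB _; rewrite ltry.
have := nneseries_tail_cvg fin (fun s _ => u0 s : (0 <= (u s)%:E)%E).
move=> /fine_cvgP [[N1 _ h1] /cvgrPdist_le /(_ _ e0) [N2 _ h2]].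
pose D := (maxn N1 N2).+1; exists D => //.
have d1 : (N1 <= D)%N by rewrite /D leqW // leq_maxl.
have d2 : (N2 <= D)%N by rewrite /D leqW // leq_maxr.
have := h2 _ d2; have := h1 _ d1; rewrite /= => f1.
rewrite sub0r normrN ger0_norm; last first.
  by apply: fine_ge0; apply: nneseries_ge0 => s _ _; rewrite lee_fin.
rewrite -lee_fin fineK // => h; apply: le_trans h; apply: eq_le_of.
rewrite -[RHS]nneseries_addn //.
by apply: eq_eseriesr => s _; rewrite addnC.
Qed.

End SumBounds.

(** * Stable sample points *)

Section GoodSample.
Context d (U : measurableType d) (R : realType) (mu : probability U R).
Variables (phi : nat -> U -> R[i]) (U0 : set U) (sigma : nat -> R) (m : nat) (eta : R).
Hypothesis basis : orthonormal_basis mu phi.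
Hypothesis U0_full : mu.-negligible (~` U0).
Hypotheses (m_gt0 : (0 < m)%N) (eta_gt0 : 0 < eta).
Hypotheses (sigma_gt0 : forall s, 0 < sigma s)
  (sigma_nd : forall s t, (s <= t)%N -> sigma s <= sigma t).
Hypothesis eta_max : (sigma m)^-1 ^+ 2 <= eta.
Hypothesis eta_sum : (\sum_(0 <= s <oo) ((sigma (m + s)%N)^-1 ^+ 2)%:E <= (m%:R * eta)%:E)%E.

(** The points control functions spanned by the first m basis functions from
    below, and partial sums of the tail of the expansion from above, for
    coefficients in any Hilbert space at once. *)
Definition stable_sample (y : nat -> U) (t : nat -> R) : Prop :=
  [/\ forall i, (i < 16 * m)%N -> U0 (y i) /\ 0 < t i,
   forall (X : normedModType R[i]) (ip : X -> X -> R), real_inner ip ->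
     forall x : 'I_m -> X, m%:R * \sum_s nrm (x s) ^+ 2 <=
       \sum_(i < 16 * m) t i * nrm (\sum_(s < m) phi s (y i) *: x s) ^+ 2 &
   forall (X : normedModType R[i]) (ip : X -> X -> R), real_inner ip ->
     forall (x : nat -> X) (B : R),
     (forall k, \sum_(s < k) (sigma s * nrm (x s)) ^+ 2 <= B) ->
     exists n0, forall n, (n0 <= n)%N ->
     \sum_(i < 16 * m) t i * nrm (\sum_(m <= s < n) phi s (y i) *: x s) ^+ 2
       <= 66 * m%:R * eta * B].

(** The tail is split at m + D, where D is so large that the squared weights
    beyond m + D have sum at most eta.  The block of length D obeys the upper
    barrier, with constant 17.  Beyond it, Cauchy--Schwarz bounds the value at
    y_i by the load of y_i, and the total load is at most 16 m.  The constant
    is 2 (17 + 16) = 66. *)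
Theorem stable_sample_exists : exists y t, stable_sample y t.
Proof.
have [psi [psi2 pp [_ orth _]]] := basis_rep basis.
pose w s := (sigma s)^-1.
have w0 s : 0 < w s by rewrite invr_gt0.
have [D D0 wD] := nneseries_tail_small (fun s => sqr_ge0 (w (m + s)%N)) eta_sum eta_gt0.
have w_tail : (\sum_(0 <= s <oo) (w (m + D + s)%N ^+ 2)%:E <= eta%:E)%E.
  by under eq_eseriesr do rewrite -addnA.
pose good y := U0 y /\ forall s, phi s y = psi s y.
have good_ae : {ae mu, forall y, good y}.
  have u0 : {ae mu, forall y, U0 y}.
    by case: U0_full => N [mN N0 sN]; exists N; split.
  by apply: filterS2 u0 pp.
pose tC y := ((tail_load psi m D w eta y)%:C : R[i]).
have se : 0 < Num.sqrt eta by rewrite sqrtr_gt0.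
have r0 (s : 'I_D) : 0 < (w (m + s)%N / Num.sqrt eta) ^+ 2.
  by rewrite exprn_gt0 // divr_gt0.
have eL : block_weights m D w eta = diag_mx (\row_(s < D) ((w (m + s)%N / Num.sqrt eta) ^+ 2)%:C) by [].
have uL : block_weights m D w eta \in unitmx.
  rewrite unitmxE det_diag unitfE; apply/prodf_neq0 => s _.
  by rewrite mxE gt_eqF // ltcR.
have pL : psd (block_weights m D w eta).
  by apply: psd_diag => s; rewrite mxE lecR ltW.
have L1 : psd (1%:M - block_weights m D w eta).
  rewrite -diag_const_mx /block_weights -linearB; apply: psd_diag => s; rewrite !mxE.
  rewrite -[1]/(1%:C) -rmorphB lecR subr_ge0 expr_div_n (sqr_sqrtr (ltW eta_gt0)).
  rewrite ler_pdivrMr // mul1r; apply: le_trans eta_max.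
  rewrite -/(w m) ler_sqr ?nnegrE ?(ltW (w0 _)) // /w lef_pV2 ?posrE //.
  by apply: sigma_nd; exact: leq_addr.
have trL : \tr (block_weights m D w eta) <= m%:R.
  rewrite mxtrace_diag; under eq_bigr do rewrite mxE.
  rewrite -rmorph_sum -(rmorph_nat (real_complex R)) lecR.
  under eq_bigr do rewrite expr_div_n (sqr_sqrtr (ltW eta_gt0)).
  rewrite -mulr_suml ler_pdivrMr //.
  exact: (nneseries_partial (fun s => sqr_ge0 (w (m + s)%N)) eta_sum).
have tau0 y : admissible psi m D w good y -> 0 <= tC y.
  move=> _; rewrite /tC lecR /tail_load divr_ge0 ?(ltW eta_gt0) // fine_ge0 //; exact: tail_energy_ge0.
have sel := select_point psi2 orth eta_gt0 w_tail good_ae.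
have [y [tc [hg hA hB hT]]] := sparsification m_gt0 D0 uL pL L1 trL tau0 sel.
pose t i := complex.Re (tc i).
have tE i : (i < 16 * m)%N -> tc i = (t i)%:C.
  by move=> im; apply: real_complex_Re; apply: ltW; exact: (hg i im).2.
have t0 i : (i < 16 * m)%N -> 0 < t i.
  by move=> im; have := (hg i im).2; rewrite tE // ltcR.
have pE i s : (i < 16 * m)%N -> psi s (y i) = phi s (y i).
  by move=> im; rewrite ((hg i im).1.1.2 s).
exists y, t; split.
- by move=> i im; split; [exact: (hg i im).1.1.1|exact: t0].
- move=> X ip ipP x; have := vform_psd ipP x hA.
  rewrite (vformD ipP) (vformN ipP) (vform_sum ipP) -(rmorph_nat (real_complex R)) (vform_scalar ipP).
  rewrite subr_ge0 => h; apply: le_trans h _; apply: eq_le_of.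
  apply: eq_bigr => i _; rewrite (tE _ (ltn_ord i)) (vformZ ipP).
  rewrite (vform_rank_one ipP); congr (_ * nrm _ ^+ 2); apply: eq_bigr => s _.
  by rewrite mxE mul1r conjCK pE.
- move=> X ip ipP x B hB2; exists (m + D)%N => n nD.
  have B0 : 0 <= B by have := hB2 0%N; rewrite big_ord0.
  pose z1 i := \sum_(j < D) phi (m + j)%N (y i) *: x (m + j)%N.
  pose z2 i := \sum_(m + D <= s < n) phi s (y i) *: x s.
  have zE i : \sum_(m <= s < n) phi s (y i) *: x s = z1 i + z2 i.
    rewrite (@big_cat_nat _ _ _ (m + D)%N) ?leq_addr //=; congr (_ + _).
    rewrite /z1 -{1}[m]add0n big_addn addKn big_mkord.
    by apply: eq_bigr => j _; rewrite addnC.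
  have b1 : \sum_(i < 16 * m) t i * nrm (z1 i) ^+ 2 <= 17 * m%:R * eta * B.
    (* Coordinates are rescaled to undo the weights of [block_vec]. *)
    pose x' (j : 'I_D) := ((sigma (m + j)%N * Num.sqrt eta)%:C) *: x (m + j)%N.
    have := vform_psd ipP x' hB.
    rewrite (vformD ipP) (vformN ipP) (vform_sum ipP) -(rmorph_nat (real_complex R)) (vform_scalar ipP).
    rewrite subr_ge0 => h.
    have eS : \sum_(i < 16 * m) t i * nrm (z1 i) ^+ 2 =
       \sum_(i < 16 * m) vform ip (tc i *: (block_vec psi m D w eta (y i) *m (block_vec psi m D w eta (y i)) ^t*)) x'.
      apply: eq_bigr => i _; rewrite (tE _ (ltn_ord i)) (vformZ ipP).
      rewrite (vform_rank_one ipP); congr (_ * nrm _ ^+ 2); apply: eq_bigr => j _.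
      rewrite mxE rmorphM /= conjCK conj_realC pE // /x' scalerA; congr (_ *: _).
      rewrite mulrAC -rmorphM /= [X in X%:C](_ : _ = 1) ?mul1r //.
      by rewrite /w; field; rewrite !gt_eqF.
    rewrite eS; apply: le_trans h _.
    rewrite natrM -!mulrA ler_wpM2l // ler_wpM2l //.
    have -> : \sum_s nrm (x' s) ^+ 2 = eta * \sum_(j < D) (sigma (m + j)%N * nrm (x (m + j)%N)) ^+ 2.
      rewrite mulr_sumr; apply: eq_bigr => j _.
      rewrite nrmZ (cabs_real (mulr_ge0 (ltW (sigma_gt0 _)) (ltW se))) !exprMn (sqr_sqrtr (ltW eta_gt0)); ring.
    rewrite (ler_wpM2l (ltW eta_gt0)) //; apply: le_trans (hB2 (m + D)%N).
    rewrite big_split_ord /= lerDr; apply: sumr_ge0 => s _; exact: sqr_ge0.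
  have b2 : \sum_(i < 16 * m) t i * nrm (z2 i) ^+ 2 <= 16 * m%:R * eta * B.
    have z2b (i : 'I_(16 * m)) : nrm (z2 i) ^+ 2 <= tail_load psi m D w eta (y i) * (eta * B).
      have [vg _] := hg i (ltn_ord i).
      have efin : tail_energy psi m D w (y i) \is a fin_num.
        by rewrite ge0_fin_numE ?tail_energy_ge0 //; exact: vg.2.
      have pos s : 0 <= w (m + D + s)%N ^+ 2 * nrm (psi (m + D + s)%N (y i) : R[i]^o) ^+ 2.
        by rewrite mulr_ge0 ?sqr_ge0.
      have etE : (\sum_(0 <= s <oo) (w (m + D + s)%N ^+ 2 * nrm (psi (m + D + s)%N (y i) : R[i]^o) ^+ 2)%:E
            <= (fine (tail_energy psi m D w (y i)))%:E)%E by rewrite fineK.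
      have part := nneseries_partial pos etE (n - (m + D)).
      have -> : tail_load psi m D w eta (y i) * (eta * B) = fine (tail_energy psi m D w (y i)) * B.
        by rewrite /tail_load; field; rewrite gt_eqF.
      have e2 : z2 i = \sum_(j < n - (m + D)) phi (m + D + j)%N (y i) *: x (m + D + j)%N.
        rewrite /z2 -{1}[(m + D)%N]add0n big_addn big_mkord.
        by apply: eq_bigr => j _; rewrite addnC.
      have n1 : nrm (z2 i) <= \sum_(j < n - (m + D))
          (w (m + D + j)%N * nrm (psi (m + D + j)%N (y i) : R[i]^o)) *
          (sigma (m + D + j)%N * nrm (x (m + D + j)%N)).
        rewrite e2; apply: le_trans (nrm_sum _ _ _) _; apply: ler_sum => j _.
        rewrite nrmZ nrm_regular pE // /w; apply: eq_le_of.
        by field; rewrite gt_eqF.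
      apply: (@le_trans _ _ ((\sum_(j < n - (m + D))
          (w (m + D + j)%N * nrm (psi (m + D + j)%N (y i) : R[i]^o)) *
          (sigma (m + D + j)%N * nrm (x (m + D + j)%N))) ^+ 2)).
        rewrite ler_sqr ?nnegrE ?nrm_ge0 //.
        by apply: le_trans (nrm_ge0 _) n1.
      apply: le_trans (cauchy_schwarz_sum _ _) _; apply: ler_pM.
      + by apply: sumr_ge0 => j _; exact: sqr_ge0.
      + by apply: sumr_ge0 => j _; exact: sqr_ge0.
      + by under eq_bigr do rewrite exprMn.
      + apply: le_trans (hB2 (m + D + (n - (m + D)))%N).
        rewrite big_split_ord /= lerDr; apply: sumr_ge0 => s _; exact: sqr_ge0.
    have hT' : \sum_(i < 16 * m) t i * tail_load psi m D w eta (y i) <= (16 * m)%:R.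
      rewrite -lecR rmorph_sum rmorph_nat; apply: le_trans hT.
      apply: eq_le_of; apply: eq_bigr => i _.
      by rewrite (tE _ (ltn_ord i)) -rmorphM.
    apply: (@le_trans _ _ ((16 * m)%:R * (eta * B))).
      apply: le_trans (ler_wpM2r _ hT'); last by rewrite mulr_ge0 // ltW.
      rewrite mulr_suml; apply: ler_sum => i _; rewrite -mulrA.
      by apply: ler_wpM2l; [exact: ltW (t0 _ (ltn_ord i))|exact: z2b].
    by rewrite natrM !mulrA.
  apply: (@le_trans _ _ (2 * (17 * m%:R * eta * B) + 2 * (16 * m%:R * eta * B))); last first.
    by apply: eq_le_of; ring.
  apply: le_trans (lerD (ler_wpM2l _ b1) (ler_wpM2l _ b2)) => //.
  rewrite !mulr_sumr -big_split /=; apply: ler_sum => i _.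
  rewrite zE [leRHS](_ : _ = t i * (2 * nrm (z1 i) ^+ 2 + 2 * nrm (z2 i) ^+ 2)); last by ring.
  by apply: ler_wpM2l; [exact: ltW (t0 _ (ltn_ord i))|exact: sqr_nrmD].
Qed.

End GoodSample.

(** * Coefficients of square integrable classes *)

Section L2Coefficients.
Context d (U : measurableType d) (R : realType) (mu : probability U R).
Variable phi : nat -> U -> R[i].
Hypothesis basis : orthonormal_basis mu phi.

Lemma coef_L2_rep (X : normedModType R[i]) (v : U -> X) : L2 mu v ->
  exists psi v', [/\ forall s, sq2 mu (psi s : U -> R[i]^o),
    orthonormal_basis mu psi, sq2 mu v', {ae mu, forall y, v y = v' y} &
    forall s, coef mu phi v s = coef mu psi v' s].
Proof.
move=> Lv; have [psi [p2 pp bp]] := basis_rep basis.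
have [v' sv vv] := L2_rep Lv.
exists psi, v'; split; [exact: p2|exact: bp|exact: sv|exact: vv|].
move=> s; apply: (coef_ae (p2 s) sv _ vv).
by move: pp; apply: filterS => y; apply.
Qed.

Section OneSpace.
Variables (X : normedModType R[i]) (ip : X -> X -> R).
Hypotheses (ipP : real_inner ip) (cX : seq_complete X).

Let psi_ex := basis_rep basis.

Lemma coef_L2D (v w : U -> X) s : L2 mu v -> L2 mu w ->
  coef mu phi (fun u => v u + w u) s = coef mu phi v s + coef mu phi w s.
Proof.
move=> Lv Lw; have [psi [p2 pp bp]] := psi_ex.
have pps : {ae mu, forall y, phi s y = psi s y}.
  by move: pp; apply: filterS => y; apply.
have [v' sv vv] := L2_rep Lv; have [w' sw ww] := L2_rep Lw.
have vw : {ae mu, forall u, v u + w u = v' u + w' u}.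
  by move: vv ww; apply: filterS2 => u -> ->.
apply: (etrans (coef_ae (p2 s) (sq2D sv sw) pps vw)).
apply: (etrans (coefD_rep ipP cX p2 s sv sw)).
have e1 := coef_ae (p2 s) sv pps vv; have e2 := coef_ae (p2 s) sw pps ww.
by congr (_ + _); apply: esym.
Qed.

Lemma coef_bounded_linear (T : X -> X) (v : U -> X) s : bounded_linear T -> L2 mu v ->
  coef mu phi (T \o v) s = T (coef mu phi v s).
Proof.
move=> bT Lv; have [psi [p2 pp bp]] := psi_ex.
have pps : {ae mu, forall y, phi s y = psi s y}.
  by move: pp; apply: filterS => y; apply.
have [v' sv vv] := L2_rep Lv.
have Tv : {ae mu, forall u, (T \o v) u = (T \o v') u}.
  by move: vv; apply: filterS => u /= ->.
apply: (etrans (coef_ae (p2 s) (sq2_bounded_linear bT sv) pps Tv)).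
apply: (etrans (coef_linear_rep s ipP cX ipP cX p2 bT sv)).
by have e1 := coef_ae (p2 s) sv pps vv; apply: congr1; apply: esym.
Qed.

Lemma L2_comb n (x : 'I_n -> X) : L2 mu (fun u => \sum_(s < n) phi s u *: x s).
Proof.
apply: L2_sum => s _; apply: L2_scale_vec.
by case: basis => h _ _; exact: h.
Qed.

Lemma coef_comb_L2 n (x : 'I_n -> X) s :
  coef mu phi (fun u => \sum_(t < n) phi t u *: x t) s =
  \sum_(t < n) (t == s :> nat)%:R *: x t.
Proof.
have [psi [p2 pp [_ orth _]]] := psi_ex.
have pps : {ae mu, forall y, phi s y = psi s y}.
  by move: pp; apply: filterS => y; apply.
have cc : {ae mu, forall u, \sum_(t < n) phi t u *: x t = \sum_(t < n) psi t u *: x t}.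
  by move: pp; apply: filterS => u hu; apply: eq_bigr => t _; rewrite hu.
apply: (etrans (coef_ae (p2 s) (sq2_comb p2 x) pps cc)).
exact: (coef_comb ipP cX p2 orth x s).
Qed.

Lemma parseval_le (v : U -> X) (B : R) : L2 mu v -> 0 <= B ->
  (forall n, \sum_(s < n) nrm (coef mu phi v s) ^+ 2 <= B ^+ 2) ->
  (L2norm mu v <= B%:E)%E.
Proof.
move=> Lv B0 hB; have [psi [v' [p2 bp sv vv cE]]] := coef_L2_rep Lv.
have h : energy mu v' <= B ^+ 2.
  apply: (parseval_le_rep ipP cX p2 bp sv) => n.
  apply: le_trans (hB n); apply: eq_le_of.
  by apply: eq_bigr => s _; rewrite -(cE s).
rewrite (L2norm_ae vv) (L2normE sv) lee_fin -(ger0_norm B0) -sqrtr_sqr.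
by rewrite ler_sqrt // sqr_ge0.
Qed.

End OneSpace.

End L2Coefficients.

(** * Weighted least squares *)

Lemma moore_penrose_full_rank (C : numClosedFieldType) l m (B : 'M[C]_(l, m)) :
  B ^t* *m B \in unitmx ->
  let G := invmx (B ^t* *m B) *m B ^t* in G *m B = 1%:M /\ moore_penrose B G.
Proof.
move=> uA G; have GB : G *m B = 1%:M by rewrite -mulmxA mulVmx.
have hA : (B ^t* *m B) ^t* = B ^t* *m B by rewrite adjM trmxCK.
split=> //; split.
- by rewrite -mulmxA GB mulmx1.
- by rewrite GB mul1mx.
- by rewrite /G !adjM trmxCK adj_inv hA !mulmxA.
- by rewrite GB trmx1 map_mx1.
Qed.

Section WeightedLeastSquares.
Context d (U : measurableType d) (R : realType) (mu : probability U R).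
Variables (phi : nat -> U -> R[i]) (U0 : set U) (sigma : nat -> R) (m : nat) (eta : R).
Hypothesis basis : orthonormal_basis mu phi.
Hypotheses (m_gt0 : (0 < m)%N) (eta_gt0 : 0 < eta).
Hypotheses (sigma_gt0 : forall s, 0 < sigma s)
  (sigma_nd : forall s t, (s <= t)%N -> sigma s <= sigma t).
Hypothesis eta_max : (sigma m)^-1 ^+ 2 <= eta.
Variables (y : nat -> U) (t : nat -> R).
Hypothesis sample : stable_sample phi U0 sigma m eta y t.
Variable l : nat.
Hypothesis l_ge : (16 * m <= l)%N.

Let sample_good i : (i < 16 * m)%N -> U0 (y i) /\ 0 < t i.
Proof. by case: sample => h _ _; exact: h. Qed.

(** Points beyond the 16 m good ones repeat the first point and carry the
    weight 0, which makes the number of points exactly l. *)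
Definition sample_pt (i : nat) : U := if (i < 16 * m)%N then y i else y 0%N.
Definition sample_weight (i : nat) : R := if (i < 16 * m)%N then t i else 0.

Let sample_weight_ge0 i : 0 <= sample_weight i.
Proof. by rewrite /sample_weight; case: ifP => // /sample_good [_ /ltW]. Qed.

Lemma sample_pt_good i : U0 (sample_pt i).
Proof.
rewrite /sample_pt; case: ifP => [/sample_good[]//|_].
by apply: (sample_good _).1; rewrite muln_gt0.
Qed.

Lemma sample_weight_sum (F : U -> nat -> R) :
  \sum_(i < l) sample_weight i * F (sample_pt i) i = \sum_(i < 16 * m) t i * F (y i) i.
Proof.
rewrite -(big_mkord xpredT (fun i => sample_weight i * F (sample_pt i) i)).
rewrite -(big_mkord xpredT (fun i => t i * F (y i) i)).
rewrite (@big_cat_nat _ _ _ (16 * m)%N) //= [X in _ + X]big_nat_cond [X in _ + X]big1 ?addr0.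
  by apply: eq_big_nat => i /andP[_ im]; rewrite /sample_weight /sample_pt im.
move=> i /andP[/andP[im _] _]; rewrite /sample_weight ifF ?mul0r //.
by apply/negbTE; rewrite -leqNgt.
Qed.

Let L : 'M[R[i]]_(l, m) := \matrix_(i < l, s < m) phi s (sample_pt i).
Let Wsqrt : 'M[R[i]]_l := diag_mx (\row_(i < l) (Num.sqrt (sample_weight i))%:C).
Let B := Wsqrt *m L.
Let A := B ^t* *m B.
Let G := invmx A *m B ^t*.

Let BE i s : B i s = (Num.sqrt (sample_weight i))%:C * phi s (sample_pt i).
Proof. by rewrite /B mul_diag_mx !mxE. Qed.

Let A_unit : A \in unitmx.
Proof.
have -> : A = (A - (m%:R : R[i])%:M) + (m%:R)%:M by rewrite subrK.
apply: psd_addr_unit; first by rewrite ltr0n.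
split.
  by rewrite adjD adjN adj_scalar /A adjM trmxCK conjC_nat.
move=> x; rewrite qformD /A qform_gram.
have [_ /(_ _ _ (@regular_real_inner R) (fun s => x s 0)) h _] := sample.
have -> : ((B *m x) ^t* *m (B *m x)) 0 0 =
    (\sum_(i < l) sample_weight i * cabs (\sum_(s < m) phi s (sample_pt i) * x s 0) ^+ 2)%:C.
  rewrite mxE rmorph_sum; apply: eq_bigr => i _.
  have -> : ((B *m x) ^t*) 0 i = Num.conj ((B *m x) i 0) by rewrite 2!mxE.
  have -> : (B *m x) i 0 = (Num.sqrt (sample_weight i))%:C * \sum_(s < m) phi s (sample_pt i) * x s 0.
    rewrite mxE mulr_sumr; apply: eq_bigr => s _; by rewrite BE mulrA.
  set z := \sum_(s < m) _; rewrite rmorphM /= conj_realC mulrACA.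
  rewrite -rmorphM /= -expr2 sqr_sqrtr // [Num.conj z * z]mulrC -cabs_sqr.
  by rewrite -rmorphM.
rewrite (sample_weight_sum (fun u _ => cabs (\sum_(s < m) phi s u * x s 0) ^+ 2)).
have -> : qform (- (m%:R)%:M) x = - (m%:R * \sum_(s < m) cabs (x s 0) ^+ 2)%:C.
  rewrite /qform mulmxN mulNmx mxE mul_mx_scalar -scalemxAl mxE mxE; congr (- _).
  rewrite rmorphM /= rmorph_nat; congr (_ * _); rewrite rmorph_sum.
  by apply: eq_bigr => s _; rewrite !mxE /= mulrC -cabs_sqr.
by rewrite -rmorphB lecR subr_ge0.
Qed.

Let GB : G *m B = 1%:M := (moore_penrose_full_rank A_unit).1.
Let AG : A *m G = B ^t*.
Proof. by rewrite /G mulmxA mulmxV // mul1mx. Qed.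

Definition wls_fun (i : nat) (u : U) : R[i] :=
  if insub i is Some j then \sum_(s < m) (G *m Wsqrt) s (j : 'I_l) * phi s u else 0.

Lemma wls_fun_ord (i : 'I_l) u : wls_fun i u = \sum_(s < m) (G *m Wsqrt) s i * phi s u.
Proof. by rewrite /wls_fun valK. Qed.

Lemma wls_fun_L2 i : L2C mu (wls_fun i).
Proof.
rewrite /wls_fun; case: insubP => [j _ _|_]; last exact: L2_0.
apply: (L2_sum (X := R[i]^o)) => s _.
by apply: (L2Z (X := R[i]^o)); case: basis => h _ _; exact: h.
Qed.

Lemma wls_fun_wls : weighted_least_squares phi l sample_pt wls_fun.
Proof.
exists m, (fun i => sample_weight i), G; split.
- by rewrite m_gt0 /=; apply: leq_trans l_ge; rewrite leq_pmull.
- by move=> i; exact: sample_weight_ge0.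
- exact: (moore_penrose_full_rank A_unit).2.
- move=> f u; under eq_bigr do rewrite wls_fun_ord mulr_sumr.
  rewrite exchange_big; apply: eq_bigr => s _.
  rewrite mulmxA [in RHS]mxE mulr_suml; apply: eq_bigr => i _.
  by rewrite [X in _ = _ * X * _]mxE mulrCA mulrA.
Qed.

Section VectorValued.
Variables (X : normedModType R[i]) (ip : X -> X -> R).
Hypothesis ipP : real_inner ip.

Let adjoint_sum (e : 'I_m -> X) (q : 'I_l -> X) :
  \sum_(i < l) sample_weight i * ip (\sum_(s < m) phi s (sample_pt i) *: e s) (q i) =
  \sum_(s < m) ip (e s) (\sum_(i < l) ((sample_weight i)%:C * Num.conj (phi s (sample_pt i))) *: q i).
Proof.
transitivity (\sum_(i < l) \sum_(s < m)
    ip (e s) (((sample_weight i)%:C * Num.conj (phi s (sample_pt i))) *: q i)).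
  apply: eq_bigr => i _; rewrite (ip_suml ipP) mulr_sumr; apply: eq_bigr => s _.
  by rewrite -scalerA (ipZr ipP) (ip_adj ipP).
by rewrite exchange_big; apply: eq_bigr => s _; rewrite (ip_sumr ipP).
Qed.

(** By the normal equations the fitted values are the orthogonal projection of
    the data, so their weighted norm is at most that of the data; the lower
    bound of the sample turns this into a bound for the coefficients. *)
Lemma wls_stability (e : 'I_m -> X) (r : 'I_l -> X) :
  (forall s, e s = \sum_(i < l) (G *m Wsqrt) s i *: r i) ->
  m%:R * \sum_s nrm (e s) ^+ 2 <= \sum_(i < l) sample_weight i * nrm (r i) ^+ 2.
Proof.
move=> he; pose v (i : 'I_l) := \sum_(s < m) phi s (sample_pt i) *: e s.
have normal (s : 'I_m) : \sum_(i < l) ((sample_weight i)%:C * Num.conj (phi s (sample_pt i))) *: v i =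
    \sum_(i < l) ((sample_weight i)%:C * Num.conj (phi s (sample_pt i))) *: r i.
  transitivity (\sum_(k < m) A s k *: e k).
    under eq_bigr do rewrite /v scaler_sumr.
    rewrite exchange_big; apply: eq_bigr => k _.
    rewrite mxE scaler_suml; apply: eq_bigr => i _.
    rewrite scalerA 2!mxE !BE rmorphM /= conj_realC; congr (_ *: _).
    by rewrite -{1}(sqr_sqrtr (sample_weight_ge0 i)) rmorphXn /=; ring.
  transitivity (\sum_(i < l) (A *m (G *m Wsqrt)) s i *: r i).
    under eq_bigr do rewrite he scaler_sumr.
    rewrite exchange_big; apply: eq_bigr => i _.
    by rewrite mxE scaler_suml; apply: eq_bigr => k _; rewrite scalerA.
  apply: eq_bigr => i _; congr (_ *: _).
  have BtE : (B ^t*) s i = Num.conj (B i s) by rewrite 2!mxE.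
  rewrite mulmxA AG mul_mx_diag [LHS]mxE [X in _ * X = _]mxE BtE BE rmorphM /= conj_realC.
  by rewrite -[in RHS](sqr_sqrtr (sample_weight_ge0 i)) rmorphXn /=; ring.
have n1 : \sum_(i < l) sample_weight i * nrm (v i) ^+ 2 = \sum_(i < l) sample_weight i * ip (v i) (r i).
  transitivity (\sum_(i < l) sample_weight i * ip (v i) (v i)).
    by apply: eq_bigr => i _; rewrite (ipxx ipP).
  by rewrite !adjoint_sum; apply: eq_bigr => s _; rewrite normal.
have n2 : \sum_(i < l) sample_weight i * nrm (v i) ^+ 2 <= \sum_(i < l) sample_weight i * nrm (r i) ^+ 2.
  have : 2 * \sum_(i < l) sample_weight i * nrm (v i) ^+ 2 <=
      \sum_(i < l) sample_weight i * nrm (v i) ^+ 2 + \sum_(i < l) sample_weight i * nrm (r i) ^+ 2.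
    rewrite {1}n1 mulr_sumr -big_split; apply: ler_sum => i _ /=.
    rewrite mulrCA -mulrDr; apply: ler_wpM2l => //.
    have := ip_cauchy ipP (v i) (r i); have := ler_norm (ip (v i) (r i)).
    by have := sqr_ge0 (nrm (v i) - nrm (r i)); nra.
  by rewrite mulr_natl mulr2n lerD2l.
apply: le_trans n2; have [_ /(_ _ _ ipP e) h _] := sample.
rewrite (sample_weight_sum (fun u _ => nrm (\sum_(s < m) phi s u *: e s) ^+ 2)).
exact: h.
Qed.

Hypothesis cX : seq_complete X.

(** The algorithm reproduces the first m terms of the expansion, so its first m
    coefficients are off by the fit e of the tail values r, of energy at most
    66 eta b^2 by [wls_stability].  The other coefficients of w are lost, and
    their energy is at most eta b^2, as sigma_s^-2 <= eta for s >= m. *)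
Theorem wls_error (w : U -> X) (b : R) : L2 mu w -> 0 <= b ->
  (forall i, (i < l)%N -> cvg (pt_series mu phi w (sample_pt i) n @[n --> \oo])) ->
  (forall k, \sum_(s < k) (sigma s * nrm (coef mu phi w s)) ^+ 2 <= b ^+ 2) ->
  let S := samp_op mu phi l sample_pt wls_fun w in
  L2 mu S /\ (L2norm mu (fun u => w u - S u)%R <= (Num.sqrt (67 * eta) * b)%:E)%E.
Proof.
move=> Lw b0 hcv hb S.
pose x s := coef mu phi w s.
pose z (i : 'I_l) := pt_eval mu phi w (sample_pt i).
pose r (i : 'I_l) := z i - \sum_(s < m) phi s (sample_pt i) *: x s.
pose e (s : 'I_m) := \sum_(i < l) (G *m Wsqrt) s i *: r i.
pose g (s : 'I_m) := x s + e s.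
have SE u : S u = \sum_(s < m) phi s u *: g s.
  have gE (s : 'I_m) : g s = \sum_(i < l) (G *m Wsqrt) s i *: z i.
    have -> : \sum_(i < l) (G *m Wsqrt) s i *: z i =
       \sum_(i < l) (G *m Wsqrt) s i *: (\sum_(k < m) phi k (sample_pt i) *: x k) + e s.
      rewrite -big_split; apply: eq_bigr => i _ /=.
      by rewrite -scalerDr /r addrC subrK.
    congr (_ + _); under eq_bigr do rewrite scaler_sumr.
    rewrite exchange_big (bigD1 s) //= [X in _ = X + _](_ : _ = x s); last first.
      have : (G *m B) s s = 1 by rewrite GB mxE eqxx.
      rewrite /B mulmxA mxE => h1.
      under eq_bigr do rewrite scalerA.
      rewrite -scaler_suml -[RHS]scale1r -h1; congr (_ *: _).
      by apply: eq_bigr => i _; rewrite [L _ _]mxE.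
    rewrite big1 ?addr0 // => k ks.
    have : (G *m B) s k = 0 by rewrite GB mxE eq_sym (negPf ks).
    rewrite /B mulmxA mxE => h1.
    under eq_bigr do rewrite scalerA.
    rewrite -scaler_suml -[RHS](scale0r (x k)); congr (_ *: _); apply: etrans h1.
    by apply: eq_bigr => i _; rewrite [L _ _]mxE.
  rewrite /S /samp_op; under eq_bigr do rewrite wls_fun_ord scaler_suml.
  rewrite exchange_big; apply: eq_bigr => s _.
  rewrite gE scaler_sumr; apply: eq_bigr => i _.
  by rewrite scalerA mulrC.
have LS : L2 mu S.
  have := L2_comb basis g; congr L2; apply/funext => u; exact: esym (SE u).
split=> //.
have eb : \sum_s nrm (e s) ^+ 2 <= 66 * eta * b ^+ 2.
  have m0 : 0 < m%:R :> R by rewrite ltr0n.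
  rewrite -(ler_pM2l m0); apply: le_trans (wls_stability (fun s => erefl)) _.
  have [_ _ /(_ _ _ ipP x (b ^+ 2) hb) [n0 hn0]] := sample.
  have -> : m%:R * (66 * eta * b ^+ 2) = 66 * m%:R * eta * b ^+ 2 by ring.
  (* The values of the tail are limits of partial sums, for which the sample
   provides the bound. *)
  pose F n := \sum_(i < l) sample_weight i * nrm (\sum_(m <= s < n) phi s (sample_pt i) *: x s) ^+ 2.
  have hF n : (n0 <= n)%N -> F n <= 66 * m%:R * eta * b ^+ 2.
    move=> hn; rewrite /F (sample_weight_sum (fun u _ => nrm (\sum_(m <= s < n) phi s u *: x s) ^+ 2)).
    exact: hn0.
  have cF : F n @[n --> \oo] --> \sum_(i < l) sample_weight i * nrm (r i) ^+ 2.
    apply: cvg_big => [|i _]; first exact: add_continuous.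
    apply: cvgM; first exact: cvg_cst.
    have c1 : nrm (\sum_(m <= s < n) phi s (sample_pt i) *: x s) @[n --> \oo] --> nrm (r i).
      apply: cvg_nrm.
      have c2 : pt_series mu phi w (sample_pt i) n @[n --> \oo] --> z i by exact: hcv.
      have c3 : (fun n => pt_series mu phi w (sample_pt i) n - \sum_(s < m) phi s (sample_pt i) *: x s) n
          @[n --> \oo] --> r i.
        by apply: cvgB => //; exact: cvg_cst.
      move: c3; apply: cvg_trans; apply: near_eq_cvg.
      exists m => // n /= mn; rewrite /pt_series.
      rewrite -(big_mkord xpredT (fun s => phi s (sample_pt i) *: x s)).
      rewrite -(big_mkord xpredT (fun s => phi s (sample_pt i) *: coef mu phi w s)).
      by rewrite [X in X - _ = _](@big_cat_nat _ _ _ m) //= [LHS]addrC addKr.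
    exact: (cvgM c1 c1).
  rewrite -(cvg_lim (@Rhausdorff R) cF); apply: limr_le.
    by apply/cvg_ex; eexists; exact: cF.
  by exists n0 => // n /= hn; exact: hF.
have Lf : L2 mu (fun u => w u - S u) by exact: L2B.
apply: (parseval_le basis ipP cX Lf).
  by rewrite mulr_ge0 // sqrtr_ge0.
move=> n.
have cf s : coef mu phi (fun u => w u - S u) s =
    x s - \sum_(k < m) (k == s :> nat)%:R *: g k.
  have -> : (fun u => w u - S u) = (fun u => w u + \sum_(k < m) phi k u *: (- g k)).
    apply/funext => u; rewrite SE -sumrN; congr (_ + _).
    by apply: eq_bigr => k _; rewrite scalerN.
  rewrite (coef_L2D basis ipP cX s Lw (L2_comb basis _)); congr (_ + _).
  rewrite (coef_comb_L2 basis ipP cX) -sumrN; apply: eq_bigr => k _.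
  by rewrite scalerN.
have hi s : (m <= s)%N -> nrm (coef mu phi (fun u => w u - S u) s) ^+ 2 <=
    eta * (sigma s * nrm (x s)) ^+ 2.
  move=> ms; rewrite cf big1 ?subr0 => [|k _]; last first.
    rewrite (_ : _ == _ = false) ?scale0r //; apply/negbTE.
    by rewrite neq_ltn (leq_trans (ltn_ord k) ms).
  rewrite exprMn mulrA ler_peMl ?sqr_ge0 //.
  have sp := sigma_gt0 s; have smp := sigma_gt0 m.
  have h1 : (sigma m)^-1 ^+ 2 * (sigma s) ^+ 2 <= eta * sigma s ^+ 2.
    by rewrite ler_wpM2r ?sqr_ge0.
  apply: le_trans h1; rewrite -exprMn exprn_ege1 // mulrC ler_pdivlMr // mul1r.
  exact: sigma_nd.
have lo (s : 'I_m) : nrm (coef mu phi (fun u => w u - S u) s) ^+ 2 = nrm (e s) ^+ 2.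
  rewrite cf (bigD1 s) //= eqxx scale1r big1 ?addr0 => [|k ks]; last first.
    by rewrite (_ : _ == _ = false) ?scale0r //; exact/negbTE.
  by rewrite /g opprD addrA subrr sub0r nrmN.
pose c s := nrm (coef mu phi (fun u => w u - S u) s) ^+ 2.
have clo (s : 'I_m) : c s = nrm (e s) ^+ 2 by exact: lo.
have c0 s : 0 <= c s by exact: sqr_ge0.
have tot : \sum_(s < m + n) c s <= 67 * eta * b ^+ 2.
  rewrite big_split_ord /=.
  have -> : 67 * eta * b ^+ 2 = 66 * eta * b ^+ 2 + eta * b ^+ 2 by ring.
  apply: lerD; first by apply: le_trans eb; apply: ler_sum => s _; rewrite clo.
  apply: (@le_trans _ _ (eta * \sum_(s < n) (sigma (m + s)%N * nrm (x (m + s)%N)) ^+ 2)).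
    by rewrite mulr_sumr; apply: ler_sum => s _; apply: hi; exact: leq_addr.
  apply: ler_wpM2l; first exact: ltW.
  apply: le_trans (hb (m + n)%N); rewrite big_split_ord /= lerDr.
  by apply: sumr_ge0 => s _; exact: sqr_ge0.
rewrite exprMn sqr_sqrtr; last by rewrite mulr_ge0 // ltW.
have mono : \sum_(s < n) c s <= \sum_(s < m + n) c s.
  rewrite addnC big_split_ord /= lerDl; apply: sumr_ge0 => s _; exact: c0.
exact: le_trans mono tot.
Qed.

End VectorValued.

End WeightedLeastSquares.

(** * Decay of the weights *)

Section Decay.
Context {R : realType}.
Variables (q M : R) (sigma : nat -> R).
Hypotheses (q_gt0 : 0 < q) (q_lt2 : q < 2).
Hypotheses (sigma_gt0 : forall s, 0 < sigma s)
  (sigma_nd : forall s t, (s <= t)%N -> sigma s <= sigma t).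
Hypothesis sigma_lq : (lq_norm q (fun s => (sigma s)^-1)%R <= M%:E)%E.

Let inv_gt0 s : 0 < (sigma s)^-1. Proof. by rewrite invr_gt0. Qed.

Lemma lq_sum : (\sum_(0 <= s <oo) ((sigma s)^-1 `^ q)%:E <= (M `^ q)%:E)%E.
Proof.
have S0 : (0 <= \sum_(0 <= s <oo) (`|(sigma s)^-1| `^ q)%:E)%E.
  by apply: nneseries_ge0 => s _ _; rewrite lee_fin powR_ge0.
have M0 : (0 <= M%:E)%E by apply: le_trans sigma_lq; exact: poweR_ge0.
have := gt0_ler_poweR (ltW q_gt0) _ _ sigma_lq.
rewrite /lq_norm -poweRrM mulVf ?gt_eqF // poweRe1 // poweR_EFin.
rewrite !in_itv /= !leey !andbT poweR_ge0 M0 => /(_ isT isT); apply: le_trans.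
apply: eq_le_of; apply: eq_eseriesr => s _.
by rewrite ger0_norm // ltW.
Qed.

Lemma lq_bound_ge0 : 0 <= M.
Proof. by rewrite -lee_fin; apply: le_trans sigma_lq; exact: poweR_ge0. Qed.

(** By monotonicity the first s + 1 terms of the l_q sum are at least the last. *)
Lemma sigma_inv_decay s : (sigma s)^-1 <= M * s.+1%:R `^ (- q^-1).
Proof.
have part := nneseries_partial (fun s => powR_ge0 (sigma s)^-1 q) lq_sum s.+1.
have h : s.+1%:R * (sigma s)^-1 `^ q <= M `^ q.
  apply: le_trans part; rewrite mulr_natl -[X in _ *+ X](card_ord s.+1) -sumr_const.
  apply: ler_sum => i _; rewrite ge0_ler_powR ?nnegrE ?(ltW (inv_gt0 _)) //; first exact: ltW.
  by rewrite lef_pV2 ?posrE // sigma_nd // -ltnS.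
have s0 : 0 < s.+1%:R :> R by rewrite ltr0n.
have h2 : (sigma s)^-1 `^ q <= (M * s.+1%:R `^ (- q^-1)) `^ q.
  rewrite powRM ?lq_bound_ge0 ?powR_ge0 // -powRrM mulNr mulVf ?gt_eqF //.
  by rewrite powR_inv1 ?(ltW s0) // ler_pdivlMr // mulrC.
have := ge0_ler_powR (_ : 0 <= q^-1) _ _ h2; rewrite !nnegrE !powR_ge0.
rewrite -!powRrM mulfV ?gt_eqF // !powRr1 ?(ltW (inv_gt0 _)) ?mulr_ge0 ?powR_ge0 ?lq_bound_ge0 //.
by apply=> //; rewrite invr_ge0 ltW.
Qed.

Variable m : nat.
Hypothesis m_gt0 : (0 < m)%N.

(** The bound for sigma_s^-2, s >= m, that plays the role of eta in the
    sampling construction. *)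
Definition decay_eta := (M * m%:R `^ (- q^-1)) ^+ 2.

Let mr : 0 < m%:R :> R. Proof. by rewrite ltr0n. Qed.

Lemma sigma_inv_decay_m : (sigma m)^-1 <= M * m%:R `^ (- q^-1).
Proof.
apply: le_trans (sigma_inv_decay m) _; rewrite ler_wpM2l ?lq_bound_ge0 //.
rewrite !powRN lef_pV2 ?posrE ?powR_gt0 ?ltr0n //.
by apply: ge0_ler_powR; rewrite ?nnegrE ?ler0n ?ler_nat ?invr_ge0 //; exact: ltW.
Qed.

Lemma decay_eta_gt0 : 0 < decay_eta.
Proof.
rewrite /decay_eta exprn_gt0 //; apply: lt_le_trans sigma_inv_decay_m.
exact: inv_gt0.
Qed.

Lemma decay_eta_max : (sigma m)^-1 ^+ 2 <= decay_eta.
Proof.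
rewrite /decay_eta ler_sqr ?nnegrE ?(ltW (inv_gt0 _)) ?sigma_inv_decay_m //.
by apply: le_trans sigma_inv_decay_m; exact: ltW.
Qed.

(** sigma^-2 = sigma^-(2-q) sigma^-q, where the first factor is at most its
    bound at m and the second one is summable. *)
Lemma decay_eta_sum :
  (\sum_(0 <= s <oo) ((sigma (m + s)%N)^-1 ^+ 2)%:E <= (m%:R * decay_eta)%:E)%E.
Proof.
set a := M * m%:R `^ (- q^-1).
have a0 : 0 < a by apply: lt_le_trans sigma_inv_decay_m; exact: inv_gt0.
have M0 := lq_bound_ge0.
have q2 : 0 <= 2 - q by rewrite subr_ge0 ltW.
have e : m%:R * decay_eta = a `^ (2 - q) * M `^ q.
  have -> : M `^ q = a `^ q * m%:R.
    rewrite /a powRM ?powR_ge0 // -powRrM mulNr mulVf ?gt_eqF //.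
    by rewrite powR_inv1 ?ltW // divfK ?gt_eqF.
  rewrite mulrA -powRD; last by rewrite (gt_eqF a0) implybT.
  by rewrite subrK powR_mulrn ?ltW // mulrC.
rewrite e EFinM.
apply: (@le_trans _ _ ((a `^ (2 - q))%:E * \sum_(0 <= s <oo) ((sigma (m + s)%N)^-1 `^ q)%:E)%E).
  rewrite -nneseriesZl; last by move=> s _; rewrite lee_fin powR_ge0.
  apply: lee_nneseries => [s _ _|s _]; first by rewrite lee_fin sqr_ge0.
  rewrite -EFinM lee_fin.
  have sp := inv_gt0 (m + s)%N.
  have -> : (sigma (m + s)%N)^-1 ^+ 2 =
      (sigma (m + s)%N)^-1 `^ (2 - q) * (sigma (m + s)%N)^-1 `^ q.
    rewrite -powRD; last by rewrite (gt_eqF sp) implybT.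
    by rewrite subrK powR_mulrn // ltW.
  rewrite ler_wpM2r ?powR_ge0 // ge0_ler_powR ?nnegrE ?(ltW sp) ?(ltW a0) //.
  apply: le_trans sigma_inv_decay_m; rewrite lef_pV2 ?posrE //.
  by apply: sigma_nd; exact: leq_addr.
apply: lee_wpmul2l; first by rewrite lee_fin powR_ge0.
apply: le_trans lq_sum.
rewrite [leRHS](@nneseries_split _ _ 0 m) //; last by move=> k _; rewrite lee_fin powR_ge0.
rewrite add0n -[X in (_ <= _ + X)%E]nneseries_addn; last by move=> k; rewrite lee_fin powR_ge0.
under eq_eseriesr do rewrite addnC.
by apply: leeDr; apply: sume_ge0 => k _; rewrite lee_fin powR_ge0.
Qed.

End Decay.

(** * The sampling rate *)

Section SamplingRate.
Context d (U : measurableType d) (R : realType) (mu : probability U R).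
Variables (phi : nat -> U -> R[i]) (U0 : set U).
Hypothesis basis : orthonormal_basis mu phi.
Hypothesis U0_full : mu.-negligible (~` U0).

(** H_sigma norm at most b, through finite sums. *)
Definition coef_bound (X : normedModType R[i]) (sigma : nat -> R) (w : U -> X) (b : R) : Prop :=
  forall k, \sum_(s < k) (sigma s * nrm (coef mu phi w s)) ^+ 2 <= b ^+ 2.

Lemma U0_nonempty : exists y, U0 y.
Proof.
apply: contrapT => h; have [N [mN N0 sN]] := U0_full.
have NT : N = setT by apply/seteqP; split=> // y _; apply: sN => /= Uy; apply: h; exists y.
have := probability_setT mu; rewrite -NT N0 => /eqP.
by rewrite eq_sym onee_eq0.
Qed.

Lemma divn16_le l : (16 <= l)%N -> (l <= 32 * (l %/ 16))%N.
Proof. by have := divn_eq l 16; have := ltn_pmod l (isT : (0 < 16)%N); lia. Qed.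

(** 67 is the constant of [wls_error]; the factor 32^(1/q) covers the loss in
    passing from l to l %/ 16, and the summand 1 makes the bound hold for
    l < 16. *)
Definition rate_const (q M : R) : R := (Num.sqrt 67 * M + 1) * 32 `^ q^-1.

Lemma coef_bound_L2norm (X : normedModType R[i]) (ip : X -> X -> R) (sigma : nat -> R)
    (w : U -> X) b : real_inner ip -> seq_complete X -> (forall s, 1 < sigma s) ->
  L2 mu w -> 0 <= b -> coef_bound sigma w b -> (L2norm mu w <= b%:E)%E.
Proof.
move=> ipP cX s1 Lw b0 hb; apply: (parseval_le basis ipP cX Lw b0) => n.
apply: le_trans (hb n); apply: ler_sum => s _.
rewrite exprMn ler_peMl ?sqr_ge0 // exprn_ege1 // ltW //.
Qed.

(** For l < 16 the zero operator suffices: the weights exceed 1, so the L_2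
    norm is at most the H_sigma norm, and l^(-1/q) is bounded below. *)
Theorem sampling_rate (q M : R) (sigma : nat -> R) (l : nat) :
  0 < q -> q < 2 -> (forall s, 1 < sigma s) ->
  (forall s t, (s <= t)%N -> sigma s <= sigma t) ->
  (lq_norm q (fun s => (sigma s)^-1)%R <= M%:E)%E -> (0 < l)%N ->
  exists (y : nat -> U) (h : nat -> U -> R[i]),
  [/\ forall i, (i < l)%N -> U0 (y i) /\ L2C mu (h i),
      weighted_least_squares phi l y h &
      forall (X : normedModType R[i]) (ip : X -> X -> R), real_inner ip -> seq_complete X ->
      forall (w : U -> X) (b : R), L2 mu w -> 0 <= b ->
      (forall i, (i < l)%N -> cvg (pt_series mu phi w (y i) n @[n --> \oo])) ->
      coef_bound sigma w b ->
      let S := samp_op mu phi l y h w in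
      L2 mu S /\
      (L2norm mu (fun u => w u - S u)%R <= (rate_const q M * l%:R `^ (- q^-1) * b)%:E)%E].
Proof.
move=> q0 q2 s1 snd hM l0.
have s0 s : 0 < sigma s by apply: lt_trans (s1 s).
have M0 := lq_bound_ge0 hM.
have qi : 0 < q^-1 by rewrite invr_gt0.
have lr : 0 < l%:R :> R by rewrite ltr0n.
have [l16|l16] := leqP 16 l.
- pose m := (l %/ 16)%N; have m0 : (0 < m)%N by rewrite divn_gt0.
  have e0 := decay_eta_gt0 q0 s0 snd hM m0.
  have emax := decay_eta_max q0 s0 snd hM m0.
  have esum := decay_eta_sum q0 q2 s0 snd hM m0.
  have [y [t hs]] := stable_sample_exists basis U0_full m0 e0 s0 snd emax esum.
  have lm : (16 * m <= l)%N by rewrite mulnC leq_divM.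
  exists (sample_pt m y), (wls_fun phi m y t l); split.
  + by move=> i _; split; [exact: sample_pt_good hs i | exact: wls_fun_L2].
  + exact: (wls_fun_wls m0 hs lm).
  + move=> X ip ipP cX w b Lw b0 hcv hb S.
    have [LS hS] := wls_error basis m0 e0 s0 snd emax hs lm ipP cX Lw b0 hcv hb.
    split=> //; apply: le_trans hS _; rewrite lee_fin ler_wpM2r //.
    have mr : 0 < m%:R :> R by rewrite ltr0n.
    have ml : l%:R <= 32 * m%:R :> R.
      by rewrite -natrM ler_nat; exact: divn16_le.
    rewrite /decay_eta sqrtrM // sqrtr_sqr ger0_norm ?mulr_ge0 ?powR_ge0 //.
    rewrite /rate_const mulrA -[leRHS]mulrA.
    have h32 : m%:R `^ (- q^-1) <= 32 `^ q^-1 * l%:R `^ (- q^-1).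
      rewrite !powRN ler_pdivlMr ?powR_gt0 // mulrC ler_pdivrMr ?powR_gt0 //.
      rewrite -powRM ?ler0n //; apply: ge0_ler_powR; rewrite ?nnegrE ?mulr_ge0 ?ler0n //.
      exact: ltW.
    apply: ler_pM => //; [exact: mulr_ge0 (sqrtr_ge0 _) M0|by rewrite lerDl].
- have [y0 Uy0] := U0_nonempty.
  exists (fun=> y0), (fun _ _ => 0); split.
  + by move=> i _; split=> //; exact: L2_0.
  + exists 1%N, (fun=> 0), 0; split.
    * by rewrite l0.
    * by move=> i; exact: lexx.
    * have -> : diag_mx (\row_(i < l) (Num.sqrt (0 : R))%:C) = 0 :> 'M[R[i]]_l.
        apply/matrixP => i j; rewrite !mxE sqrtr0; exact: mul0rn.
      split; rewrite ?mul0mx ?mulmx0 ?mul0mx // ?trmx0 ?map_mx0 //.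
    * move=> f u; rewrite big1 => [|i _]; last by rewrite mulr0.
      by rewrite big_ord1 mul0mx mxE mul0r.
  + move=> X ip ipP cX w b Lw b0 _ hb S.
    have S0 u : S u = 0 by rewrite /S /samp_op big1 // => i _; rewrite scale0r.
    have LS : L2 mu S.
      by have := L2_0 mu X; congr L2; apply/funext => u; exact: esym (S0 u).
    split=> //.
    have -> : (fun u => w u - S u) = w by apply/funext => u; rewrite S0 subr0.
    apply: le_trans (coef_bound_L2norm ipP cX s1 Lw b0 hb) _.
    rewrite lee_fin ler_peMl // /rate_const -mulrA.
    apply: mulr_ege1; first by rewrite lerDr mulr_ge0 // sqrtr_ge0.
    rewrite powRN ler_pdivlMr ?powR_gt0 // mul1r.
    apply: ge0_ler_powR; rewrite ?nnegrE ?ler0n //; first exact: ltW.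
    by rewrite ler_nat; apply: leq_trans (ltnW l16) _.
Qed.

End SamplingRate.

(** * The unit ball and its level differences *)

Section ExtendedReals.
Context {R : realType}.
Local Open Scope ereal_scope.

Lemma sqrte_le (x : \bar R) (b : R) : 0 <= x -> (0 <= b)%R ->
  (x `^ 2^-1 <= b%:E) <-> (x <= (b ^+ 2)%:E).
Proof.
move=> x0 b0; split.
  move=> h; have := gt0_ler_poweR (ler0n R 2) _ _ h.
  rewrite -poweRrM mulVf ?pnatr_eq0 // poweRe1 // poweR_EFin powR_mulrn //.
  by rewrite !in_itv /= !leey !andbT poweR_ge0 lee_fin b0 => /(_ isT isT).
move=> h; have i0 : (0 <= 2^-1 :> R)%R by rewrite invr_ge0.
have := gt0_ler_poweR i0 _ _ h.
rewrite poweR_EFin powR12_sqrt ?sqr_ge0 // sqrtr_sqr ger0_norm //.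
by rewrite !in_itv /= !leey !andbT x0 lee_fin sqr_ge0 => /(_ isT isT).
Qed.

Lemma sqre_le (x : \bar R) (b : R) : 0 <= x -> (0 <= b)%R ->
  (x ^+ 2 <= (b ^+ 2)%:E) <-> (x <= b%:E).
Proof.
case: x => [r| |]; last by rewrite leeNy_eq.
- by move=> r0 b0; rewrite -EFin_expe !lee_fin ler_sqr.
- by move=> _ _; rewrite expe2 /= mulyy !leNgt !ltry.
Qed.

Lemma eseries_le (u : nat -> R) (b : R) : (forall s, (0 <= u s)%R) ->
  (forall k, (\sum_(s < k) u s <= b)%R) -> \sum_(0 <= s <oo) (u s)%:E <= b%:E.
Proof.
move=> u0 hb; apply: lime_le; first by apply: is_cvg_nneseries => s _ _; rewrite lee_fin.
by apply: nearW => n; rewrite /= sumEFin lee_fin big_mkord.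
Qed.

End ExtendedReals.

Section WeightedNorms.
Context d (U : measurableType d) (R : realType) (mu : probability U R).
Variable (phi : nat -> U -> R[i]).
Hypothesis basis : orthonormal_basis mu phi.
Variables (X : normedModType R[i]) (ip : X -> X -> R).
Hypotheses (ipP : real_inner ip) (cX : seq_complete X).

Lemma HnormP (sigma : nat -> R) (w : U -> X) b : 0 <= b ->
  (Hnorm mu phi sigma w <= b%:E)%E <-> coef_bound mu phi sigma w b.
Proof.
move=> b0; have S0 : (0 <= \sum_(0 <= s <oo) ((sigma s * nrm (coef mu phi w s)) ^+ 2)%:E)%E.
  by apply: nneseries_ge0 => s _ _; rewrite lee_fin sqr_ge0.
split.
  move=> /(sqrte_le S0 b0) h k.
  exact: (nneseries_partial (fun s => sqr_ge0 _) h k).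
move=> h; apply/(sqrte_le S0 b0); apply: eseries_le => // s; exact: sqr_ge0.
Qed.

Lemma Hnorm_ge0 (sigma : nat -> R) (w : U -> X) : (0 <= Hnorm mu phi sigma w)%E.
Proof. exact: poweR_ge0. Qed.

Lemma coef_bound_sub (sigma : nat -> R) (v w : U -> X) b :
  L2 mu v -> L2 mu w -> (forall s, 0 <= sigma s) ->
  coef_bound mu phi sigma v b -> coef_bound mu phi sigma w b ->
  coef_bound mu phi sigma (fun u => v u - w u) (2 * b).
Proof.
move=> Lv Lw s0 hv hw k.
have bl : bounded_linear (fun x : X => - x).
  split; [exact: opprD|by move=> a x; rewrite scalerN|].
  by exists 1 => // x; rewrite nrmN mul1r.
have LN : L2 mu (fun u => - w u) by exact: L2_bounded_linear bl Lw.
have cN s : coef mu phi (fun u => - w u) s = - coef mu phi w s.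
  by have := coef_bounded_linear basis ipP cX s bl Lw.
apply: (@le_trans _ _ (2 * \sum_(s < k) (sigma s * nrm (coef mu phi v s)) ^+ 2 +
    2 * \sum_(s < k) (sigma s * nrm (coef mu phi w s)) ^+ 2)).
  rewrite !mulr_sumr -big_split; apply: ler_sum => s _.
  rewrite (coef_L2D basis ipP cX s Lv LN) cN !exprMn /=.
  rewrite [leRHS](_ : _ = sigma s ^+ 2 * (2 * nrm (coef mu phi v s) ^+ 2 +
    2 * nrm (- coef mu phi w s) ^+ 2)); last by rewrite nrmN; ring.
  by rewrite ler_wpM2l ?sqr_ge0 // sqr_nrmD.
by have := hv k; have := hw k; rewrite exprMn; lra.
Qed.

Lemma coef_bound_mono (sigma : nat -> R) (w : U -> X) a b :
  0 <= a -> a <= b -> coef_bound mu phi sigma w a -> coef_bound mu phi sigma w b.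
Proof.
move=> a0 ab h k; apply: le_trans (h k) _.
by rewrite ler_sqr ?nnegrE // (le_trans a0).
Qed.

Variables (sigma1 sigma2 : nat -> R) (P : nat -> {linear X -> X}) (alpha eps K : R).
Hypotheses (sigma1_ge0 : forall s, 0 <= sigma1 s) (sigma2_ge0 : forall s, 0 <= sigma2 s).
Hypotheses (alpha_gt0 : 0 < alpha) (eps_gt0 : 0 < eps).
Hypothesis P_bounded : exists B : R, forall k, (1 <= k)%N -> forall x, nrm (P k x) <= B * nrm x.
Hypothesis P_Hat : forall (v : U -> X) m, (1 <= m)%N ->
    Hatspace mu phi sigma1 sigma2 P alpha (1 + eps) v ->
    (Hatnorm mu phi sigma1 sigma2 P alpha (1 + eps) (P m \o v)
      <= K%:E * Hatnorm mu phi sigma1 sigma2 P alpha (1 + eps) v)%E.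

Lemma P_bounded_linear k : (1 <= k)%N -> bounded_linear (P k).
Proof.
move=> k1; have [B hB] := P_bounded; split; [exact: linearD|by move=> a x; rewrite linearZ|].
exists `|B|; first exact: normr_ge0.
by move=> x; apply: le_trans (hB k k1 x) _; rewrite ler_wpM2r ?nrm_ge0 // ler_norm.
Qed.

Lemma P_L2 k (v : U -> X) : (1 <= k)%N -> L2 mu v -> L2 mu (P k \o v).
Proof. by move=> k1; apply: L2_bounded_linear; exact: P_bounded_linear. Qed.

Lemma sum_inv_sqr n : \sum_(s < n) (s.+1%:R ^- 2) <= (2 : R).
Proof.
case: n => [|n]; first by rewrite big_ord0 ler0n.
suff h : \sum_(s < n.+1) (s.+1%:R ^- 2) <= (2 : R) - n.+1%:R^-1.
  by apply: le_trans h _; rewrite gerBl invr_ge0 ler0n.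
elim: n => [|n IH]; first by rewrite big_ord1 expr1n invr1; lra.
rewrite big_ord_recr /=; apply: le_trans (lerD IH (lexx _)) _.
have n0 : 0 < n.+1%:R :> R by rewrite ltr0n.
rewrite -subr_ge0 -(natr1 n.+1); set a : R := n.+1%:R in n0 *.
have a1 : 0 < a + 1 by rewrite ltr_wpDr.
have -> : 2 - (a + 1)^-1 - (2 - a^-1 + (a + 1) ^- 2) = (a * (a + 1) ^+ 2)^-1.
  by field; rewrite !gt_eqF.
by rewrite invr_ge0 mulr_ge0 ?sqr_ge0 // ltW.
Qed.

Section Ball.
Variable v : U -> X.
Hypothesis v_ball : Haball mu phi sigma1 sigma2 P alpha v.

Lemma ball_L2 : L2 mu v. Proof. by case: v_ball. Qed.

Lemma ball_bounds : (Hnorm mu phi sigma1 v <= 1)%E /\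
  forall k, (1 <= k)%N ->
   (Hnorm mu phi sigma2 (v \- (P k \o v))%R <= (2 `^ (- (alpha * k%:R)))%:E)%E.
Proof.
have [_] := v_ball; rewrite /Hanorm; set H := Hnorm mu phi sigma1 v.
set S := ereal_sup _ => h.
have H0 : (0 <= H)%E by exact: Hnorm_ge0.
have S0 : (0 <= S)%E.
  apply: le_trans (ereal_sup_ubound _); last by exists 1%N.
  by apply: mule_ge0; [rewrite lee_fin powR_ge0|exact: Hnorm_ge0].
have sH0 : (0 <= H ^+ 2)%E by exact: expe_ge0.
have sS0 : (0 <= S ^+ 2)%E by exact: expe_ge0.
move: h => /(sqrte_le (adde_ge0 sH0 sS0) ler01) h.
have h1 : (H <= 1)%E.
  apply/(sqre_le H0 ler01); apply: le_trans h; exact: leeDl.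
have h2 : (S <= 1)%E.
  apply/(sqre_le S0 ler01); apply: le_trans h; exact: leeDr.
split=> // k k1.
have p0 : 0 < 2 `^ (alpha * k%:R) :> R by rewrite powR_gt0.
have : ((2 `^ (alpha * k%:R))%:E * Hnorm mu phi sigma2 (v \- (P k \o v))%R <= 1)%E.
  by apply: le_trans h2; apply: ereal_sup_ubound; exists k.
by rewrite muleC -lee_pdivlMr // mul1e powRN.
Qed.

Lemma ball_coef1 : coef_bound mu phi sigma1 v 1.
Proof. by apply/HnormP => //; exact: ball_bounds.1. Qed.

Lemma ball_coef2 k : (1 <= k)%N ->
  coef_bound mu phi sigma2 (fun u => v u - P k (v u)) (2 `^ (- (alpha * k%:R))).
Proof. by move=> k1; apply/HnormP; [exact: powR_ge0|exact: ball_bounds.2]. Qed.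

(** k^(-2(1+eps)) <= k^(-2), and the sum of the latter is at most 2; together
    with the H_(sigma_1) part this gives 1 + 2 <= 4. *)
Lemma ball_Hat : (Hatnorm mu phi sigma1 sigma2 P alpha (1 + eps) v <= 2%:E)%E.
Proof.
have [h1 h2] := ball_bounds; rewrite /Hatnorm.
set H := Hnorm mu phi sigma1 v in h1 *.
have T0 k : (0 <= ((2 `^ (alpha * k%:R) * k%:R `^ (- (1 + eps)))%:E *
                       Hnorm mu phi sigma2 (v \- (P k \o v))%R) ^+ 2)%E.
  apply: expe_ge0; apply: mule_ge0; last exact: Hnorm_ge0.
  by rewrite lee_fin mulr_ge0 ?powR_ge0.
apply/sqrte_le; [|exact: ler0n|].
  apply: adde_ge0; first by apply: expe_ge0; exact: Hnorm_ge0.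
  by apply: nneseries_ge0 => k _ _; exact: T0.
rewrite (_ : (2 ^+ 2 : R) = 1 ^+ 2 + 3); last by ring.
rewrite EFinD; apply: leeD.
  by apply/(sqre_le (Hnorm_ge0 _ _) ler01).
rewrite -nneseries_addn //.
apply: (@le_trans _ _ (\sum_(0 <= k <oo) (k.+1%:R ^- 2)%:E)%E); last first.
  apply: eseries_le => [s|k]; first by rewrite invr_ge0 exprn_ge0.
  by apply: le_trans (sum_inv_sqr k) _; rewrite ler_nat.
apply: lee_nneseries => [k _ _|k _]; first exact: T0.
rewrite addn1; have k0 : 0 < k.+1%:R :> R by rewrite ltr0n.
have i0 : 0 <= k.+1%:R^-1 :> R by rewrite invr_ge0 ltW.
rewrite -exprVn; apply/sqre_le => //.
  by apply: mule_ge0; [rewrite lee_fin mulr_ge0 ?powR_ge0|exact: Hnorm_ge0].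
apply: (@le_trans _ _ ((2 `^ (alpha * k.+1%:R) * k.+1%:R `^ (- (1 + eps)))%:E *
   (2 `^ (- (alpha * k.+1%:R)))%:E)%E).
  by apply: lee_wpmul2l; [rewrite lee_fin mulr_ge0 ?powR_ge0|exact: h2].
rewrite -EFinM lee_fin mulrAC -powRD; last by rewrite pnatr_eq0 implybT.
rewrite subrr powRr0 mul1r powRN lef_pV2 ?posrE ?powR_gt0 //.
by apply: le1r_powR; [rewrite ler1n|rewrite lerDl ltW].
Qed.

Lemma Hat_coef_bound (w : U -> X) b : 0 <= b ->
  (Hatnorm mu phi sigma1 sigma2 P alpha (1 + eps) w <= b%:E)%E ->
  coef_bound mu phi sigma1 w b.
Proof.
move=> b0; rewrite /Hatnorm; set T := (\sum_(1 <= k <oo) _)%E => h.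
have T0 : (0 <= T)%E.
  apply: nneseries_ge0 => k _ _; apply: expe_ge0; apply: mule_ge0; last exact: Hnorm_ge0.
  by rewrite lee_fin mulr_ge0 ?powR_ge0.
have H0 : (0 <= Hnorm mu phi sigma1 w ^+ 2)%E by apply: expe_ge0; exact: Hnorm_ge0.
move: h => /(sqrte_le (adde_ge0 H0 T0) b0) h.
apply/(HnormP _ _ b0); apply/(sqre_le (Hnorm_ge0 _ _) b0).
by apply: le_trans h; exact: leeDl.
Qed.

(** The assumption on P_k is applied to v, of norm at most 2 by [ball_Hat]. *)
Lemma ball_proj_coef1 k : (1 <= k)%N ->
  coef_bound mu phi sigma1 (P k \o v) (2 * `|K|).
Proof.
move=> k1; have hv := ball_Hat.
apply: Hat_coef_bound; first by rewrite mulr_ge0.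
have hs : Hatspace mu phi sigma1 sigma2 P alpha (1 + eps) v.
  by split; [exact: ball_L2|apply: le_lt_trans hv _; rewrite ltry].
apply: le_trans (P_Hat k1 hs) _.
have n0 : (0 <= Hatnorm mu phi sigma1 sigma2 P alpha (1 + eps) v)%E by exact: poweR_ge0.
apply: (@le_trans _ _ (`|K|%:E * Hatnorm mu phi sigma1 sigma2 P alpha (1 + eps) v)%E).
  by apply: lee_wpmul2r => //; rewrite lee_fin ler_norm.
by rewrite mulrC EFinM; apply: lee_wpmul2l => //; rewrite lee_fin.
Qed.

Definition level_diff k := delta_op (fun k => P k : X -> X) k \o v.

Lemma level_diffE k : (2 <= k)%N -> level_diff k = (fun u => P k (v u) - P k.-1 (v u)).
Proof. by move=> k2; apply/funext => u; rewrite /level_diff /= /delta_op gtn_eqF. Qed.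

Lemma level_diff1 : level_diff 1 = P 1%N \o v.
Proof. by []. Qed.

Lemma level_diff_L2 k : (1 <= k)%N -> L2 mu (level_diff k).
Proof.
case: k => [//|[|k]] _; first by rewrite level_diff1; apply: P_L2 => //; exact: ball_L2.
by rewrite level_diffE //; apply: L2B; apply: P_L2 => //; exact: ball_L2.
Qed.

Lemma level_diff_coef1 k : (1 <= k)%N -> coef_bound mu phi sigma1 (level_diff k) (4 * `|K|).
Proof.
have K0 := normr_ge0 K.
case: k => [//|[|k]] _.
  rewrite level_diff1; apply: (coef_bound_mono _ _ (ball_proj_coef1 (leqnn 1))); first by rewrite mulr_ge0.
  by rewrite ler_wpM2r // ler_nat.
rewrite level_diffE //; rewrite (_ : 4 * `|K| = 2 * (2 * `|K|)); last by ring.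
by apply: coef_bound_sub => //; [apply: P_L2 => //; exact: ball_L2|
  apply: P_L2 => //; exact: ball_L2|exact: ball_proj_coef1|exact: ball_proj_coef1].
Qed.

(** delta_k v = (v - P_(k-1) v) - (v - P_k v), both parts decaying with k. *)
Lemma level_diff_coef2 k : (2 <= k)%N ->
  coef_bound mu phi sigma2 (level_diff k) (2 * 2 `^ alpha * 2 `^ (- (alpha * k%:R))).
Proof.
move=> k2; have k1 : (1 <= k)%N by apply: ltnW.
have k1' : (1 <= k.-1)%N by rewrite -ltnS prednK // ltnW.
have e : level_diff k = (fun u => (v u - P k.-1 (v u)) - (v u - P k (v u))).
  rewrite level_diffE //; apply/funext => u.
  by rewrite opprB [RHS]addrC addrA subrK.
rewrite e -mulrA; apply: coef_bound_sub => //.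
- by apply: L2B; [exact: ball_L2|apply: P_L2 => //; exact: ball_L2].
- by apply: L2B; [exact: ball_L2|apply: P_L2 => //; exact: ball_L2].
- apply: coef_bound_mono (ball_coef2 k1'); first exact: powR_ge0.
  rewrite -powRD; last by rewrite pnatr_eq0 implybT.
  apply: eq_le_of; congr (_ `^ _).
  by rewrite -[in RHS](prednK k1) -natr1; ring.
- apply: coef_bound_mono (ball_coef2 k1); first exact: powR_ge0.
  rewrite ler_peMl ?powR_ge0 //.
  by rewrite -[leLHS](powRr0 2) ler_powR ?ler1n // ltW.
Qed.

End Ball.

End WeightedNorms.

(** * Logarithms and the sampling budget *)

Section Logarithm.
Context {R : realType}.
Implicit Types x y : R.

Let ln2 : 0 < ln 2 :> R. Proof. by rewrite ln_gt0 // ltr1n. Qed.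

Lemma powR_log2 x : 0 < x -> 2 `^ (log2 x) = x.
Proof.
move=> x0; apply: ln_inj; rewrite ?posrE ?powR_gt0 //.
by rewrite ln_powR /log2 divfK // gt_eqF.
Qed.

Lemma log2_powR x : log2 (2 `^ x) = x.
Proof. by rewrite /log2 ln_powR mulfK // gt_eqF. Qed.

Lemma le_log2 x y : 0 < x -> x <= y -> log2 x <= log2 y.
Proof.
move=> x0 xy; rewrite /log2 ler_pM2r ?invr_gt0 // ler_ln ?posrE //.
exact: lt_le_trans xy.
Qed.

Lemma log2_ge1 x : 2 <= x -> 1 <= log2 x.
Proof.
move=> x2; rewrite -[leLHS]log2_powR le_log2 ?powR_gt0 // powRr1 //.
Qed.

Lemma truncn_log2_le x k : 0 < x -> (1 <= k <= Num.truncn (log2 x))%N -> 2 `^ k%:R <= x.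
Proof.
move=> x0 /andP[k1 kx]; have l0 : 0 <= log2 x.
  rewrite leNgt; apply/negP => l0; move: (leq_trans k1 kx).
  by rewrite truncn_gt0 leNgt (lt_trans l0).
rewrite -[leRHS](powR_log2 x0) ler_powR ?ler1n //.
by apply: (@le_trans _ _ (Num.truncn (log2 x))%:R); rewrite ?ler_nat // truncn_le.
Qed.

Lemma truncn_log2_gt x : 0 < x -> x < 2 `^ (Num.truncn (log2 x)).+1%:R.
Proof.
move=> x0; rewrite ltNge; apply/negP => h.
have p0 k : 0 < 2 `^ k%:R :> R by rewrite powR_gt0.
by have := le_log2 (p0 _) h; rewrite log2_powR leNgt truncnS_gt.
Qed.

End Logarithm.

Section Budget.
Context {R : realType}.
Variables (n : nat).
Hypothesis n2 : (2 <= n)%N.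
Let Lg : R := log2 n%:R.
Let N := `|Num.ceil (n%:R / log2 n%:R : R)|%N.

Let nr2 : 2 <= n%:R :> R. Proof. by rewrite ler_nat. Qed.
Let n0 : 0 < n%:R :> R. Proof. by rewrite ltr0n; case: n n2. Qed.

Lemma Lg_ge1 : 1 <= Lg. Proof. exact: log2_ge1. Qed.
Let Lg0 : 0 < Lg. Proof. exact: lt_le_trans Lg_ge1. Qed.

Let x0 : 0 < n%:R / Lg. Proof. exact: divr_gt0. Qed.

Let NE : N%:R = (Num.ceil (n%:R / Lg))%:~R :> R.
Proof.
rewrite /N natr_absz ger0_norm //; apply: ltW; rewrite ceil_gt0 //.
Qed.

Lemma N_ge : n%:R / Lg <= N%:R.
Proof. by rewrite NE; exact: ceil_ge. Qed.

Lemma N_lt : N%:R < n%:R / Lg + 1.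
Proof.
rewrite NE -ltrBlDr; have := ceilB1_lt (n%:R / Lg).
by rewrite rmorphB.
Qed.

Lemma N_le : (N <= n)%N.
Proof.
rewrite -(ler_nat R) NE -[leRHS]/((n%:Z)%:~R : R) ler_int ceil_le_int.
by rewrite ler_pdivrMr // ler_peMr ?(ltW n0) // Lg_ge1.
Qed.

Lemma N_gt0 : (0 < N)%N.
Proof. by rewrite -(ltr0n R); apply: lt_le_trans N_ge. Qed.

Lemma N_powR_le th : 0 <= th -> N%:R `^ (- th) <= n%:R `^ (- th) * Lg `^ th.
Proof.
move=> th0; have NR : 0 < N%:R :> R by rewrite ltr0n N_gt0.
rewrite !powRN ler_pdivlMl ?powR_gt0 // ler_pdivrMr ?powR_gt0 //.
rewrite -powRM ?(ltW Lg0) ?ler0n //; apply: ge0_ler_powR => //.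
- by rewrite nnegrE ltW.
- by rewrite nnegrE ltW // mulr_gt0.
- by have := N_ge; rewrite ler_pdivrMr // mulrC.
Qed.

Variable kN : nat.
Hypothesis kN_le : (1 <= kN)%N -> 2 `^ kN%:R <= N%:R :> R.

Lemma pow2_le k : (1 <= k <= kN)%N -> (2 ^ k <= N)%N.
Proof.
move=> /andP[k1 kk]; rewrite -(ler_nat R) natrX -powR_mulrn ?ler0n //.
apply: le_trans (kN_le (leq_trans k1 kk)); rewrite ler_powR ?ler1n //.
by rewrite ler_nat.
Qed.

Lemma Nk_gt0 k : (1 <= k <= kN)%N -> (0 < N %/ 2 ^ k)%N.
Proof. by move=> h; rewrite divn_gt0 ?expn_gt0 // pow2_le. Qed.

Lemma Nk_ge k : (1 <= k <= kN)%N ->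
  N%:R * 2 `^ (- k%:R) <= 2 * (N %/ 2 ^ k)%:R :> R.
Proof.
move=> h; have p0 : 0 < 2 `^ k%:R :> R by rewrite powR_gt0.
rewrite powRN ler_pdivrMr // powR_mulrn ?ler0n // -natrX -!natrM ler_nat.
have := divn_eq N (2 ^ k); have := ltn_pmod N (expn_gt0 2 k : (0 < 2 ^ k)%N).
have := Nk_gt0 h; nia.
Qed.

Lemma kN_Lg : kN%:R <= Lg.
Proof.
case: (posnP kN) => [->|k1]; first exact: ltW.
rewrite -[leLHS]log2_powR; apply: le_log2; first by rewrite powR_gt0.
by apply: le_trans (kN_le k1) _; rewrite ler_nat N_le.
Qed.

(** A level costs at most (3/4) N, and there are at most log n of them, in
    total (3/4) (n + log n) <= n as soon as 3 log n <= n.  Otherwise N <= 3, and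
    there is at most one level. *)
Lemma cost_le : comp_cost R kN (fun k => (N %/ 2 ^ k)%N) <= n%:R.
Proof.
have term k : (1 <= k <= kN)%N ->
    (2 ^ (k%:Z - 1) + 2 ^ (k%:Z - 2)) * (N %/ 2 ^ k)%:R <= 3 / 4 * N%:R :> R.
  move=> hk; have -> : 2 ^ (k%:Z - 1) + 2 ^ (k%:Z - 2) = 3 / 4 * (2 ^ k)%:R :> R.
    have e1 : (2 : R) ^ (-1 : int) = 2^-1 by [].
    have e2 : (2 : R) ^ (-2 : int) = (2 ^+ 2)^-1 by [].
    by rewrite !expfzDr ?pnatr_eq0 // e1 e2 -exprnP natrX; field.
  rewrite -mulrA -natrM ler_wpM2l //.
  by rewrite ler_nat mulnC leq_divM.
have le1 : comp_cost R kN (fun k => (N %/ 2 ^ k)%N) <= kN%:R * (3 / 4 * N%:R).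
  have -> : kN%:R * (3 / 4 * N%:R) = \sum_(1 <= k < kN.+1) (3 / 4 * N%:R) :> R.
    by rewrite sumr_const_nat subn1 mulr_natl.
  by apply: ler_sum_nat => k hk; apply: term.
apply: le_trans le1 _.
(* The sign of 2^n - n^3 decides whether 3 log n <= n. *)
have [small|big] := leqP (2 ^ n) (n ^ 3).
  have nL : n%:R <= 3 * Lg.
    rewrite -[leLHS]log2_powR mulr_natl /Lg.
    have -> : log2 n%:R *+ 3 = log2 ((n ^ 3)%:R) :> R.
      by rewrite natrX /log2 lnXn // mulrnAl.
    apply: le_log2; first by rewrite powR_gt0.
    by rewrite powR_mulrn ?ler0n // -natrX ler_nat.
  have N3 : (N <= 3)%N.
    rewrite -ltnS -(ltr_nat R); apply: lt_le_trans N_lt _.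
    rewrite (_ : 4%:R = 3 + 1 :> R); last by ring.
    by rewrite lerD2r ler_pdivrMr.
  have k1 : (kN <= 1)%N.
    case: leqP => // k2; have := @pow2_le 2 k2; lia.
  have h1 : kN%:R <= 1 :> R by rewrite (ler_nat R kN 1).
  have h2 : N%:R <= 3 :> R by rewrite (ler_nat R N 3).
  have h0 : kN%:R * (3 / 4 * N%:R) <= 1 * (3 / 4 * N%:R) :> R.
    by apply: ler_wpM2r => //; rewrite mulr_ge0.
  apply: le_trans h0 _; have hn := nr2.
  have [N2|N3'] := leqP N 2.
    have h3 : N%:R <= 2 :> R by rewrite (ler_nat R N 2).
    by lra.
  have n3 : 3 <= n%:R :> R by rewrite (ler_nat R 3 n); apply: leq_trans N3' N_le.
  by lra.
have nL : 3 * Lg <= n%:R.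
  rewrite -[leRHS]log2_powR mulr_natl /Lg.
  have -> : log2 n%:R *+ 3 = log2 ((n ^ 3)%:R) :> R.
    by rewrite natrX /log2 lnXn // mulrnAl.
  apply: le_log2; first by rewrite ltr0n expn_gt0 (ltnW n2).
  by rewrite powR_mulrn ?ler0n // -natrX ler_nat ltnW.
have h1 : kN%:R * (3 / 4 * N%:R) <= Lg * (3 / 4 * (n%:R / Lg + 1)).
  apply: ler_pM => //; first exact: kN_Lg.
  by apply: ler_wpM2l; [rewrite divr_ge0|exact: ltW N_lt].
apply: le_trans h1 _.
have -> : Lg * (3 / 4 * (n%:R / Lg + 1)) = 3 / 4 * (n%:R + Lg).
  by field; rewrite gt_eqF.
by move: nL; lra.
Qed.

End Budget.

(** * Summation over the levels *)

Section LevelSum.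
Context {R : realType}.

Lemma powR_anti (a b t : R) : 0 < a -> a <= b -> 0 <= t -> b `^ (- t) <= a `^ (- t).
Proof.
move=> a0 ab t0; have b0 : 0 < b by exact: lt_le_trans ab.
rewrite !powRN lef_pV2 ?posrE ?powR_gt0 //.
by apply: ge0_ler_powR; rewrite ?nnegrE //; exact: ltW.
Qed.

Lemma powRDp (x r s : R) : 0 < x -> x `^ r * x `^ s = x `^ (r + s).
Proof. by move=> x0; rewrite -powRD // (gt_eqF x0) implybT. Qed.

Lemma geometric_sum (rho : R) n : 1 < rho ->
  \sum_(1 <= k < n.+1) rho ^+ k <= rho ^+ n * (rho / (rho - 1)).
Proof.
move=> r1; have d0 : 0 < rho - 1 by rewrite subr_gt0.
have r0 : 0 < rho by apply: lt_trans r1.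
elim: n => [|n IH].
  by rewrite big_geq // expr0 mul1r divr_ge0 // ltW.
rewrite big_nat_recr //=; apply: le_trans (lerD IH (lexx _)) _.
apply: eq_le_of; rewrite exprS; field.
by rewrite gt_eqF.
Qed.

Variables (q1 q2 alpha : R).
Hypotheses (q1_gt0 : 0 < q1) (q1_le_q2 : q1 <= q2) (alpha_gt0 : 0 < alpha).
Let delta := q1^-1 - q2^-1.
Let beta := q1^-1 * (alpha / (alpha + delta)).
Let p := q1 * (alpha + delta).

Let q2_gt0 : 0 < q2. Proof. exact: lt_le_trans q1_le_q2. Qed.
Let i1 : 0 < q1^-1. Proof. by rewrite invr_gt0. Qed.
Let i2 : 0 < q2^-1. Proof. by rewrite invr_gt0. Qed.
Let delta_ge0 : 0 <= delta.
Proof. by rewrite subr_ge0 lef_pV2 ?posrE. Qed.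
Let ad_gt0 : 0 < alpha + delta. Proof. by rewrite ltr_wpDr. Qed.
Let beta_gt0 : 0 < beta. Proof. by rewrite mulr_gt0 // divr_gt0. Qed.
Let p_gt0 : 0 < p. Proof. by rewrite mulr_gt0. Qed.
Let pbeta : p * beta = alpha.
Proof. by rewrite /p /beta; field; rewrite !gt_eqF. Qed.
Let beta_le : beta <= q1^-1.
Proof. by rewrite /beta ler_piMr ?(ltW i1) // ler_pdivrMr // mul1r lerDl. Qed.
Let ii : q2^-1 <= q1^-1. Proof. by rewrite lef_pV2 ?posrE. Qed.

(** Whether level k is sampled with the weights sigma_1; the switch is where the
    two bounds of [level_term] meet. *)
Definition use_first (N k : nat) : bool :=
  (k == 1%N) || ((q2^-1 < alpha) && (2 `^ (k%:R * (alpha + delta)) <= N%:R `^ delta)).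

Definition level_term (N k : nat) : R :=
  if use_first N k then 2 `^ (k%:R * q1^-1) * N%:R `^ (- q1^-1)
  else 2 `^ (- (alpha * k%:R)) * 2 `^ (k%:R * q2^-1) * N%:R `^ (- q2^-1).

Variable N : nat.
Hypothesis N_gt0 : (0 < N)%N.
Let NR1 : 1 <= N%:R :> R. Proof. by rewrite ler1n. Qed.
Let NR : 0 < N%:R :> R. Proof. by rewrite ltr0n. Qed.
Let two0 : 0 < 2 :> R. Proof. by []. Qed.
Let c1_ge1 : 1 <= 2 `^ q1^-1 :> R.
Proof. by rewrite -[leLHS](powRr0 2) ler_powR ?ler1n // ltW. Qed.

Lemma level_term_small k : alpha <= q2^-1 -> (1 <= k)%N ->
  level_term N k <= 2 `^ q1^-1 * ((2 `^ (q2^-1 - alpha)) ^+ k * N%:R `^ (- q2^-1)).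
Proof.
move=> al k1; have g0 : 0 <= q2^-1 - alpha by rewrite subr_ge0.
rewrite /level_term /use_first ltNge al /= orbF; case: eqP => [->|_].
  rewrite mul1r ler_wpM2l ?powR_ge0 // expr1.
  apply: (@le_trans _ _ (1 * N%:R `^ (- q2^-1))).
    by rewrite mul1r ler_powR // lerN2.
  by rewrite ler_wpM2r ?powR_ge0 // -[leLHS](powRr0 2) ler_powR ?ler1n.
rewrite powRDp // -powR_mulrn ?powR_ge0 // -powRrM.
rewrite [X in 2 `^ X](_ : _ = (q2^-1 - alpha) * k%:R); last by ring.
by rewrite ler_peMl // mulr_ge0 ?powR_ge0.
Qed.

(** Both bounds are at most N^(-beta) on their side of the switch.  Level 1
    always uses the first one, at the price of the factor 2^(1/q1). *)
Lemma level_term_large k : q2^-1 < alpha -> (1 <= k)%N ->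
  level_term N k <= 2 `^ q1^-1 * N%:R `^ (- beta).
Proof.
move=> al k1; rewrite /level_term /use_first al /=.
have kr0 : 0 < k%:R :> R by rewrite ltr0n.
have main : 2 `^ (k%:R * (alpha + delta)) <= N%:R `^ delta ->
    2 `^ (k%:R * q1^-1) * N%:R `^ (- q1^-1) <= N%:R `^ (- beta).
  move=> h.
  have e : 2 `^ (k%:R * q1^-1) = (2 `^ (k%:R * (alpha + delta))) `^ (q1^-1 / (alpha + delta)) :> R.
    by rewrite -powRrM; congr (_ `^ _); field; rewrite !gt_eqF.
  have h2 : 2 `^ (k%:R * q1^-1) <= N%:R `^ (delta * (q1^-1 / (alpha + delta))).
    rewrite e [leRHS]powRrM; apply: ge0_ler_powR; rewrite ?nnegrE ?powR_ge0 //.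
    by rewrite divr_ge0 // ltW.
  apply: le_trans (ler_wpM2r (powR_ge0 _ _) h2) _.
  rewrite powRDp //; apply: eq_le_of; congr (_ `^ _).
  by rewrite /beta; field; rewrite !gt_eqF.
have [k11|kn1] := eqVneq k 1%N.
  rewrite /= k11 mul1r ler_wpM2l ?powR_ge0 //.
  by rewrite ler_powR // lerN2.
case: ifPn => /= h.
  by apply: le_trans (main h) _; rewrite ler_peMl ?powR_ge0.
rewrite -ltNge in h.
have a0 : 0 < alpha - q2^-1 by rewrite subr_gt0.
have e : 2 `^ (- (alpha * k%:R)) * 2 `^ (k%:R * q2^-1) =
    (2 `^ (k%:R * (alpha + delta))) `^ (- ((alpha - q2^-1) / (alpha + delta))) :> R.
  by rewrite powRDp // -powRrM; congr (_ `^ _); field; rewrite !gt_eqF.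
have h2 : 2 `^ (- (alpha * k%:R)) * 2 `^ (k%:R * q2^-1) <=
    N%:R `^ (delta * - ((alpha - q2^-1) / (alpha + delta))).
  rewrite e [leRHS]powRrM; apply: powR_anti; [by rewrite powR_gt0|exact: ltW|].
  by rewrite divr_ge0 // ltW.
apply: le_trans (ler_wpM2r (powR_ge0 _ _) h2) _.
rewrite powRDp // (_ : delta * _ + _ = - beta).
  by rewrite ler_peMl ?powR_ge0.
have e2 : q2^-1 = q1^-1 - delta by rewrite /delta opprB addrC subrK.
by rewrite e2 /beta; field; rewrite !gt_eqF.
Qed.

Variable xi : R.
Hypothesis xi_gt0 : 0 < xi.
Hypothesis xi_small : alpha <= q2^-1 -> xi <= N%:R < 2 * xi.
Hypothesis xi_large : q2^-1 < alpha -> xi `^ p <= N%:R < 2 * xi `^ p.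
Let kN := Num.truncn (log2 xi).

Lemma p_ge1 : q2^-1 < alpha -> 1 <= p.
Proof.
move=> al; rewrite /p mulrC -ler_pdivrMr // mul1r /delta.
by have := ltW al; lra.
Qed.

Lemma xi_le_N : xi <= N%:R.
Proof.
have [al|al] := leP alpha q2^-1; first by case/andP: (xi_small al).
have [x1|x1] := leP 1 xi; last exact: le_trans (ltW x1) NR1.
case/andP: (xi_large al) => h _; apply: le_trans h.
exact: le1r_powR (p_ge1 al).
Qed.

Lemma kN_le : (1 <= kN)%N -> 2 `^ kN%:R <= N%:R :> R.
Proof.
move=> k1; apply: le_trans xi_le_N; apply: truncn_log2_le => //.
by rewrite k1 leqnn.
Qed.

(** The last level is within 1 of log xi, so the truncation error
    2^(-alpha kN) is of order xi^(-alpha). *)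
Lemma top_level : 2 `^ (- (alpha * kN%:R)) <= 2 `^ alpha * xi `^ (- alpha).
Proof.
have h := powR_anti xi_gt0 (ltW (truncn_log2_gt xi_gt0)) (ltW alpha_gt0).
apply: le_trans (ler_wpM2l (powR_ge0 2 alpha) h).
rewrite -powRrM powRDp //; apply: eq_le_of; congr (_ `^ _).
by rewrite -/kN -natr1; ring.
Qed.

Lemma top_level_small : alpha <= q2^-1 ->
  2 `^ (- (alpha * kN%:R)) <= 4 `^ alpha * N%:R `^ (- alpha).
Proof.
move=> al; apply: le_trans top_level _.
have /andP[_ h] := xi_small al.
rewrite (_ : 4 `^ alpha = 2 `^ alpha * 2 `^ alpha); last first.
  by rewrite -powRM //; congr (_ `^ _); ring.
rewrite -mulrA ler_wpM2l ?powR_ge0 // !powRN ler_pdivlMr ?powR_gt0 //.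
rewrite mulrC ler_pdivrMr ?powR_gt0 // -powRM ?(ltW xi_gt0) //.
by apply: ge0_ler_powR; rewrite ?nnegrE ?mulr_ge0 ?ler0n ?(ltW xi_gt0) ?(ltW alpha_gt0) ?(ltW h).
Qed.

Lemma top_level_large : q2^-1 < alpha ->
  2 `^ (- (alpha * kN%:R)) <= 2 `^ alpha * 2 `^ beta * N%:R `^ (- beta).
Proof.
move=> al; apply: le_trans top_level _.
have /andP[_ h] := xi_large al.
have p0 : 0 < xi `^ p by rewrite powR_gt0.
rewrite -mulrA ler_wpM2l ?powR_ge0 //.
have -> : xi `^ (- alpha) = (xi `^ p) `^ (- beta) by rewrite -powRrM mulrN pbeta.
rewrite !powRN ler_pdivlMr ?powR_gt0 //.
rewrite mulrC ler_pdivrMr ?powR_gt0 // -powRM ?(ltW p0) //.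
by apply: ge0_ler_powR; rewrite ?(ltW beta_gt0) ?nnegrE ?mulr_ge0 ?ler0n ?(ltW p0) ?(ltW h).
Qed.

Lemma sum_small : alpha < q2^-1 ->
  \sum_(1 <= k < kN.+1) level_term N k <=
    2 `^ q1^-1 * (2 `^ (q2^-1 - alpha) / (2 `^ (q2^-1 - alpha) - 1)) * N%:R `^ (- alpha).
Proof.
move=> al; set rho := 2 `^ (q2^-1 - alpha).
have g0 : 0 < q2^-1 - alpha by rewrite subr_gt0.
have r1 : 1 < rho.
  have : 1 `^ (q2^-1 - alpha) < rho by apply: gt0_ltr_powR; rewrite ?nnegrE ?ltr1n.
  by rewrite [X in X < _](_ : _ = 1) // /powR oner_eq0 ln1 mulr0 expR0.
have [k0|k1] := posnP kN.
  by rewrite k0 big_geq // !mulr_ge0 ?powR_ge0 ?invr_ge0 ?subr_ge0 ?(ltW r1).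
apply: (@le_trans _ _ (\sum_(1 <= k < kN.+1) 2 `^ q1^-1 * (rho ^+ k * N%:R `^ (- q2^-1)))).
  by apply: ler_sum_nat => k /andP[hk _]; apply: level_term_small => //; exact: ltW.
rewrite -mulr_sumr -mulr_suml -mulrA ler_wpM2l ?powR_ge0 //.
apply: le_trans (ler_wpM2r (powR_ge0 _ _) (geometric_sum kN r1)) _.
rewrite mulrAC [leRHS]mulrC ler_wpM2r ?divr_ge0 ?powR_ge0 ?subr_ge0 ?(ltW r1) //.
have : rho ^+ kN <= N%:R `^ (q2^-1 - alpha).
  rewrite -powR_mulrn ?powR_ge0 // -powRrM mulrC powRrM.
  by apply: ge0_ler_powR; rewrite ?nnegrE ?powR_ge0 ?ler0n ?(ltW g0) // kN_le.
move=> h; apply: le_trans (ler_wpM2r (powR_ge0 _ _) h) _.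
by rewrite powRDp // addrAC subrr add0r.
Qed.

Lemma sum_levels_le (c : R) : (forall k, (1 <= k)%N -> level_term N k <= c) ->
  \sum_(1 <= k < kN.+1) level_term N k <= kN%:R * c.
Proof.
move=> hc; have -> : kN%:R * c = \sum_(1 <= k < kN.+1) c.
  by rewrite sumr_const_nat subn1 mulr_natl.
by apply: ler_sum_nat => k /andP[hk _]; exact: hc.
Qed.

Definition sum_const : R :=
  2 `^ q1^-1 * (2 `^ (q2^-1 - alpha) / (2 `^ (q2^-1 - alpha) - 1)).

End LevelSum.

Section Rate.
Context {R : realType}.
Variables (q1 q2 alpha eps : R).
Hypotheses (q1_gt0 : 0 < q1) (q1_le_q2 : q1 <= q2) (alpha_gt0 : 0 < alpha) (eps_gt0 : 0 < eps).
Let delta := q1^-1 - q2^-1.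
Let beta := q1^-1 * (alpha / (alpha + delta)).
Let q2_gt0 : 0 < q2. Proof. exact: lt_le_trans q1_le_q2. Qed.
Let i1 : 0 < q1^-1. Proof. by rewrite invr_gt0. Qed.
Let delta_ge0 : 0 <= delta.
Proof. by rewrite subr_ge0 lef_pV2 ?posrE. Qed.
Let ad_gt0 : 0 < alpha + delta. Proof. by rewrite ltr_wpDr. Qed.
Let beta_gt0 : 0 < beta. Proof. by rewrite mulr_gt0 // divr_gt0. Qed.

Lemma size_powR_le (n : nat) (th e : R) : (2 <= n)%N -> 0 <= th -> th <= e ->
  `|Num.ceil (n%:R / log2 n%:R : R)|%N%:R `^ (- th) <= n%:R `^ (- th) * log2 n%:R `^ e :> R.
Proof.
move=> n2 th0 the; apply: le_trans (N_powR_le n2 th0) _.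
by rewrite ler_wpM2l ?powR_ge0 // ler_powR // Lg_ge1.
Qed.

(** At most log n comparable terms: the exponent of log n is raised by 1 on top
    of the exponent th that comes with passing from N to n. *)
Lemma log_sum_rate (n kN : nat) (th e c1 c2 s top : R) : (2 <= n)%N ->
  0 <= th -> th + 1 <= e -> 0 <= c1 -> 0 <= c2 -> kN%:R <= log2 n%:R :> R ->
  let NR : R := `|Num.ceil (n%:R / log2 n%:R : R)|%N%:R in
  s <= kN%:R * (c1 * NR `^ (- th)) -> top <= c2 * NR `^ (- th) ->
  is_true (s + top <= (c1 + c2) * (n%:R `^ (- th) * log2 n%:R `^ e)).
Proof.
move=> n2 th0 the c10 c20 kL NR hs ht; set rate := _ * log2 n%:R `^ e.
have L1 : 1 <= log2 n%:R :> R := Lg_ge1 n2.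
have L0 : 0 < log2 n%:R :> R by exact: lt_le_trans L1.
have h3 : NR `^ (- th) * log2 n%:R <= rate.
  apply: (@le_trans _ _ (n%:R `^ (- th) * log2 n%:R `^ th * log2 n%:R)).
    by rewrite ler_wpM2r ?(ltW L0) //; apply: size_powR_le.
  rewrite /rate -mulrA ler_wpM2l ?powR_ge0 //.
  by rewrite -{2}[log2 n%:R]powRr1 ?(ltW L0) // powRDp // ler_powR.
have h4 : NR `^ (- th) <= rate.
  by apply: le_trans h3; rewrite ler_peMr ?powR_ge0.
apply: le_trans (lerD hs ht) _; rewrite mulrDl; apply: lerD.
  rewrite mulrCA ler_wpM2l //; apply: le_trans h3.
  by rewrite mulrC ler_wpM2l ?powR_ge0.
by rewrite ler_wpM2l.
Qed.

(** The sum of the level errors is of order N^(-alpha) or N^(-beta), with a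
    further factor kN <= log n when the terms are comparable; passing from N to
    n costs (log n)^alpha or (log n)^beta.  The exponents of log n in the rate
    exceed what this requires. *)
Lemma level_sum_rate : exists2 C : R, 0 < C & forall (n : nat) (xi : R),
  (2 <= n)%N ->
  let N := `|Num.ceil (n%:R / log2 n%:R : R)|%N in
  0 < xi ->
  (alpha <= q2^-1 -> xi <= N%:R < 2 * xi) ->
  (q2^-1 < alpha -> xi `^ (q1 * (alpha + delta)) <= N%:R
      < 2 * xi `^ (q1 * (alpha + delta))) ->
  let kN := Num.truncn (log2 xi) in
  let rate : R :=
    if alpha < q2^-1 then
      n%:R `^ (- alpha) * log2 n%:R `^ (alpha + 2^-1 + eps)
    else if alpha == q2^-1 then
      n%:R `^ (- alpha) * log2 n%:R `^ (alpha + 3 / 2 + eps)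
    else
      n%:R `^ (- beta) *
      log2 n%:R `^ (1 + beta * (1 + (2 * alpha)^-1) + eps * beta / alpha) in
  is_true (\sum_(1 <= k < kN.+1) level_term q1 q2 alpha N k + 2 `^ (- (alpha * kN%:R))
    <= C * rate).
Proof.
have [al|[al|al]] : alpha < q2^-1 \/ q2^-1 < alpha \/ alpha = q2^-1.
  by case: (ltgtP alpha q2^-1); auto.
- exists (`|sum_const q1 q2 alpha| + 4 `^ alpha).
    by rewrite ltr_wpDl // powR_gt0.
  move=> n xi n2 N xi0 hs hl kN rate.
  have rE : rate = n%:R `^ (- alpha) * log2 n%:R `^ (alpha + 2^-1 + eps) by rewrite /rate al.
  have N0 : (0 < N)%N by exact: (@N_gt0 R n n2).
  have h1 := sum_small q1_gt0 q1_le_q2 N0 xi0 hs hl al.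
  have h2 := top_level_small alpha_gt0 N0 xi0 hs (ltW al).
  have h3 : N%:R `^ (- alpha) <= rate.
    by rewrite rE; apply: size_powR_le; rewrite ?(ltW alpha_gt0) // -addrA lerDl addr_ge0 ?invr_ge0 // ltW.
  apply: le_trans (lerD h1 h2) _; rewrite -/(sum_const q1 q2 alpha) -mulrDl.
  apply: (@le_trans _ _ ((`|sum_const q1 q2 alpha| + 4 `^ alpha) * N%:R `^ (- alpha))).
    by rewrite ler_wpM2r ?powR_ge0 // lerD2r ler_norm.
  by rewrite ler_wpM2l // addr_ge0 ?powR_ge0.
- exists (2 `^ q1^-1 + 2 `^ alpha * 2 `^ beta).
    by rewrite addr_gt0 ?mulr_gt0 ?powR_gt0.
  move=> n xi n2 N xi0 hs hl kN rate.
  have N0 : (0 < N)%N by exact: (@N_gt0 R n n2).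
  have -> : rate = n%:R `^ (- beta) *
      log2 n%:R `^ (1 + beta * (1 + (2 * alpha)^-1) + eps * beta / alpha).
    by rewrite /rate ltNge (ltW al) gt_eqF.
  apply: log_sum_rate (kN_Lg n2 (kN_le q1_gt0 N0 xi0 hs hl)) _ _ => //.
  + exact: ltW.
  + have g0 : 0 <= beta * (2 * alpha)^-1.
      by apply: mulr_ge0; [exact: ltW|rewrite invr_ge0 mulr_ge0 // ltW].
    have g1 : 0 <= eps * beta / alpha by apply: divr_ge0; [apply: mulr_ge0|]; exact: ltW.
    rewrite mulrDr mulr1; move: g0 g1; set x := _ * _^-1; set y := eps * _ / _.
    by move: beta x y => b x y; lra.
  + by apply: sum_levels_le => k; exact: level_term_large.
  + exact: top_level_large.
- exists (2 `^ q1^-1 + 4 `^ alpha).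
    by rewrite addr_gt0 ?powR_gt0.
  move=> n xi n2 N xi0 hs hl kN rate.
  have N0 : (0 < N)%N by exact: (@N_gt0 R n n2).
  have al' : alpha <= q2^-1 by rewrite al.
  have -> : rate = n%:R `^ (- alpha) * log2 n%:R `^ (alpha + 3 / 2 + eps).
    by rewrite /rate al ltxx eqxx.
  apply: log_sum_rate (kN_Lg n2 (kN_le q1_gt0 N0 xi0 hs hl)) _ _ => //.
  + exact: ltW.
  + by have := eps_gt0; lra.
  + apply: sum_levels_le => k hk.
    have := level_term_small q1_gt0 q1_le_q2 N0 al' hk.
    by rewrite al subrr powRr0 expr1n mul1r.
  + have top := top_level_small alpha_gt0 N0 xi0 hs al'; exact: top.
Qed.
End Rate.

(** * The multilevel operator *)

Section Assembly.
Context {R : realType}.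
Variables (q1 q2 alpha eps K M1 M2 : R).
Hypotheses (q1_gt0 : 0 < q1) (q1_le_q2 : q1 <= q2) (q2_lt2 : q2 < 2).
Hypotheses (alpha_gt0 : 0 < alpha) (eps_gt0 : 0 < eps).
Let q2_gt0 : 0 < q2. Proof. exact: lt_le_trans q1_le_q2. Qed.

(** One summand for the levels sampled with sigma_1 and one for those sampled
    with sigma_2; absolute values make it nonnegative for all M1, M2 and K. *)
Definition level_const : R :=
  rate_const q1 `|M1| * (4 * `|K|) * 2 `^ q1^-1 +
  rate_const q2 `|M2| * (2 * 2 `^ alpha) * 2 `^ q2^-1.

Lemma rate_const_ge0 (q M : R) : 0 <= M -> 0 <= rate_const q M.
Proof. by move=> M0; rewrite mulr_ge0 ?powR_ge0 // addr_ge0 // mulr_ge0 // sqrtr_ge0. Qed.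

Lemma level_const_ge0 : 0 <= level_const.
Proof. by rewrite addr_ge0 // !mulr_ge0 ?powR_ge0 ?rate_const_ge0. Qed.

Lemma level_term_ge0 N k : 0 <= level_term q1 q2 alpha N k.
Proof. by rewrite /level_term; case: ifP => _; rewrite !mulr_ge0 ?powR_ge0. Qed.

Lemma sample_size_powR (N k l : nat) (t : R) : (0 < N)%N -> 0 <= t ->
  N%:R * 2 `^ (- k%:R) <= 2 * l%:R :> R ->
  l%:R `^ (- t) <= 2 `^ t * (2 `^ (k%:R * t) * N%:R `^ (- t)).
Proof.
move=> N0 t0 h; have NR : 0 < N%:R :> R by rewrite ltr0n.
have a0 : 0 < N%:R * 2 `^ (- k%:R) :> R by rewrite mulr_gt0 ?powR_gt0.
have := powR_anti a0 h t0.
rewrite !powRM ?powR_ge0 ?ler0n // -powRrM mulrNN => h2.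
have -> : l%:R `^ (- t) = 2 `^ t * (2 `^ (- t) * l%:R `^ (- t)) :> R.
  by rewrite mulrA powRDp // subrr powRr0 mul1r.
by rewrite ler_wpM2l ?powR_ge0 // [leRHS]mulrC.
Qed.

Context d (U : measurableType d) (mu : probability U R).
Variables (phi : nat -> U -> R[i]) (U0 : set U).
Hypothesis basis : orthonormal_basis mu phi.
Variables (X : normedModType R[i]) (ip : X -> X -> R).
Hypotheses (ipP : real_inner ip) (cX : seq_complete X).
Variables (sigma1 sigma2 : nat -> R) (P : nat -> {linear X -> X}).
Hypothesis sigma1_mono : forall s t, (s <= t)%N -> sigma1 s <= sigma1 t.
Hypothesis sigma1_gt1 : forall s, 1 < sigma1 s.
Hypothesis sigma2_mono : forall s t, (s <= t)%N -> sigma2 s <= sigma2 t.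
Hypothesis sigma2_gt1 : forall s, 1 < sigma2 s.
Hypothesis sigma1_lq : (lq_norm q1 (fun s => (sigma1 s)^-1)%R <= M1%:E)%E.
Hypothesis sigma2_lq : (lq_norm q2 (fun s => (sigma2 s)^-1)%R <= M2%:E)%E.
Hypothesis P_bounded : exists B : R, forall k, (1 <= k)%N -> forall x, nrm (P k x) <= B * nrm x.
Hypothesis U0_dom : evaluation_domain mu X phi sigma1 sigma2 U0.
Hypothesis P_Hat : forall (v : U -> X) m, (1 <= m)%N ->
    Hatspace mu phi sigma1 sigma2 P alpha (1 + eps) v ->
    (Hatnorm mu phi sigma1 sigma2 P alpha (1 + eps) (P m \o v)
      <= K%:E * Hatnorm mu phi sigma1 sigma2 P alpha (1 + eps) v)%E.
Let s1_ge0 s : 0 <= sigma1 s. Proof. exact/ltW/(lt_trans ltr01). Qed.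
Let s2_ge0 s : 0 <= sigma2 s. Proof. exact/ltW/(lt_trans ltr01). Qed.
Let U0_full : mu.-negligible (~` U0). Proof. by case: U0_dom. Qed.

Lemma evaluation_cvg sigma (w : U -> X) b y : sigma = sigma1 \/ sigma = sigma2 ->
  L2 mu w -> 0 <= b -> coef_bound mu phi sigma w b -> U0 y ->
  cvg (pt_series mu phi w y n @[n --> \oo]).
Proof.
move=> hs Lw b0 hb Uy; have [_ h] := U0_dom; apply: h => //.
have Hb : (Hnorm mu phi sigma w < +oo)%E.
  by apply: (@le_lt_trans _ _ b%:E); [exact/HnormP|exact: ltry].
by case: hs => <-; [left|right].
Qed.

Definition level_sampler (k l : nat) (y : nat -> U) (h : nat -> U -> R[i]) (b : R) : Prop :=
  [/\ forall i, (i < l)%N -> U0 (y i) /\ L2C mu (h i),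
      weighted_least_squares phi l y h &
      forall v : U -> X, Haball mu phi sigma1 sigma2 P alpha v ->
      let S := samp_op mu phi l y h (level_diff P v k) in
      L2 mu (fun u => level_diff P v k u - S u) /\
      (L2norm mu (fun u => level_diff P v k u - S u)%R <= b%:E)%E].

(** The weights must be one of the two given sequences, since pointwise
    evaluation on U0 is guaranteed for these. *)
Lemma weighted_level_sample (q M : R) (sigma : nat -> R) (N k l : nat) (b : R) :
  sigma = sigma1 \/ sigma = sigma2 -> 0 < q -> q < 2 ->
  (forall s, 1 < sigma s) -> (forall s t, (s <= t)%N -> sigma s <= sigma t) ->
  (lq_norm q (fun s => (sigma s)^-1)%R <= M%:E)%E ->
  (0 < N)%N -> (1 <= k)%N -> (0 < l)%N -> N%:R * 2 `^ (- k%:R) <= 2 * l%:R :> R ->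
  0 <= b -> (forall v : U -> X, Haball mu phi sigma1 sigma2 P alpha v ->
    coef_bound mu phi sigma (level_diff P v k) b) ->
  exists yh : (nat -> U) * (nat -> U -> R[i]),
    level_sampler k l yh.1 yh.2 (rate_const q `|M| * b *
      (2 `^ q^-1 * (2 `^ (k%:R * q^-1) * N%:R `^ (- q^-1)))).
Proof.
move=> hs q0 qlt2 gt1 mono lq N0 k1 l0 hl b0 hb.
have lq' : (lq_norm q (fun s => (sigma s)^-1)%R <= `|M|%:E)%E.
  by apply: le_trans lq _; rewrite lee_fin ler_norm.
have [y [h [hU hW hE]]] := sampling_rate basis U0_full q0 qlt2 gt1 mono lq' l0.
exists (y, h); split=> // v vB /=.
have Ld := level_diff_L2 P_bounded vB k1; have cb := hb v vB.
have cv i : (i < l)%N -> cvg (pt_series mu phi (level_diff P v k) (y i) n @[n --> \oo]).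
  by move=> il; apply: (evaluation_cvg hs Ld b0 cb); exact: (hU i il).1.
have [LS hS] := hE X ip ipP cX _ _ Ld b0 cv cb.
split; first exact: L2B.
apply: le_trans hS _; rewrite lee_fin mulrAC.
apply: ler_wpM2l; first by rewrite mulr_ge0 ?rate_const_ge0.
by apply: sample_size_powR => //; rewrite invr_ge0 ltW.
Qed.

Lemma level_sample (N k l : nat) : (0 < N)%N -> (1 <= k)%N -> (0 < l)%N ->
  N%:R * 2 `^ (- k%:R) <= 2 * l%:R :> R ->
  exists yh : (nat -> U) * (nat -> U -> R[i]),
    level_sampler k l yh.1 yh.2 (level_const * level_term q1 q2 alpha N k).
Proof.
move=> N0 k1 l0 hl.
have r1 := rate_const_ge0 q1 (normr_ge0 M1); have r2 := rate_const_ge0 q2 (normr_ge0 M2).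
have [uf|uf] := boolP (use_first q1 q2 alpha N k).
- have b0 : 0 <= 4 * `|K| by rewrite mulr_ge0.
  have [yh [hU hW hE]] := weighted_level_sample (or_introl erefl) q1_gt0
    (le_lt_trans q1_le_q2 q2_lt2) sigma1_gt1 sigma1_mono sigma1_lq N0 k1 l0 hl b0
    (fun v vB => level_diff_coef1 basis ipP cX s1_ge0 eps_gt0 P_bounded P_Hat vB k1).
  exists yh; split=> // v /hE [LS hS]; split=> //; apply: le_trans hS _.
  rewrite lee_fin /level_term uf mulrA ler_wpM2r ?mulr_ge0 ?powR_ge0 //.
  by rewrite /level_const lerDl !mulr_ge0 ?powR_ge0.
- have k2 : (2 <= k)%N by case: k k1 uf {hl} => [|[|k]].
  have b0 : 0 <= 2 * 2 `^ alpha * 2 `^ (- (alpha * k%:R)) by rewrite !mulr_ge0 ?powR_ge0.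
  have [yh [hU hW hE]] := weighted_level_sample (or_intror erefl) q2_gt0
    q2_lt2 sigma2_gt1 sigma2_mono sigma2_lq N0 k1 l0 hl b0
    (fun v vB => level_diff_coef2 basis ipP cX s2_ge0 alpha_gt0 P_bounded vB k2).
  exists yh; split=> // v /hE [LS hS]; split=> //; apply: le_trans hS _.
  rewrite lee_fin /level_term (negbTE uf); move: (2 `^ (- (alpha * k%:R))) b0 => D b0.
  have D0 : 0 <= D by move: b0; rewrite pmulr_rge0 // mulr_gt0 ?powR_gt0.
  rewrite [leLHS](_ : _ = rate_const q2 `|M2| * (2 * 2 `^ alpha) * 2 `^ q2^-1 *
    (D * 2 `^ (k%:R * q2^-1) * N%:R `^ (- q2^-1))); last by ring.
  rewrite ler_wpM2r ?mulr_ge0 ?powR_ge0 //.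
  by rewrite /level_const lerDr !mulr_ge0 ?powR_ge0.
Qed.

Lemma sum_level_diff (v : U -> X) u n :
  \sum_(1 <= k < n.+2) level_diff P v k u = P n.+1 (v u).
Proof.
elim: n => [|n IH]; first by rewrite big_nat1.
by rewrite big_nat_recr //= IH level_diffE //= addrC subrK.
Qed.

Lemma L2norm_sum_le (g : U -> X) (f : nat -> U -> X) (a : R) (b : nat -> R) n :
  L2 mu g -> 0 <= a -> (L2norm mu g <= a%:E)%E ->
  (forall k, (1 <= k <= n)%N -> 0 <= b k /\ L2 mu (f k) /\ (L2norm mu (f k) <= (b k)%:E)%E) ->
  L2 mu (fun u => g u + \sum_(1 <= k < n.+1) f k u) /\
  (L2norm mu (fun u => g u + \sum_(1 <= k < n.+1) f k u)%R <=
     (a + \sum_(1 <= k < n.+1) b k)%:E)%E.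
Proof.
move=> Lg a0 hg; elim: n => [|n IH] hf.
  rewrite (_ : (fun u => _) = g) ?big_geq ?addr0 //.
  by apply/funext => u; rewrite big_geq ?addr0.
have [|L h] := IH; first by move=> k /andP[k1 kn]; apply: hf; rewrite k1 leqW.
have [b0 [Lf hb]] : 0 <= b n.+1 /\ L2 mu (f n.+1) /\ (L2norm mu (f n.+1) <= (b n.+1)%:E)%E.
  by apply: hf; rewrite /= leqnn.
have -> : (fun u => g u + \sum_(1 <= k < n.+2) f k u) =
    (fun u => (g u + \sum_(1 <= k < n.+1) f k u) + f n.+1 u).
  by apply/funext => u; rewrite big_nat_recr //= addrA.
rewrite big_nat_recr //= addrA; split; first exact: L2D.
apply: L2norm_triangle => //; rewrite addr_ge0 //.
rewrite big_nat_cond sumr_ge0 // => k /andP[/andP[k1 kn] _].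
by have [|//] := hf k; rewrite k1 ltnW.
Qed.

(** v - P_kN v is the truncation error, and the differences telescope to P_kN v.
    Without any level the operator is 0, and the norm of v is at most 1, the
    value of the truncation term. *)
Lemma multilevel_error (N kN : nat) (Nk : nat -> nat) (y : nat -> nat -> U)
    (h : nat -> nat -> U -> R[i]) (v : U -> X) :
  Haball mu phi sigma1 sigma2 P alpha v ->
  (forall k, (1 <= k <= kN)%N ->
     level_sampler k (Nk k) (y k) (h k) (level_const * level_term q1 q2 alpha N k)) ->
  (L2norm mu (v \- multilevel_op mu phi P kN Nk y h v)%R <=
    ((level_const + 1) * (\sum_(1 <= k < kN.+1) level_term q1 q2 alpha N k +
        2 `^ (- (alpha * kN%:R))))%:E)%E.
Proof.
move=> vB hk; have Lv := ball_L2 vB.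
set top := 2 `^ _; have top0 : 0 <= top by exact: powR_ge0.
pose f k u := level_diff P v k u - samp_op mu phi (Nk k) (y k) (h k) (level_diff P v k) u.
have [g [Lg hg e]] : exists g : U -> X, [/\ L2 mu g, (L2norm mu g <= top%:E)%E &
    (v \- multilevel_op mu phi P kN Nk y h v) =
    (fun u => g u + \sum_(1 <= k < kN.+1) f k u)].
  rewrite /top; case: (kN) => [|n].
    exists v; split=> //.
      have := coef_bound_L2norm basis ipP cX sigma1_gt1 Lv ler01 (ball_coef1 vB).
      by rewrite mulr0 oppr0 powRr0.
    by apply/funext => u; rewrite /= /multilevel_op !big_geq // subr0 addr0.
  exists (fun u => v u - P n.+1 (v u)).
  have LP : L2 mu (fun u => v u - P n.+1 (v u)).
    by apply: L2B => //; exact: (P_L2 P_bounded _ Lv).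
  split=> //.
    apply: (coef_bound_L2norm basis ipP cX sigma2_gt1 LP (powR_ge0 _ _)).
    exact: (ball_coef2 vB).
  apply/funext => u; rewrite /= /multilevel_op /f sumrB sum_level_diff addrA subrK.
  by [].
have hf k : (1 <= k <= kN)%N -> 0 <= level_const * level_term q1 q2 alpha N k /\
    L2 mu (f k) /\ (L2norm mu (f k) <= (level_const * level_term q1 q2 alpha N k)%:E)%E.
  by move=> /hk[_ _ /(_ v vB) hk']; split=> //; rewrite mulr_ge0 ?level_const_ge0 ?level_term_ge0.
have [_ hh] := L2norm_sum_le Lg top0 hg hf.
rewrite e; apply: le_trans hh _; rewrite lee_fin -mulr_sumr addrC mulrDr.
have c0 := level_const_ge0.
have s0 : 0 <= \sum_(1 <= k < kN.+1) level_term q1 q2 alpha N k.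
  by apply: sumr_ge0 => k _; exact: level_term_ge0.
by apply: lerD; [rewrite ler_wpM2r // lerDl|rewrite ler_peMl // lerDr].
Qed.

End Assembly.

Theorem theorem2p2 (R : realType) (q1 q2 alpha eps K M1 M2 : R)
  (q1_gt0 : 0 < q1) (q1_le_q2 : q1 <= q2) (q2_lt2 : q2 < 2)
  (alpha_gt0 : 0 < alpha) (eps_gt0 : 0 < eps) :
  let delta := q1^-1 - q2^-1 in
  let beta := q1^-1 * (alpha / (alpha + delta)) in
  exists2 C : R, 0 < C &
  forall (d : measure_display) (U : topMeasurableType d)
    (mu : probability U R)
    (X : completeNormedModType R[i]) (dot : {dot X for Num.conj})
    (phi : nat -> U -> R[i]) (sigma1 sigma2 : nat -> R)
    (V : nat -> set X) (P : nat -> {linear X -> X})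
    (U0 : set U) (xi : nat -> R),
  separable_space U ->
  separable_space X -> (forall x : X, `|x| ^+ 2 = dot x x) ->
  orthonormal_basis mu phi ->
  (forall s t, (s <= t)%N -> sigma1 s <= sigma1 t) -> (forall s, 1 < sigma1 s) ->
  (forall s t, (s <= t)%N -> sigma2 s <= sigma2 t) -> (forall s, 1 < sigma2 s) ->
  (lq_norm q1 (fun s => (sigma1 s)^-1)%R <= M1%:E)%E ->
  (lq_norm q2 (fun s => (sigma2 s)^-1)%R <= M2%:E)%E ->
  (forall k, (1 <= k)%N -> has_dimension (V k) (2 ^ k.-1)) ->
  projectors V P ->
  evaluation_domain mu X phi sigma1 sigma2 U0 ->
  (forall n, (1 <= n)%N -> 0 < xi n) ->
  (forall n m, (1 <= n < m)%N -> xi n < xi m) ->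
  (alpha <= q2^-1 -> forall n, (1 <= n)%N -> xi n <= n%:R < 2 * xi n) ->
  (q2^-1 < alpha -> forall n, (1 <= n)%N ->
    xi n `^ (q1 * (alpha + delta)) <= n%:R
      < 2 * xi n `^ (q1 * (alpha + delta))) ->
  (forall v m, (1 <= m)%N ->
    Hatspace mu phi sigma1 sigma2 P alpha (1 + eps) v ->
    (Hatnorm mu phi sigma1 sigma2 P alpha (1 + eps) (P m \o v)
      <= K%:E * Hatnorm mu phi sigma1 sigma2 P alpha (1 + eps) v)%E) ->
  forall n : nat, (2 <= n)%N ->
  let N := `|Num.ceil (n%:R / log2 n%:R : R)|%N in
  let Nk := fun k : nat => (N %/ 2 ^ k)%N in
  let kN := Num.truncn (log2 (xi N)) in
  let rate : R :=
    if alpha < q2^-1 then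
      n%:R `^ (- alpha) * log2 n%:R `^ (alpha + 2^-1 + eps)
    else if alpha == q2^-1 then
      n%:R `^ (- alpha) * log2 n%:R `^ (alpha + 3 / 2 + eps)
    else
      n%:R `^ (- beta) *
      log2 n%:R `^ (1 + beta * (1 + (2 * alpha)^-1) + eps * beta / alpha) in
  exists (y : nat -> nat -> U) (h : nat -> nat -> U -> R[i]),
    [/\ forall k, (1 <= k <= kN)%N -> forall i, (i < Nk k)%N ->
          U0 (y k i) /\ L2C mu (h k i),
        forall k, (1 <= k <= kN)%N ->
          weighted_least_squares phi (Nk k) (y k) (h k),
        comp_cost R kN Nk <= n%:R &
        (ereal_sup
           [set L2norm mu (v \- multilevel_op mu phi P kN Nk y h v)%R
           | v in Haball mu phi sigma1 sigma2 P alpha]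
         <= (C * rate)%:E)%E].

Proof.
move=> delta beta.
have q2_gt0 : 0 < q2 by exact: lt_le_trans q1_le_q2.
have [C0 C0_gt0 hC0] := level_sum_rate q1_gt0 q1_le_q2 alpha_gt0 eps_gt0.
have c0 := level_const_ge0 q1 q2 alpha K M1 M2.
have c1 : 0 < level_const q1 q2 alpha K M1 M2 + 1 by rewrite ltr_wpDl.
exists ((level_const q1 q2 alpha K M1 M2 + 1) * C0); first exact: mulr_gt0.
move=> d U mu X dot phi sigma1 sigma2 V P U0 xi _ _ hdot basis mono1 gt1 mono2 gt2
  lq1 lq2 _ [_ _ Pb] dom xi0 _ xis xil PH n n2 N Nk kN rate.
have ipP := dot_real_inner hdot.
have cX := @seq_completeX R X.
have N0 : (0 < N)%N by exact: (@N_gt0 R n n2).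
have xiN := xi0 N N0.
have hs : alpha <= q2^-1 -> xi N <= N%:R < 2 * xi N by move=> al; exact: xis.
have hl : q2^-1 < alpha -> xi N `^ (q1 * (alpha + delta)) <= N%:R
    < 2 * xi N `^ (q1 * (alpha + delta)) by move=> al; exact: xil.
have k2N : (1 <= kN)%N -> 2 `^ kN%:R <= N%:R :> R := kN_le q1_gt0 N0 xiN hs hl.
have /choice[yh hyh] : forall k, exists yh : (nat -> U) * (nat -> U -> R[i]),
  (1 <= k <= kN)%N -> level_sampler alpha mu phi U0 sigma1 sigma2 P k (Nk k) yh.1 yh.2
    (level_const q1 q2 alpha K M1 M2 * level_term q1 q2 alpha N k).
  move=> k; have [hk|hk] := boolP (1 <= k <= kN)%N; last first.
    have [y0 _] := U0_nonempty dom.1.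
    by exists ((fun=> y0), (fun _ _ => 0)).
  have [k1 _] := andP hk.
  have [yh h] := level_sample q1_gt0 q1_le_q2 q2_lt2 alpha_gt0 eps_gt0 basis ipP cX
    mono1 gt1 mono2 gt2 lq1 lq2 Pb dom PH N0 k1 (Nk_gt0 k2N hk) (Nk_ge n2 k2N hk).
  by exists yh => _.
exists (fun k => (yh k).1), (fun k => (yh k).2); split.
- by move=> k /hyh[+ _ _].
- by move=> k /hyh[_ + _].
- exact: (cost_le n2 k2N).
- apply: ge_ereal_sup => _ [v vB <-].
  have he := multilevel_error (h := fun k => (yh k).2) basis ipP cX gt1 gt2 Pb vB hyh.
  apply: le_trans he _; rewrite lee_fin -mulrA ler_wpM2l ?(ltW c1) //.
  exact: (hC0 n (xi N) n2 xiN hs hl).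
Qed.
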